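(* Let $(Z_t)_{t\ge0}=(X_t,\Theta_t)_{t\ge0}$ be a Speed Up Zig-Zag (SUZZ) process with strictly positive speed function $s\in C^2(\mathbb{R}^d)$ and rates $\lambda_i(x,\theta)=[\theta_iA_i(x)]^++\gamma_i(x,\theta_{-i})$, where $A_i(x)=s(x)\partial_iU(x)-\partial_is(x)$. Assume: 1. There is $\bar\gamma$ such that $\gamma_i(x,\theta_{-i})=\gamma_i(x)\le\bar\gamma$ for all $i$ and $(x,\theta)\in E$; and there exist $R>0$, $A>0$ such that for all $x\notin B(0,R)$, $\sum_{i=1}^d|A_i(x)|>A>\max\{3d\bar\gamma,\,4d(d-1)\bar\gamma\}$. 2. With $h_0(u)=u$ and $h_n(u)=\log(1+h_{n-1}(u))$ for $u\ge0$, $n\ge1$, there exists $n\in\mathbb{N}$ such that $$\lim_{\|x\|\to\infty}\frac{h_n\big(s(x)\|\nabla(U(x)-\log s(x))\|_1\big)}{U(x)-\log s(x)}=0.$$ 3. $A_j\in C^1$ for all $j$, and for every $\delta>0$, $$\lim_{\|x\|\to\infty}\sum_{i=1}^d\sum_{j=1}^d\frac{s(x)}{\sum_{k=1}^d|A_k(x)|}\cdot\frac{|\partial_iA_j(x)|}{(1+|A_j(x)|)\big(1+\log(1+\delta|A_j(x)|)\big)}=0.$$ 4. $\lim_{\|x\|\to\infty}\|x\|^{d-1}s(x)e^{-U(x)}=0$. Then the SUZZ process has the measure $\mu(dx,d\theta)=\frac{1}{2^dH}e^{-U(x)}dx\,d\theta$ as invariant measure.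
   Context: Setting: $E=\mathbb{R}^d\times\{-1,+1\}^d$; $U\in C^1(\mathbb{R}^d)$ with $H=\int e^{-U}dx<\infty$; $d\theta$ is counting measure on $\{-1,+1\}^d$. $a^+=\max\{a,0\}$; $F_j(\theta)$ is $\theta$ with its $j$-th coordinate sign flipped. The refresh rates $\gamma_i$ are non-negative, locally bounded and (locally) integrable, and $\gamma_i$ does not depend on the $i$-th component of $\theta$. SUZZ process: let $\Phi_t(x,\theta)$, $t\in[0,t^*(x,\theta))$, be the maximal solution of $\frac{d}{dt}\Phi_t=\theta s(\Phi_t)$, $\Phi_0=x$, with explosion time $t^*(x,\theta)\in(0,+\infty]$. Started from $(x,\theta)$, the process follows $X_t=\Phi_t(x,\theta)$, $\Theta_t=\theta$ until the first switching time $T_1$, where $\mathbb{P}(T_1\ge t)=\exp\{-\int_0^t\sum_i\lambda_i(\Phi_u(x,\theta),\theta)du\}$ for $t<t^*(x,\theta)$; if no switch occurs before $t^*(x,\theta)$, then $T_1=+\infty$ and the process is sent to a graveyard state $\partial$ at time $t^*(x,\theta)$. If $T_1<t^*(x,\theta)$, the velocity at time $T_1$ becomes $F_j(\theta)$ with probability $\lambda_j/\sum_i\lambda_i$ evaluated at $(X_{T_1},\theta)$, and the construction restarts independently from $(X_{T_1},F_j(\theta))$, giving successive switching times $T_1<T_2<\cdots$. With $\xi=\lim_nT_n$, if $\xi<\infty$ the process is in $\partial$ from time $\xi$ on. $\mathbb{N}=\{1,2,\dots\}$. *)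

(* Defs.v *)
From HB Require Import structures.
From mathcomp Require Import all_boot all_order all_algebra.
From mathcomp Require Import all_classical all_reals all_analysis.
From mathcomp Require Import measurable_realfun.

Set Implicit Arguments.
Unset Strict Implicit.
Unset Printing Implicit Defensive.

Import Order.TTheory GRing.Theory Num.Theory.
Import numFieldNormedType.Exports.

Local Open Scope classical_set_scope.
Local Open Scope ring_scope.

(** * The measurable space R^d and its Lebesgue measure *)

Definition rV_display : measure_display -> measure_display.
Proof. exact. Qed.

Section measurable_rV.
Context (R : realType) (d : nat).

Let coor (i : 'I_d) (x : 'rV[R]_d) : R := x 0 i.

Let rV_set0 : g_sigma_preimage coor set0.
Proof. exact: sigma_algebra0. Qed.

Let rV_setC A : g_sigma_preimage coor A -> g_sigma_preimage coor (~` A).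
Proof. exact: sigma_algebraC. Qed.

Let rV_bigcup (F : _^nat) : (forall i, g_sigma_preimage coor (F i)) ->
  g_sigma_preimage coor (\bigcup_i (F i)).
Proof. exact: sigma_algebra_bigcup. Qed.

(* The product sigma-algebra; it contains the open sets, see [open_measurable_rV],
   so that it is the Borel sigma-algebra. *)
HB.instance Definition _ := @isMeasurable.Build (rV_display default_measure_display)
  'rV[R]_d (g_sigma_preimage coor) rV_set0 rV_setC rV_bigcup.

Lemma measurable_coor (i : 'I_d) :
  measurable_fun [set: 'rV[R]_d] (fun x : 'rV[R]_d => x 0 i).
Proof.
move=> _ Y mY; rewrite setTI; apply: sub_sigma_algebra => /=.
rewrite -bigcup_seq/=; exists i => /=; first by rewrite mem_index_enum.
by exists Y => //; rewrite setTI.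
Qed.

Lemma measurable_fun_rVP d' (T : measurableType d') (f : T -> 'rV[R]_d) :
  (forall i, measurable_fun [set: T] (fun t => f t 0 i)) ->
  measurable_fun [set: T] f.
Proof.
move=> mf.
suff H : g_sigma_preimage coor `<=` [set A | measurable (f @^-1` A)].
  by move=> _ A mA; rewrite setTI; exact: H.
apply: smallest_sub.
  split=> /=.
  - by rewrite preimage_set0.
  - by move=> A mA; rewrite setTD preimage_setC; exact: measurableC.
  - by move=> F mF; rewrite preimage_bigcup; exact: bigcupT_measurable.
rewrite -bigcup_seq => A [/= i _ [B mB <-]] /=.
rewrite setTI -comp_preimage.
by have := mf i measurableT B mB; rewrite setTI.
Qed.

Lemma open_measurable_rV (A : set 'rV[R]_d) : open A -> measurable A.
Proof.
move=> oA.
pose Q (q : 'rV[rat]_d) (k : nat) :=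
  [set x : 'rV[R]_d | forall i, `|ratr (q 0 i) - x 0 i| < k.+1%:R^-1].
have mQ q k : measurable (Q q k).
  rewrite (_ : Q q k = \bigcap_(i in [set: 'I_d])
     ((fun x : 'rV[R]_d => x 0 i) @^-1`
        ball (ratr (q 0 i) : R) (k.+1%:R^-1))); last first.
    by apply/seteqP; split=> x H i; [move=> _|]; exact: H.
  apply: fin_bigcap_measurable => // i _.
  have := @measurable_coor i measurableT (ball (ratr (q 0 i) : R) k.+1%:R^-1).
  by rewrite setTI; apply; apply: open_measurable; exact: ball_open.
rewrite (_ : A = \bigcup_(p in [set p : 'rV[rat]_d * nat | Q p.1 p.2 `<=` A])
   Q p.1 p.2); last first.
  apply/seteqP; split=> [x Ax|x [p /= pA]]; last exact: pA.
  have /nbhs_ballP[e /= e0 eA] : nbhs x A by exact: open_nbhs_nbhs.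
  have [k ke] : exists k, k.+1%:R^-1 < e / 2.
    have [k _ /(_ _ (leqnn _))/=] :=
      near_infty_natSinv_lt (PosNum (divr_gt0 e0 (ltr0n R 2))).
    by exists k.
  have H i : exists q : rat, `|ratr q - x 0 i| < k.+1%:R^-1.
    have k0 : x 0 i < x 0 i + k.+1%:R^-1 by rewrite ltrDl invr_gt0.
    have [q] := rat_in_itvoo k0.
    rewrite in_itv/= => /andP[q1 q2]; exists q.
    by rewrite gtr0_norm ?subr_gt0// ltrBlDl.
  have [g gP] := choice H.
  exists (\row_i g i, k); last by move=> i /=; rewrite mxE.
  move=> y /= yQ; apply: eA; split => // a i; rewrite ord1.
  have := yQ i; rewrite mxE => yg.
  rewrite /ball/= (_ : x 0 i - y 0 i =
    (x 0 i - ratr (g i)) + (ratr (g i) - y 0 i)); last by rewrite addrA subrK.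
  rewrite (le_lt_trans (ler_normD _ _))// (splitr e) ltrD//.
    by rewrite distrC (lt_trans (gP i)).
  exact: lt_trans yg ke.
rewrite bigcup_mkcond; apply: countable_bigcupT_measurable => //= p.
by case: ifP.
Qed.

Lemma continuous_measurable_rV (f : 'rV[R]_d -> R) :
  continuous f -> measurable_fun [set: 'rV[R]_d] f.
Proof.
move=> /continuousP cf.
apply: (measurability _ (RGenOpens.measurableE R)).
move=> _ [_ [a [b ->] <-]]; rewrite setTI; apply: open_measurable_rV.
exact/cf/interval_open.
Qed.

End measurable_rV.

Lemma product_sigma_finite d1 d2 (T1 : measurableType d1)
    (T2 : measurableType d2) (R : realType)
    (m1 : {sigma_finite_measure set T1 -> \bar R})
    (m2 : {sigma_finite_measure set T2 -> \bar R}) :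
  sigma_finite setT (m1 \x m2)%E.
Proof.
have /sigma_finiteP[F [TF ndF Foo]] := sigma_finiteT m1.
have /sigma_finiteP[G [TG ndG Goo]] := sigma_finiteT m2.
exists (fun n => F n `*` G n).
  rewrite -setXTT TF TG predeqE => -[x y]; split.
    move=> [/= [n _ Fnx] [k _ Gky]]; exists (maxn n k) => //; split.
    - by move: x Fnx; exact/subsetPset/ndF/leq_maxl.
    - by move: y Gky; exact/subsetPset/ndG/leq_maxr.
  by move=> [n _ []/= ? ?]; split; exists n.
move=> k; have [? ?] := Foo k; have [? ?] := Goo k.
split; first exact: measurableX.
by rewrite product_measure1E// lte_mul_pinfty// ge0_fin_numE.
Qed.

Section lebesgue_rV.
Context (R : realType).

(* Lebesgue measure on R^(n+1) is the image of the product of the Lebesgue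
   measures on R and R^n under (a, x) |-> [a, x]. *)
Definition cons_rV n (p : R * 'rV[R]_n) : 'rV[R]_n.+1 :=
  \row_i (if unlift ord0 i is Some j then p.2 0 j else p.1).

Lemma measurable_cons_rV n : measurable_fun [set: R * 'rV[R]_n] (@cons_rV n).
Proof.
apply: measurable_fun_rVP => i; rewrite /cons_rV.
case: (unliftP ord0 i) => [j|] ->; under eq_fun do rewrite mxE ?liftK ?unlift_none.
  by apply: (measurableT_comp (@measurable_coor R n j)); exact: measurable_snd.
exact: measurable_fst.
Qed.

Section step.
Context n (m : {sigma_finite_measure set 'rV[R]_n -> \bar R}).

Let push := pushforward (@lebesgue_measure R \x m)%E (@cons_rV n).

Let push0 : push set0 = 0%E.
Proof. by rewrite /push /pushforward preimage_set0 measure0. Qed.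

Let push_ge0 A : (0 <= push A)%E.
Proof. exact: (measure_ge0 (@lebesgue_measure R \x m)%E). Qed.

Let mpre (A : set 'rV[R]_n.+1) : measurable A -> measurable (@cons_rV n @^-1` A).
Proof.
by move=> mA; rewrite -[X in measurable X]setTI; exact: measurable_cons_rV.
Qed.

Let push_sigma_additive : semi_sigma_additive push.
Proof.
move=> F mF tF mUF; rewrite /push /pushforward preimage_bigcup.
apply: measure_semi_sigma_additive.
- by move=> k; exact: mpre.
- apply/trivIsetP => /= i j _ _ ij; rewrite -preimage_setI.
  by move/trivIsetP : tF => /(_ _ _ _ _ ij) ->//; rewrite preimage_set0.
- by rewrite -preimage_bigcup; exact: mpre.
Qed.

HB.instance Definition _ := isMeasure.Build _ _ _ push
  push0 push_ge0 push_sigma_additive.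

Let push_sigma_finite : sigma_finite setT push.
Proof.
have [F FT Ffin] := product_sigma_finite (@lebesgue_measure R) m.
pose split_rV (x : 'rV[R]_n.+1) : R * 'rV[R]_n :=
  (x 0 ord0, \row_i x 0 (lift ord0 i)).
have msplit : measurable_fun [set: 'rV[R]_n.+1] split_rV.
  apply: measurable_fun_pair; first exact: measurable_coor.
  apply: measurable_fun_rVP => i; under eq_fun do rewrite mxE.
  exact: measurable_coor.
have consK p : split_rV (cons_rV p) = p.
  case: p => a x; rewrite /split_rV /cons_rV !mxE unlift_none/=.
  by congr (_, _); apply/rowP => i; rewrite !mxE liftK.
exists (fun k => split_rV @^-1` F k).
  by rewrite -preimage_bigcup -FT preimage_setT.
move=> k; have [mFk Fk] := Ffin k; split.
  by rewrite -[X in measurable X]setTI; exact: msplit.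
rewrite /push /pushforward -comp_preimage (_ : _ \o _ = id)//.
by apply/funext => p /=; exact: consK.
Qed.

HB.instance Definition _ := Measure_isSigmaFinite.Build _ _ _ push
  push_sigma_finite.

Definition lebesgue_rV_step :
  {sigma_finite_measure set 'rV[R]_n.+1 -> \bar R} := push.

End step.

Fixpoint lebesgue_rV (n : nat) : {sigma_finite_measure set 'rV[R]_n -> \bar R} :=
  match n with
  | 0 => \d_(0 : 'rV[R]_0)
  | n'.+1 => lebesgue_rV_step (lebesgue_rV n')
  end.

End lebesgue_rV.

Section density.
Local Open Scope ereal_scope.
Context disp (T : measurableType disp) (R : realType).
Context (m : {measure set T -> \bar R}) (f : T -> R).
Hypothesis mf : measurable_fun [set: T] f.
Hypothesis f0 : forall x, (0 <= f x)%R.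

Let nu (A : set T) := \int[m]_(x in A) (f x)%:E.

Let nu0 : nu set0 = 0.
Proof. by rewrite /nu integral_set0. Qed.

Let nu_ge0 A : 0 <= nu A.
Proof. by apply: integral_ge0 => x _; rewrite lee_fin. Qed.

Let nu_sigma_additive : semi_sigma_additive nu.
Proof.
move=> A mA tA mUA; rewrite /nu/= ge0_integral_bigcup//=.
- apply: is_cvg_ereal_nneg_natsum_cond => n _ _.
  by apply: integral_ge0 => /= x ?; rewrite lee_fin.
- by apply/measurable_EFinP; exact: measurable_funTS.
- by move=> x _; rewrite lee_fin.
Qed.

HB.instance Definition _ := isMeasure.Build _ _ _ nu
  nu0 nu_ge0 nu_sigma_additive.

Definition density : {measure set T -> \bar R} := nu.

Lemma densityE A : density A = \int[m]_(x in A) (f x)%:E.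
Proof. by []. Qed.

End density.

(** * Velocities *)

(* {-1,+1}^d, with [true] encoding +1 and [false] encoding -1 *)
Definition velocity (d : nat) := {ffun 'I_d -> bool}.

HB.instance Definition _ d := Finite.on (velocity d).
HB.instance Definition _ d := isPointed.Build (velocity d) [ffun=> true].
HB.instance Definition _ d := @isMeasurable.Build default_measure_display
  (velocity d) discrete_measurable discrete_measurable0
  discrete_measurableC discrete_measurableU.

(* An alias, because the library attaches the sigma-finiteness of [counting] to
   the carrier nat. *)
Definition counting_velocity (R : realType) (d : nat) : set (velocity d) -> \bar R :=
  @counting (velocity d) R.
Arguments counting_velocity R d : clear implicits.

HB.instance Definition _ (R : realType) d :=
  Measure.copy (counting_velocity R d) (@counting (velocity d) R).

Lemma sigma_finite_counting_velocity (R : realType) d :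
  sigma_finite [set: velocity d] (counting_velocity R d).
Proof.
exists (fun=> setT); first by rewrite bigcup_const.
move=> k; split => //; rewrite /counting_velocity /counting/= asboolT ?ltry//.
Qed.

HB.instance Definition _ (R : realType) d :=
  Measure_isSigmaFinite.Build _ _ _ (counting_velocity R d)
    (sigma_finite_counting_velocity R d).

(** * Calculus on R^d *)

Section calculus.
Context (R : realType) (d : nat).
Implicit Types (f : 'rV[R]_d -> R) (x : 'rV[R]_d).

(* The library norm on ['rV_d] is the sup norm. *)
Definition eucl_norm x : R := Num.sqrt (\sum_i x 0 i ^+ 2).

(* the filter of neighbourhoods of infinity: [F x @[x --> eucl_infty] --> l]
   means that F x tends to l as ||x|| tends to infinity *)
Definition eucl_infty : set_system 'rV[R]_d :=
  [set S | exists M : R, forall x, M < eucl_norm x -> S x].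

#[global] Instance eucl_infty_filter : Filter eucl_infty.
Proof.
split; first by exists 0.
- move=> P Q [M MP] [N NQ]; exists (Num.max M N) => x.
  by rewrite gt_max => /andP[/MP Px /NQ Qx].
- by move=> P Q PQ [M MP]; exists M => x /MP /PQ.
Qed.

Definition partial (i : 'I_d) f x : R := 'D_(delta_mx 0 i) f x.

Definition C1 f : Prop :=
  (forall x, differentiable f x) /\ (forall i, continuous (partial i f)).

Definition C2 f : Prop := C1 f /\ (forall i, C1 (partial i f)).

Lemma C1_continuous f : C1 f -> continuous f.
Proof. by move=> [df _] x; exact: differentiable_continuous. Qed.

End calculus.

Arguments eucl_infty {R d}.

(* the iterated logarithms h_n *)
Fixpoint iter_log (R : realType) (n : nat) (u : R) : R :=
  if n is n'.+1 then ln (1 + iter_log n' u) else u.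

(** * The Speed Up Zig-Zag process *)

Section suzz.
Context (R : realType) (d : nat).

Local Notation E := ('rV[R]_d * velocity d)%type.

Definition flip (j : 'I_d) (th : velocity d) : velocity d :=
  [ffun i => if i == j then ~~ th i else th i].

Definition sgn (th : velocity d) (i : 'I_d) : R := if th i then 1 else -1.

Definition velocity_rV (th : velocity d) : 'rV[R]_d := \row_i sgn th i.

Definition drift (U s : 'rV[R]_d -> R) (i : 'I_d) (x : 'rV[R]_d) : R :=
  s x * partial i U x - partial i s x.

Definition suzz_rate (U s : 'rV[R]_d -> R)
    (gamma : 'I_d -> 'rV[R]_d -> velocity d -> R) (i : 'I_d) (z : E) : R :=
  Num.max (sgn z.2 i * drift U s i z.1) 0 + gamma i z.1 z.2.

Definition refresh_rates (gamma : 'I_d -> 'rV[R]_d -> velocity d -> R) : Prop :=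
  [/\ forall i x th, 0 <= gamma i x th,
      forall i x th, gamma i x (flip i th) = gamma i x th,
      forall i (x : 'rV[R]_d) th, exists M, \forall y \near x, gamma i y th <= M,
      forall i th, measurable_fun [set: 'rV[R]_d] (gamma i ^~ th) &
      forall i th (K : set 'rV[R]_d), compact K ->
        (lebesgue_rV R d).-integrable K (fun x => (gamma i x th)%:E)].

(* [phi] solves phi' = theta s(phi), phi(0) = x on [0, b), where z = (x, theta) *)
Definition solves_flow (s : 'rV[R]_d -> R) (z : E) (b : \bar R)
    (phi : R -> 'rV[R]_d) : Prop :=
  [/\ phi 0 = z.1,
      phi t @[t --> 0^'+] --> phi 0 &
      forall t : R, 0 < t -> (t%:E < b)%E ->
        is_derive t 1 phi (s (phi t) *: velocity_rV z.2)].

(* [Phi ^~ z] on [0, tstar z) is the maximal solution started from z; the values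
   of [Phi t z] for t outside [0, tstar z) are irrelevant. *)
Definition maximal_flow (s : 'rV[R]_d -> R)
    (Phi : R -> E -> 'rV[R]_d) (tstar : E -> \bar R) : Prop :=
  forall z, [/\ (0 < tstar z)%E, solves_flow s z (tstar z) (Phi ^~ z) &
    forall b psi, (0 < b)%E -> solves_flow s z b psi -> (b <= tstar z)%E].

Section process.
Context (disp : measure_display) (Omega : measurableType disp).
Variables (T : nat -> Omega -> \bar R) (Y : nat -> Omega -> E).

(* sigma(T_0, Y_0, ..., T_n, Y_n) *)
Definition history (n : nat) : set_system Omega :=
  <<s \bigcup_(k in [set k | (k <= n)%N])
        (preimage_set_system setT (T k) measurable `|`
         preimage_set_system setT (Y k) measurable) >>.

(* sigma(T_0, Y_0, ..., T_n, Y_n, T_{n+1}) *)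
Definition history_switch (n : nat) : set_system Omega :=
  <<s history n `|` preimage_set_system setT (T n.+1) measurable >>.

(* The law of the process started from z is governed by [P z]. [T n] is the n-th
   switching time, with T_0 = 0, [Y n] is the state right after it (meaningful
   only if T_n is finite), and the graveyard state is [None]. *)
Record suzz_process (s : 'rV[R]_d -> R) (lambda : 'I_d -> E -> R)
    (P : E -> probability Omega R) (Z : R -> Omega -> option E)
    (Phi : R -> E -> 'rV[R]_d) (tstar : E -> \bar R) : Prop := {
  suzz_flow : maximal_flow s Phi tstar;
  suzz_measurable_time : forall n, measurable_fun [set: Omega] (T n);
  suzz_measurable_state : forall n, measurable_fun [set: Omega] (Y n);
  suzz_time0 : forall w, T 0 w = 0%E;
  suzz_start : forall z, P z [set w | Y 0 w = z] = 1%E;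
  suzz_time_stop : forall n w, T n w = +oo%E -> T n.+1 w = +oo%E;
  suzz_time_incr : forall n w, (T n w < +oo -> T n w < T n.+1 w)%E;
  suzz_time_explosion : forall n w, (T n.+1 w < +oo ->
    T n.+1 w < T n w + tstar (Y n w))%E;
  suzz_switch_position : forall n w, (T n.+1 w < +oo)%E ->
    (Y n.+1 w).1 = Phi (fine (T n.+1 w) - fine (T n w)) (Y n w);
  suzz_switch_velocity : forall n w, (T n.+1 w < +oo)%E ->
    exists j, (Y n.+1 w).2 = flip j (Y n w).2;
  (* given the first n switches, the next one occurs after an additional time
     at least t with probability exp(- int_0^t sum_i lambda_i(Phi_u, theta) du) *)
  suzz_time_law : forall z n (t : R) (B : set Omega), 0 <= t -> history n B ->
    let D := B `&` [set w | (T n w < +oo)%E /\ (t%:E < tstar (Y n w))%E] in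
    P z (D `&` [set w | (T n w + t%:E <= T n.+1 w)%E]) =
    (\int[P z]_(w in D) (expR (- \int[lebesgue_measure]_(u in `[0%R, t])
        (\sum_i lambda i (Phi u (Y n w), (Y n w).2))%R))%:E)%E;
  (* given moreover the (n+1)-st switching time, the j-th coordinate of the
     velocity flips with probability lambda_j / sum_i lambda_i *)
  suzz_velocity_law : forall z n j (B : set Omega), history_switch n B ->
    let D := B `&` [set w | (T n.+1 w < +oo)%E] in
    P z (D `&` [set w | (Y n.+1 w).2 = flip j (Y n w).2]) =
    (\int[P z]_(w in D) (lambda j ((Y n.+1 w).1, (Y n w).2) /
        \sum_i lambda i ((Y n.+1 w).1, (Y n w).2))%:E)%E;
  suzz_path : forall n (t : R) w, (T n w <= t%:E)%E -> (t%:E < T n.+1 w)%E ->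
    (t%:E < T n w + tstar (Y n w))%E ->
    Z t w = Some (Phi (t - fine (T n w)) (Y n w), (Y n w).2);
  suzz_flow_explosion : forall n (t : R) w,
    (T n w <= t%:E)%E -> (t%:E < T n.+1 w)%E ->
    (T n w + tstar (Y n w) <= t%:E)%E -> Z t w = None;
  suzz_switch_explosion : forall (t : R) w,
    (limn (fun n => T n w) <= t%:E)%E -> Z t w = None
}.

(* mu P_t = mu for all t >= 0, with P_t(z, B) = P_z(Z_t in B) *)
Definition invariant_measure (P : E -> probability Omega R)
    (Z : R -> Omega -> option E) (mu : {measure set E -> \bar R}) : Prop :=
  forall (t : R) (B : set E), 0 <= t -> measurable B ->
    (\int[mu]_z P z [set w | exists2 y, B y & Z t w = Some y] = mu B)%E.

End process.

(** * The target measure *)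

(* the base measure dx dtheta, dtheta being the counting measure *)
Definition base_measure : {measure set E -> \bar R} :=
  (lebesgue_rV R d \x counting_velocity R d)%E.

(* H, provided that it is finite *)
Definition normalization (U : 'rV[R]_d -> R) : R :=
  \int[lebesgue_rV R d]_x expR (- U x).

Definition target_pdf (U : 'rV[R]_d -> R) (z : E) : R :=
  (2 ^+ d * normalization U)^-1 * expR (- U z.1).

Lemma measurable_target_pdf U : continuous U ->
  measurable_fun [set: E] (target_pdf U).
Proof.
move=> cU; apply: measurable_funM; first exact: measurable_cst.
apply: measurableT_comp; first exact: measurable_expR.
apply: measurableT_comp; first exact: oppr_measurable.
apply: measurableT_comp; first exact: continuous_measurable_rV.
exact: measurable_fst.
Qed.

Lemma target_pdf_ge0 U z : 0 <= target_pdf U z.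
Proof.
rewrite mulr_ge0 ?expR_ge0// invr_ge0 mulr_ge0 ?exprn_ge0//.
by apply: Rintegral_ge0 => x _; exact: expR_ge0.
Qed.

Definition target_measure (U : 'rV[R]_d -> R) (hU : C1 U) :
    {measure set E -> \bar R} :=
  density base_measure (measurable_target_pdf (C1_continuous hU))
    (target_pdf_ge0 U).

End suzz.

(* Main.v *)
(* Parametrized by r along the line of the points x + r theta, the
   process killed at rate a has an explicit resolvent: it is the sum over n of the
   n-fold iterates of fly o jump, where fly integrates along the line with weight
   exp (- int (a + sum_i lambda_i) / s) / s and jump applies the switching rates.
   Since sum_i theta_i A_i is s times the derivative of U - log s along the line,
   and the refresh rates do not depend on theta, both operators are dual, with
   respect to mu, to themselves conjugated by theta |-> - theta. Hence mu is
   invariant as soon as the process does not lose mass, that is as soon as the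
   resolvent of the constant a is 1 mu-almost everywhere. Duality against a cutoff
   reduces this to the flux of s exp (- U) through large spheres, which tends to 0
   by the fourth hypothesis.
   Finally the expectation of f (Z_t) is determined by its Laplace transform, for f
   continuous, because trajectories are right-continuous, also at explosion, when f
   is extended by 0 to the graveyard; the laws of Z_t follow by a pi-lambda argument. *)

Require Import Defs.
From HB Require Import structures.
From mathcomp Require Import all_boot all_order all_algebra.
From mathcomp Require Import all_classical all_reals all_analysis.
From mathcomp Require Import measurable_realfun ring lra.

Set Implicit Arguments.
Unset Strict Implicit.
Unset Printing Implicit Defensive.

Import Order.TTheory GRing.Theory Num.Theory.
Import numFieldNormedType.Exports.

Local Open Scope classical_set_scope.
Local Open Scope ring_scope.

(** * Lebesgue measure on the line *)

(** The flow may reach infinity in finite time, and the switching times may accumulate. The line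
    parameter removes the first difficulty from the operators: every ray is indexed by [0, +oo),
    whatever its explosion time, and x |-> x - r theta preserves Lebesgue measure, whereas the flow
    at a fixed time is in general neither total nor measure preserving. The clock returns only
    through [time_change], when the resolvent is identified with the Laplace transform of the
    process. Positive operators and series keep every exchange within Tonelli's theorem; no
    generator, domain or core appears. The a priori bound is one-sided: the resolvent of the
    constant a is at most 1, the deficit being the mass that escapes. Killing at rate a > 0 makes
    the remainders of the series vanish: from a region where the total rate is at most C, at most C
    / a switches are made on average before killing. Refreshment rates are merely measurable along a
    line, so cumulated rates cannot be differentiated pointwise; errors of second order on a fine
    subdivision replace derivatives. *)

Section lebesgue_R.
Context (R : realType).
Notation leb := (@lebesgue_measure R).
Local Open Scope ereal_scope.

Lemma ge0_integral_shift (c : R) (f : R -> \bar R) :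
  measurable_fun setT f -> (forall x, 0 <= f x) ->
  \int[leb]_x f (x + c)%R = \int[leb]_x f x.
Proof.
move=> mf f0.
pose phi (x : measurableTypeR R) : measurableTypeR R := (x + c)%R.
have mphi : measurable_fun [set: measurableTypeR R] phi by exact: measurable_funD.
pose mu := measure_function_pushforward__canonical__measure_function_Measure leb mphi.
transitivity (\int[mu]_x f x); first exact/esym/ge0_integral_pushforward.
apply: (@eq_measure_integral _ _ _ setT leb) => A mA _.
apply/esym; apply: (@lebesgue_measure_unique _ mu) => //.
move=> _ [[a b] _ <-]; rewrite /mu/= /pushforward.
rewrite (_ : phi @^-1` _ = `]a - c, b - c]%classic)%R; last first.
  by apply/seteqP; split=> x /=; rewrite !in_itv/= /phi ltrBlDr lerBrDr.
rewrite !lebesgue_measure_itv/= !lte_fin ltrD2r; case: ifPn => // _.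
by rewrite -!EFinD opprB addrA subrK.
Qed.

Lemma ge0_integral_opp (f : R -> \bar R) :
  measurable_fun setT f -> (forall x, 0 <= f x) ->
  \int[leb]_x f (- x)%R = \int[leb]_x f x.
Proof.
move=> mf f0.
pose phi (x : measurableTypeR R) : measurableTypeR R := (- x)%R.
have mphi : measurable_fun [set: measurableTypeR R] phi by exact: oppr_measurable.
pose mu := measure_function_pushforward__canonical__measure_function_Measure leb mphi.
transitivity (\int[mu]_x f x); first exact/esym/ge0_integral_pushforward.
apply: (@eq_measure_integral _ _ _ setT leb) => A mA _.
exact: lebesgue_measureN.
Qed.

Lemma ge0_integral_reflect (r : R) (f : R -> \bar R) :
  measurable_fun setT f -> (forall x, 0 <= f x) ->
  \int[leb]_(v in `[0%R, r]) f (r - v)%R = \int[leb]_(v in `[0%R, r]) f v.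
Proof.
move=> mf f0; rewrite integral_mkcond [RHS]integral_mkcond.
set g := f \_ _.
have mg : measurable_fun setT g.
  by apply/(measurable_restrictT _ _).1 => //; exact: measurable_funTS.
have g0 x : 0 <= g x by rewrite /g patchE; case: ifP.
rewrite -(ge0_integral_opp mg g0).
rewrite -(ge0_integral_shift (- r) (f := fun x => g (- x)%R))//; last first.
  by apply: measurableT_comp => //; exact: oppr_measurable.
apply: eq_integral => x _; rewrite /g !patchE opprB.
congr (if _ then _ else _).
by rewrite !mem_setE/= !in_itv/= subr_ge0 gerBl andbC.
Qed.

Section half_line.
Context d (T : measurableType d).

Lemma measurable_integral_half_line (F : T * R -> \bar R) :
  measurable_fun setT F -> (forall x, 0 <= F x) ->
  measurable_fun setT (fun x => \int[leb]_(r in `[0%R, +oo[) F (x, r)).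
Proof.
move=> mF F0.
under eq_fun do rewrite integral_mkcond.
pose G (p : T * R) := (\1_(`[0%R, +oo[%classic : set R) p.2)%:E * F p.
rewrite (_ : (fun x => _) = fubini_F leb G); last first.
  apply/funext => x; apply: eq_integral => r _; rewrite /G/= patchE indicE.
  by case: ifPn => _ /=; rewrite ?mul1e ?mul0e.
apply: measurable_fun_fubini_tonelli_F.
  apply: emeasurable_funM => //; apply/measurable_EFinP.
  by apply: measurableT_comp => //; exact: measurable_indic.
by move=> p; rewrite /G mule_ge0// lee_fin.
Qed.

Lemma tonelli_half_line (m : {sigma_finite_measure set T -> \bar R})
    (F : T * R -> \bar R) :
  measurable_fun setT F -> (forall x, 0 <= F x) ->
  \int[m]_x \int[leb]_(r in `[0%R, +oo[) F (x, r) =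
  \int[leb]_(r in `[0%R, +oo[) \int[m]_x F (x, r).
Proof.
move=> mF F0.
pose G (p : T * R) := (\1_(`[0%R, +oo[%classic : set R) p.2)%:E * F p.
have mG : measurable_fun setT G.
  apply: emeasurable_funM => //; apply/measurable_EFinP.
  by apply: measurableT_comp => //; exact: measurable_indic.
have G0 p : 0 <= G p by rewrite /G mule_ge0// lee_fin.
transitivity (\int[m]_x \int[leb]_r G (x, r)).
  apply: eq_integral => x _; rewrite integral_mkcond; apply: eq_integral => r _.
  by rewrite /G/= patchE indicE; case: ifPn => _ /=; rewrite ?mul1e ?mul0e.
rewrite fubini_tonelli// [RHS]integral_mkcond; apply: eq_integral => r _.
rewrite patchE /G/= indicE; case: ifPn => _ /=.
  by under eq_integral do rewrite mul1e.
by under eq_integral do rewrite mul0e; rewrite integral0.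
Qed.

End half_line.
End lebesgue_R.

(** * Cumulated rates *)

Section cumulative.
Context (R : realType).
Notation leb := (@lebesgue_measure R).

Lemma lebesgue_integrable_bounded (f : R -> R) (b1 b2 : bool) (p q C : R) :
  measurable_fun setT f -> (forall v, p <= v <= q -> `|f v| <= C) ->
  leb.-integrable [set` Interval (BSide b1 p) (BSide b2 q)] (EFin \o f).
Proof.
move=> mf fC; apply: measurable_bounded_integrable => //.
- rewrite /= lebesgue_measure_itv; case: ifP => _; last by rewrite ltry.
  by rewrite -EFinB ltry.
- exact: measurable_funTS.
- exists C; split; first exact: num_real.
  move=> M CM v /= vpq; apply: (le_trans (fC _ _)); last exact: ltW.
  move: vpq; rewrite itv_boundlr => /andP[pv vq].
  by move: pv vq; case: b1; case: b2; rewrite !bnd_simp => pv vq;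
    rewrite ?(ltW pv) ?(ltW vq) ?pv ?vq.
Qed.

Lemma lebesgue_integrableM (D : set R) (k : R) (f : R -> R) : measurable D ->
  leb.-integrable D (EFin \o f) -> leb.-integrable D (EFin \o (fun v => k * f v)).
Proof.
move=> mD intf.
rewrite (_ : _ \o _ = (fun v => k%:E * (EFin \o f) v)%E).
  exact: integrableZl.
by apply/funext => v /=; rewrite EFinM.
Qed.

(** Cut [0, r] into N equal steps: each loses at most K (r / N)^2, hence all of them at most K r^2 /
    N, which tends to 0. This stands in for the sign of a derivative that need not exist. *)
Lemma quadratic_defect_le (D : R -> R) (K r e : R) : 0 <= r -> 0 < e ->
  (forall p q, 0 <= p -> p <= q -> q <= r -> q - p <= e ->
    - K * (q - p) ^+ 2 <= D q - D p) -> D 0 <= D r.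
Proof.
move=> r0 e0 DK; apply/ler_addgt0Pr => eps eps0.
(* One N serves two demands: the mesh r / N is at most e, and the total loss |K| r^2 / N is at most
   eps. *)
have [n nP] : exists n : nat, r / e + `|K| * r ^+ 2 / eps < n.+1%:R.
  have [n] := @archi_boundP R (r / e + `|K| * r ^+ 2 / eps)
    ltac:(by rewrite addr_ge0 ?divr_ge0 ?mulr_ge0 ?sqr_ge0// ltW).
  by exists (Num.bound (r / e + `|K| * r ^+ 2 / eps)); apply: (lt_trans (archi_boundP _));
    rewrite ?addr_ge0 ?divr_ge0 ?mulr_ge0 ?sqr_ge0 ?(ltW e0) ?(ltW eps0)// ltr_nat.
set N := n.+1%:R in nP.
have N0 : 0 < N by rewrite ltr0n.
pose x (i : nat) : R := r * i%:R / N.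
have xS i : x i.+1 - x i = r / N.
  by rewrite /x -mulrBl -mulrBr -natrB// subSnn mulr1.
have -> : 0 = x 0%N by rewrite /x mulr0 mul0r.
have xN : x n.+1 = r by rewrite /x mulfK// gt_eqF.
rewrite -xN -lerBlDl -opprB lerNl.
rewrite -(telescope_sumr (fun i => D (x i)))//.
have rNe : r / N <= e.
  rewrite ler_pdivrMr// mulrC -ler_pdivrMr//; apply: ltW; apply: le_lt_trans nP.
  by rewrite lerDl divr_ge0 ?mulr_ge0 ?sqr_ge0// ltW.
apply: (@le_trans _ _ (\sum_(0 <= i < n.+1) (- K * (r / N) ^+ 2))); last first.
  apply: ler_sum_nat => i /andP[_ iN]; rewrite -(xS i); apply: DK.
  - by rewrite /x divr_ge0// ?mulr_ge0// ltW.
  - by rewrite -subr_ge0 xS divr_ge0// ltW.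
  - by rewrite -xN /x ler_pM2r ?invr_gt0// ler_wpM2l// ler_nat.
  - by rewrite xS.
rewrite sumr_const_nat subn0 -mulr_natr -/N lerNl mulNr mulNr opprK.
rewrite (_ : _ * N = K * r ^+ 2 / N); last by field; rewrite gt_eqF.
rewrite ler_pdivrMr//.
rewrite [leRHS]mulrC -ler_pdivrMr//; apply: ltW; apply: le_lt_trans nP.
apply: (@le_trans _ _ (`|K| * r ^+ 2 / eps)); last by rewrite lerDr divr_ge0// ltW.
by rewrite ler_pM2r ?invr_gt0// ler_wpM2r ?sqr_ge0// ler_norm.
Qed.

Definition locally_bounded_rate (b : R -> R) :=
  [/\ measurable_fun setT b, forall v, 0 <= b v &
    forall r, exists C, forall v, 0 <= v <= r -> b v <= C].

Definition cum (b : R -> R) (r : R) : R := \int[leb]_(v in `[0, r]) b v.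

Lemma cum_ge0 b r : (forall v, 0 <= b v) -> 0 <= cum b r.
Proof. by move=> b0; apply: Rintegral_ge0. Qed.

Lemma cum0 b : cum b 0 = 0.
Proof. by rewrite /cum set_itv1 Rintegral_set1. Qed.

Section measurable_cum.
Context d (T : measurableType d) (F : T * R -> R).
Hypothesis mF : measurable_fun setT F.

Lemma measurable_cum : (forall p, 0 <= F p) ->
  measurable_fun setT (fun p : T * R => cum (fun v => F (p.1, v)) p.2).
Proof.
move=> F0.
(* Truncating the integrand fixes the domain of integration, so that Tonelli gives measurability
   although the upper endpoint varies. *)
pose G (q : (T * R) * R) : \bar R :=
  (if q.2 <= q.1.2 then F (q.1.1, q.2) else 0)%:E.
have mG : measurable_fun setT G.
  apply/measurable_EFinP; apply: measurable_fun_ifT => //.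
    apply: measurable_fun_ler; first exact: measurable_snd.
    exact: (measurableT_comp measurable_snd measurable_fst).
  apply: measurableT_comp => //; apply: measurable_fun_pair; last exact: measurable_snd.
  exact: (measurableT_comp measurable_fst measurable_fst).
have G0 q : (0 <= G q)%E by rewrite lee_fin; case: ifP.
rewrite (_ : (fun _ => _) = fine \o (fun x => \int[leb]_(r in `[0%R, +oo[) G (x, r))%E).
  by apply: measurableT_comp => //; exact: measurable_integral_half_line.
apply/funext => -[x r] /=; rewrite /cum /Rintegral; congr fine.
rewrite integral_mkcond [RHS]integral_mkcond; apply: eq_integral => v _.
rewrite !patchE /G/= !mem_setE !in_itv/= andbT.
by case: (leP 0 v) => //= v0; case: ifPn.
Qed.
End measurable_cum.

Section rate.
Variable b : R -> R.
Hypothesis bP : locally_bounded_rate b.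

Let mb : measurable_fun setT b. Proof. by case: bP. Qed.
Let b0 v : 0 <= b v. Proof. by case: bP => _ + _; exact. Qed.

Lemma rate_integrable b1 b2 p q : 0 <= p ->
  leb.-integrable [set` Interval (BSide b1 p) (BSide b2 q)] (EFin \o b).
Proof.
move=> p0; case: bP => _ _ /(_ q)[C bC].
apply: (@lebesgue_integrable_bounded _ _ _ _ _ C) => // v /andP[pv vq].
by rewrite ger0_norm// bC// (le_trans p0).
Qed.

Lemma cumE r : (\int[leb]_(v in `[0%R, r]) (b v)%:E = (cum b r)%:E)%E.
Proof.
rewrite /cum /Rintegral fineK//; apply: integrable_fin_num => //.
exact: rate_integrable.
Qed.

Lemma cumB p q : 0 <= p -> p <= q ->
  cum b q - cum b p = \int[leb]_(v in `]p, q]) b v.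
Proof.
move=> p0 pq; rewrite /cum Rintegral_itvB// ?bnd_simp//.
exact: rate_integrable.
Qed.

Lemma le_cum p q : 0 <= p -> p <= q -> cum b p <= cum b q.
Proof.
by move=> p0 pq; rewrite -subr_ge0 cumB//; apply: Rintegral_ge0.
Qed.

Lemma cumB_le C r p q : (forall v, 0 <= v <= r -> b v <= C) ->
  0 <= p -> p <= q -> q <= r -> cum b q - cum b p <= C * (q - p).
Proof.
move=> bC p0 pq qr; rewrite cumB//.
have -> : C * (q - p) = \int[leb]_(v in `]p, q]) C.
  rewrite Rintegral_cst//= lebesgue_measure_itv/= lte_fin.
  by case: (ltgtP p q) pq => // -> _; rewrite subrr.
apply: le_Rintegral => //; first exact: rate_integrable.
  apply: (@lebesgue_integrable_bounded _ _ _ _ _ `|C|) => //.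
by move=> v /=; rewrite in_itv/= => /andP[pv vq]; rewrite bC// (le_trans vq qr) (le_trans p0 (ltW pv)).
Qed.

Lemma measurable_cum1 : measurable_fun setT (cum b).
Proof.
apply: (@measurable_comp _ _ _ _ _ _ setT (fun p : R * R => cum (fun v => b v) p.2) _ (fun r => (r, r))) => //.
  exact: (@measurable_cum _ _ (fun p => b p.2) (measurableT_comp mb measurable_snd)).
by apply: measurable_fun_pair.
Qed.

Lemma expR_cum_integrable b1 b2 (p q : R) (f : R -> R) (C : R) : 0 <= p ->
  measurable_fun setT f -> (forall v, p <= v <= q -> `|f v| <= C) ->
  leb.-integrable [set` Interval (BSide b1 p) (BSide b2 q)]
    (EFin \o (fun v => f v * expR (- cum b v))).
Proof.
move=> p0 mf fC; apply: (@lebesgue_integrable_bounded _ _ _ _ _ C).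
  apply: measurable_funM => //; apply: measurableT_comp => //.
  exact: measurable_funN measurable_cum1.
move=> v vpq; rewrite normrM -[leRHS]mulr1 ler_pM// ?fC//.
by rewrite ger0_norm ?expR_ge0// -expR0 ler_expR oppr_le0 cum_ge0.
Qed.

(* Duhamel's formula as an inequality: [f] is only Lipschitz, and [l] bounds
   its decrease along the line. *)
Lemma le_cum_discount (f l : R -> R) (Cl r e : R) : 0 <= r -> 0 < e ->
  measurable_fun setT f -> measurable_fun setT l ->
  (forall v, 0 <= f v <= 1) -> (forall v, 0 <= l v <= Cl) ->
  (forall p q, p <= q -> f q - Cl * (q - p) <= f p <= f q + Cl * (q - p)) ->
  (forall p q, 0 <= p -> p <= q -> q <= r -> q - p <= e ->
    f p - f q <= \int[leb]_(v in `]p, q]) l v) ->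
  f 0 <= \int[leb]_(v in `[0, r]) ((b v * f v + l v) * expR (- cum b v)) +
    f r * expR (- cum b r).
Proof.
move=> r0 e0 mf ml f01 l0 fL fl.
have [C bC] : exists C, forall v, 0 <= v <= r -> b v <= C by case: bP.
have C0 : 0 <= C by apply: le_trans (bC 0 _); rewrite ?lexx.
have Cl0 : 0 <= Cl by have /andP[h1 h2] := l0 0; exact: le_trans h2.
have mg : measurable_fun setT (fun v => b v * f v + l v).
  by apply: measurable_funD => //; apply: measurable_funM.
have gC v : 0 <= v <= r -> `|b v * f v + l v| <= C + Cl.
  move=> vr; have /andP[f0 f1] := f01 v; have /andP[l0' l1] := l0 v.
  rewrite ger0_norm ?addr_ge0 ?mulr_ge0// lerD//.
  by rewrite -[leRHS]mulr1 ler_pM// bC.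
pose D q := \int[leb]_(v in `[0, q]) ((b v * f v + l v) * expR (- cum b v)) +
    f q * expR (- cum b q).
suff : D 0 <= D r.
  by rewrite /D set_itv1 Rintegral_set1 cum0 oppr0 expR0 mulr1 add0r.
(* With [dlt] the increment of [cum b] over a step of length h, the errors are [dlt] squared and two
   copies of Cl h [dlt]; as [dlt] is at most C h, this is the resulting constant. *)
apply: (@quadratic_defect_le D (C ^+ 2 + 2 * C * Cl) r e) => // p q p0 pq qr qpe.
have pr := le_trans pq qr.
set h := q - p; set dlt := cum b q - cum b p.
have h0 : 0 <= h by rewrite subr_ge0.
have dlt0 : 0 <= dlt by rewrite subr_ge0 le_cum.
have dltC : dlt <= C * h by exact: (cumB_le bC).
have intg : leb.-integrable `]p, q] (EFin \o (fun v => (b v * f v + l v) * expR (- cum b v))).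
  apply: (@expR_cum_integrable _ _ _ _ _ (C + Cl) p0 mg) => v /andP[pv vq].
  by rewrite gC// (le_trans p0 pv) (le_trans vq qr).
have DE : D q - D p =
    \int[leb]_(v in `]p, q]) ((b v * f v + l v) * expR (- cum b v)) +
    f q * expR (- cum b q) - f p * expR (- cum b p).
  rewrite /D opprD addrACA -[RHS]addrA; congr (_ + _).
  apply: (Rintegral_itvB (a := BLeft 0)); rewrite ?bnd_simp//.
  apply: (@expR_cum_integrable _ _ _ _ _ (C + Cl) (lexx 0) mg) => v /andP[pv vq].
  by rewrite gC// pv (le_trans vq qr).
have intb : leb.-integrable `]p, q] (EFin \o (fun v => (f q - Cl * h) * b v)).
  have [C' bC'] : exists C, forall v, 0 <= v <= q -> b v <= C by case: bP => _ _; exact.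
  apply: (@lebesgue_integrable_bounded _ _ _ _ _ (`|f q - Cl * h| * C')).
    by apply: measurable_funM.
  move=> v /andP[pv vq]; rewrite normrM ler_wpM2l// ger0_norm// bC'//.
  by rewrite (le_trans p0 pv).
have intl : leb.-integrable `]p, q] (EFin \o l).
  apply: (@lebesgue_integrable_bounded _ _ _ _ _ Cl) => // v _.
  by have /andP[? ?] := l0 v; rewrite ger0_norm.
have intS : leb.-integrable `]p, q] (EFin \o (fun v => (f q - Cl * h) * b v + l v)).
  exact: (integrableD _ intb intl).
(* Over the step, f is at least f q - Cl h, the discount is at least its final value, and l
   integrates to at least f p - f q. *)
have low : expR (- cum b q) * ((f q - Cl * h) * dlt + (f p - f q)) <=
    \int[leb]_(v in `]p, q]) ((b v * f v + l v) * expR (- cum b v)).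
  apply: (@le_trans _ _ (\int[leb]_(v in `]p, q])
      (expR (- cum b q) * ((f q - Cl * h) * b v + l v)))); last first.
    apply: le_Rintegral => //.
      exact: (lebesgue_integrableM _ _ intS).
    move=> v /=; rewrite in_itv/= => /andP[pv vq].
    have v0 := le_trans p0 (ltW pv).
    have /andP[f0 f1] := f01 v; have /andP[l0' l1] := l0 v.
    rewrite mulrC; apply: (@le_trans _ _ ((b v * f v + l v) * expR (- cum b q))).
      rewrite ler_wpM2r ?expR_ge0// lerD2r mulrC ler_wpM2l//.
      have /andP[+ _] := fL v q vq; apply: le_trans.
      by rewrite lerD2l lerN2 ler_wpM2l// lerD2l lerN2 ltW.
    by rewrite ler_wpM2l ?addr_ge0 ?mulr_ge0// ler_expR lerN2 le_cum.
  rewrite RintegralZl// RintegralD// RintegralZl//; last exact: rate_integrable.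
  rewrite -cumB// -/dlt ler_wpM2l ?expR_ge0// lerD2l; exact: fl.
rewrite DE; clear DE intg intb intl intS mg gC D.
have E1 : expR (- cum b p) * (1 - dlt) <= expR (- cum b q).
  rewrite (_ : - cum b q = - cum b p + - dlt); last by rewrite /dlt; ring.
  by rewrite expRD ler_wpM2l ?expR_ge0// expR_ge1Dx.
have Ep : expR (- cum b p) <= 1 by rewrite -expR0 ler_expR oppr_le0 cum_ge0.
have Eq : expR (- cum b q) <= 1 by rewrite -expR0 ler_expR oppr_le0 cum_ge0.
have /andP[fp0 fp1] := f01 p; have /andP[fqp _] := fL p q pq.
have := fL p q pq; rewrite -/h => /andP[_ fpq].
move: low; move: (expR_ge0 (- cum b p)) (expR_ge0 (- cum b q)).
set I := \int[leb]_(v in _) _.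
set E := expR _ in E1 Ep *; set E' := expR _ in E1 Eq *.
move=> E0 E'0 low.
have H1 : E * (1 - dlt ^+ 2) <= E' * (1 + dlt).
  have := ler_wpM2r (addr_ge0 ler01 dlt0) E1.
  by rewrite (_ : _ * _ * _ = E * (1 - dlt ^+ 2))//; ring.
have H2 : dlt ^+ 2 <= C ^+ 2 * h ^+ 2 by rewrite -exprMn lerXn2r ?nnegrE ?mulr_ge0.
have H3 : Cl * h * dlt <= C * Cl * h ^+ 2.
  by rewrite (_ : C * Cl * _ = Cl * h * (C * h)); [rewrite ler_wpM2l ?mulr_ge0|ring].
have H4 : E' * (Cl * h * dlt) <= Cl * h * dlt.
  by rewrite -[leRHS]mul1r ler_wpM2r ?mulr_ge0.
have H5 : f p * E * dlt ^+ 2 <= dlt ^+ 2.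
  rewrite -[leRHS]mul1r ler_wpM2r ?sqr_ge0//.
  exact: (mulr_ile1 fp0 E0 fp1 Ep).
have H6 : f p * (E * (1 - dlt ^+ 2)) <= f p * (E' * (1 + dlt)).
  by rewrite ler_wpM2l.
have H7 : E' * dlt * (f p - Cl * h) <= E' * dlt * f q.
  by rewrite ler_wpM2l ?mulr_ge0// lerBlDr.
lra.
Qed.

Lemma cum_discount_ge r : 0 <= r ->
  1 - expR (- cum b r) <= \int[leb]_(v in `[0, r]) (b v * expR (- cum b v)).
Proof.
move=> r0.
have := @le_cum_discount (cst 1) (cst 0) 0 r 1 r0 ltr01.
rewrite /= mul1r -lerBlDr.
under eq_Rintegral do rewrite mulr1 addr0.
apply=> //.
- by move=> v; rewrite ler01 lexx.
- by move=> v; rewrite lexx.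
- by move=> p q _; rewrite mul0r subr0 addr0 lexx.
- by move=> p q _ _ _ _; rewrite subrr Rintegral_ge0.
Qed.

(** The opposite estimate on a step comes from exp (- x) <= 1 / (1 + x) <= 1 - x + x^2 for x >=
    0. *)
Lemma cum_discount_le r : 0 <= r ->
  \int[leb]_(v in `[0, r]) (b v * expR (- cum b v)) <= 1 - expR (- cum b r).
Proof.
move=> r0; have [C bC] : exists C, forall v, 0 <= v <= r -> b v <= C by case: bP.
have C0 : 0 <= C by apply: le_trans (bC 0 _); rewrite ?lexx.
pose D q := - expR (- cum b q) - \int[leb]_(v in `[0, q]) (b v * expR (- cum b v)).
suff : D 0 <= D r.
  by rewrite /D set_itv1 Rintegral_set1 cum0 oppr0 expR0; lra.
apply: (@quadratic_defect_le D (C ^+ 2) r 1) => // p q p0 pq qr _.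
set dlt := cum b q - cum b p.
have dlt0 : 0 <= dlt by rewrite subr_ge0 le_cum.
have dltC : dlt <= C * (q - p) by exact: (cumB_le bC).
have intg b1 p' q' : 0 <= p' -> q' <= r -> leb.-integrable [set` Interval (BSide b1 p') (BRight q')]
    (EFin \o (fun v => b v * expR (- cum b v))).
  move=> p'0 q'r; apply: (@expR_cum_integrable _ _ _ _ _ C) => // v /andP[pv vq].
  by rewrite ger0_norm// bC// (le_trans p'0 pv) (le_trans vq q'r).
have DE : \int[leb]_(v in `[0, q]) (b v * expR (- cum b v)) -
    \int[leb]_(v in `[0, p]) (b v * expR (- cum b v)) =
    \int[leb]_(v in `]p, q]) (b v * expR (- cum b v)).
  by apply: (Rintegral_itvB (a := BLeft 0)); rewrite ?bnd_simp//; exact: intg.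
have : \int[leb]_(v in `]p, q]) (b v * expR (- cum b v)) <= expR (- cum b p) * dlt.
  rewrite /dlt cumB// -RintegralZl//; last exact: rate_integrable.
  apply: le_Rintegral => //; first exact: intg.
    exact: (lebesgue_integrableM _ _ (rate_integrable _ _ _ p0)).
  move=> v /=; rewrite in_itv/= => /andP[pv vq].
  by rewrite mulrC ler_wpM2r// ler_expR lerN2 le_cum// ltW.
have E1 : expR (- cum b q) <= expR (- cum b p) * (1 - dlt + dlt ^+ 2).
  rewrite (_ : - cum b q = - cum b p + - dlt); last by rewrite /dlt; ring.
  rewrite expRD ler_wpM2l ?expR_ge0//.
  rewrite expRN; apply: (@le_trans _ _ (1 + dlt)^-1).
    by rewrite lef_pV2 ?posrE ?expR_gt0 ?expR_ge1Dx// ltr_pwDl.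
  rewrite -[leLHS]mul1r ler_pdivrMr ?ltr_pwDl//.
  rewrite (_ : _ * _ = 1 + dlt ^+ 3); last by ring.
  by rewrite lerDl exprn_ge0.
have Ep : expR (- cum b p) <= 1 by rewrite -expR0 ler_expR oppr_le0 cum_ge0.
rewrite /D; move: DE E1 Ep (expR_ge0 (- cum b p)); rewrite -/dlt.
set E := expR _; set E' := expR _.
have H2 : dlt ^+ 2 <= C ^+ 2 * (q - p) ^+ 2.
  by rewrite -exprMn lerXn2r ?nnegrE// mulr_ge0// subr_ge0.
move=> <- E1 Ep E0 low.
have : E' * dlt ^+ 2 <= dlt ^+ 2 by rewrite -[leRHS]mul1r ler_wpM2r ?sqr_ge0.
lra.
Qed.

(** The density of the first ring of a clock of rate b integrates to the probability that it rings
    before r. Every total mass computed below comes from this identity. *)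
Lemma cum_discount r : 0 <= r ->
  \int[leb]_(v in `[0, r]) (b v * expR (- cum b v)) = 1 - expR (- cum b r).
Proof.
by move=> r0; apply/eqP; rewrite eq_le cum_discount_le// cum_discount_ge.
Qed.
End rate.
End cumulative.

(** * Integration against a density *)

Section density_integral.
Local Open Scope ereal_scope.
Context disp (T : measurableType disp) (R : realType).
Context (m : {measure set T -> \bar R}) (f : T -> R).
Hypothesis mf : measurable_fun [set: T] f.
Hypothesis f0 : forall x, (0 <= f x)%R.

Import HBNNSimple.

(** Monotone approximation by simple functions reduces the formula to indicators, where it is the
    definition of the measure. *)
Lemma ge0_integral_density (g : T -> \bar R) :
  measurable_fun setT g -> (forall x, 0 <= g x) ->
  \int[density m mf f0]_x g x = \int[m]_x (g x * (f x)%:E).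
Proof.
move=> mg g0.
pose g_ := nnsfun_approx measurableT mg.
transitivity (limn (fun n => \int[density m mf f0]_x (g_ n x)%:E)).
  rewrite -monotone_convergence//.
  - by apply: eq_integral => x _; apply/esym/cvg_lim => //; exact: cvg_nnsfun_approx.
  - by move=> n; exact/measurable_EFinP.
  - by move=> n x _; rewrite lee_fin.
  - by move=> x _ a b ab; rewrite lee_fin; exact/lefP/nd_nnsfun_approx.
transitivity (limn (fun n => \int[m]_x ((g_ n x)%:E * (f x)%:E))); last first.
  rewrite -monotone_convergence//.
  - apply: eq_integral => x _; apply/cvg_lim => //.
    by apply: cvgeZr => //; exact: cvg_nnsfun_approx.
  - by move=> n; apply: emeasurable_funM; exact/measurable_EFinP.
  - by move=> n x _; rewrite mule_ge0// lee_fin.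
  - move=> x _ a b ab; rewrite lee_wpmul2r ?lee_fin//.
    exact/lefP/nd_nnsfun_approx.
congr (limn _); apply/funext => n.
under eq_integral do rewrite fimfunE -fsumEFin//.
rewrite ge0_integral_fsum//; last 2 first.
  - by move=> y; exact/measurable_EFinP/measurable_funM.
  - by move=> y x _; rewrite nnfun_muleindic_ge0.
under [RHS]eq_integral => x _.
  rewrite fimfunE -fsumEFin// ge0_mule_fsuml; last first.
    by move=> r; exact: nnfun_muleindic_ge0.
  over.
rewrite ge0_integral_fsum//; last 2 first.
  - move=> y; apply: emeasurable_funM; last exact/measurable_EFinP.
    by apply/measurable_EFinP; exact: measurable_funM.
  - by move=> y x _; rewrite mule_ge0 ?lee_fin// -lee_fin nnfun_muleindic_ge0.
apply: eq_fsbigr => r _; rewrite integralZl_indic_nnsfun// integral_indic//= setIT.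
(* A negative value is not taken by a nonnegative simple function: its level set is empty and both
   sides vanish. *)
have [r0|r0] := ltP r 0%R.
  rewrite preimage_nnfun0// ?densityE integral_set0 mule0.
  by under eq_integral do rewrite indic0 mulr0 mul0e; rewrite integral0.
under [RHS]eq_integral do rewrite EFinM -muleA.
rewrite ge0_integralZl//; last 2 first.
  - apply: emeasurable_funM; exact/measurable_EFinP.
  - by move=> x _; rewrite mule_ge0 ?lee_fin.
rewrite ?densityE [in LHS]integral_mkcond; congr (_ * _).
apply: eq_integral => x _; rewrite patchE indicE.
by case: ifPn => _ /=; rewrite ?mul1e ?mul0e.
Qed.

End density_integral.

(** * Change of clock along a line *)

Section speed.
Context (R : realType).
Notation leb := (@lebesgue_measure R).

(* When [b] is the slowness 1 / s along a line, [cum b r] is the time at which the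
   flow has covered the parameter [r]; [alive b v] says that the flow has not
   exploded at time [v], and [rho b v] is then the parameter reached. *)
Definition alive (b : R -> R) (v : R) := exists n : nat, v < cum b n%:R.

Definition rho (b : R -> R) (v : R) : R :=
  fine (\int[leb]_(r in `[0%R, +oo[) (if cum b r <= v then 1 else 0)%:E)%E.

Variable b : R -> R.
Hypothesis b_cont : continuous b.
Hypothesis b_gt0 : forall v, 0 < b v.

Lemma continuous_rate : locally_bounded_rate b.
Proof.
split; [exact: continuous_measurable_fun|by move=> v; exact: ltW|move=> r].
have [r0|r0] := leP 0 r; last first.
  by exists 0 => v /andP[v0 vr]; have := le_lt_trans (le_trans v0 vr) r0; rewrite ltxx.
have [c _ cP] := EVT_max r0 (continuous_subspaceT b_cont).
by exists (b c) => v vr; apply: cP; rewrite in_itv.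
Qed.
Let bP := continuous_rate.

Lemma lt_cum p q : 0 <= p -> p < q -> cum b p < cum b q.
Proof.
move=> p0 pq; rewrite -subr_gt0 cumB// ?ltW//.
have [c _ cP] := EVT_min (ltW pq) (continuous_subspaceT b_cont).
apply: (@lt_le_trans _ _ (\int[leb]_(v in `]p, q]) b c)).
  rewrite Rintegral_cst//= lebesgue_measure_itv/= lte_fin pq/=.
  by rewrite mulr_gt0// subr_gt0.
apply: le_Rintegral => //; last first.
- by move=> v /=; rewrite in_itv/= => /andP[pv vq]; apply: cP; rewrite in_itv/= (ltW pv).
- exact: rate_integrable.
- by apply: (@lebesgue_integrable_bounded _ _ _ _ _ _ `|b c|).
Qed.

Lemma le_cumE p q : 0 <= p -> 0 <= q -> (cum b p <= cum b q) = (p <= q).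
Proof.
move=> p0 q0; apply/idP/idP => [|pq]; last exact: le_cum.
by apply: contraTT; rewrite -!ltNge; exact: lt_cum.
Qed.

Lemma alive_cum r : 0 <= r -> alive b (cum b r).
Proof.
move=> r0; exists (Num.bound r); apply: lt_cum => //.
exact: archi_boundP.
Qed.

(** By strict monotonicity the parameters whose [cum] is at most [cum b r] form [0, r], of length r.
    Writing the inverse of [cum] as a length, rather than choosing it, makes it jointly measurable
    in the time and in the line. *)
Lemma rho_cum r : 0 <= r -> rho b (cum b r) = r.
Proof.
move=> r0; rewrite /rho.
rewrite (_ : (\int[leb]_(x in _) _)%E = (\int[leb]_(x in `[0%R, r]) 1)%E).
  rewrite integral_cst//= mul1e lebesgue_measure_itv/= lte_fin.
  case: ltP => [_|rle0]; first by rewrite /= subr0.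
  by apply/eqP; rewrite eq_le r0 rle0.
rewrite integral_mkcond [RHS]integral_mkcond; apply: eq_integral => v _.
rewrite !patchE !mem_setE !in_itv/= andbT.
by case: (leP 0 v) => //= v0; rewrite le_cumE//; case: ifP.
Qed.

Lemma cum_surj v : 0 <= v -> alive b v -> exists2 r, 0 <= r & cum b r = v.
Proof.
move=> v0 [n vn].
have [|//|c] := @IVT R (cum b) 0 n%:R v (ler0n _ _).
  apply: parameterized_integral_continuous => //.
  exact: rate_integrable.
  rewrite cum0 min_l ?max_r ?cum_ge0// ?v0 ?ltW// => t; exact: ltW.
by rewrite in_itv/= => /andP[c0 _] cv; exists c.
Qed.

Lemma cum_rho v : 0 <= v -> alive b v -> 0 <= rho b v /\ cum b (rho b v) = v.
Proof. by move=> v0 /(cum_surj v0)[r r0 <-]; rewrite rho_cum. Qed.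

Lemma is_derive_cum (r : R) : 0 < r -> is_derive r 1 (cum b) (b r).
Proof.
move=> r0.
have [||||h1 h2] := @continuous_FTC1_closed R b 0 r (r + 1).
- by rewrite ltrDl.
- exact: rate_integrable.
- by [].
- exact: b_cont.
by apply: DeriveDef; [exact: h1|rewrite -derive1E; exact: h2].
Qed.

Lemma is_derive_rho (v : R) : 0 < v -> alive b v ->
  is_derive v 1 (rho b) (b (rho b v))^-1.
Proof.
move=> v0 va; have [r0 rv] := cum_rho (ltW v0) va.
have {}r0 : 0 < rho b v.
  rewrite lt_neqAle r0 andbT; apply/eqP => r00.
  by move: v0; rewrite -rv -r00 cum0 ltxx.
rewrite -[X in is_derive X]rv; apply: (is_derive_inverse (f := cum b)).
- near=> r; apply: rho_cum; apply: ltW; near: r; exact: lt_nbhsr.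
- near=> r; apply/differentiable_continuous/derivable1_diffP.
  by case: (@is_derive_cum r _) => //; near: r; exact: lt_nbhsr.
- exact: is_derive_cum.
- by rewrite gt_eqF.
Unshelve. all: by end_near. Qed.

Lemma rho_cvg0 : rho b v @[v --> 0^'+] --> 0.
Proof.
apply/cvgrPdist_lt => e e0; near=> v.
have v0 : 0 < v by [].
have ve : v < cum b e by near: v; apply: nbhs_right_lt; rewrite -(cum0 b); exact: lt_cum.
have va : alive b v.
  by have [n] := alive_cum (ltW e0); exists n; exact: lt_trans ve _.
have [r0 rv] := cum_rho (ltW v0) va.
rewrite sub0r normrN ger0_norm// ltNge; apply/negP => er.
by move: ve; rewrite -rv ltNge le_cumE// ?er// ltW.
Unshelve. all: by end_near. Qed.

Lemma measurable_rho1 : measurable_fun setT (rho b).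
Proof.
have mb : measurable_fun setT (cum b) := measurable_cum1 bP.
rewrite /rho; apply: measurableT_comp => //.
apply: (measurable_integral_half_line
  (F := fun p : R * R => (if cum b p.2 <= p.1 then 1 else 0)%:E)).
  apply/measurable_EFinP; apply: measurable_fun_ifT => //.
  by apply: measurable_fun_ler => //; apply: measurableT_comp.
by move=> x; rewrite lee_fin; case: ifP.
Qed.

Lemma measurable_alive1 : measurable [set v | alive b v].
Proof.
rewrite (_ : [set v | _] = \bigcup_n `]-oo, cum b n%:R[%classic).
  exact: bigcupT_measurable.
by apply/seteqP; split=> v /= [n]; [exists n => //=; rewrite in_itv|move=> _ /=; rewrite in_itv/=; exists n].
Qed.

Let alive_weight (v : R) : R := \1_(`[0, +oo[ `&` [set v | alive b v]) v.

Let malive_weight : measurable_fun setT alive_weight.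
Proof.
apply: measurable_indic; apply: measurableI => //; exact: measurable_alive1.
Qed.

Let alive_weight_ge0 v : 0 <= alive_weight v. Proof. by rewrite /alive_weight. Qed.

Let length_weight (r : R) : R := \1_(`[0, +oo[) r * b r.

Let mlength_weight : measurable_fun setT length_weight.
Proof.
apply: measurable_funM; first exact: measurable_indic.
exact: continuous_measurable_fun.
Qed.

Let length_weight_ge0 v : 0 <= length_weight v.
Proof. by rewrite /length_weight mulr_ge0// ltW. Qed.

(** The substitution v = cum b r. The image under [rho] of Lebesgue measure on the alive times is
    compared with b(r) dr on half-open intervals, according to their position relative to 0; these
    intervals determine the measure. *)
Lemma time_change (H : R -> \bar R) :
  measurable_fun setT H -> (forall r, 0 <= H r)%E ->
  (\int[leb]_(r in `[0%R, +oo[) (H r * (b r)%:E) =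
   \int[leb]_(v in `[0%R, +oo[ `&` [set v | alive b v]) H (rho b v))%E.
Proof.
move=> mH H0.
have mrho : measurable_fun [set: R] (rho b : R -> measurableTypeR R) by exact: measurable_rho1.
pose m0 := density leb malive_weight alive_weight_ge0.
pose m1 := measure_function_pushforward__canonical__measure_function_Measure m0 mrho.
pose m2 := density leb mlength_weight length_weight_ge0.
have m1E p q : m1 `]p, q]%classic =
    leb ((rho b @^-1` `]p, q]) `&` (`[0, +oo[ `&` [set v | alive b v])).
  transitivity (\int[leb]_(x in rho b @^-1` `]p, q]) (\1_(`[0, +oo[ `&` [set v | alive b v]) x)%:E)%E; first by [].
  rewrite integral_indic; last 2 first.
  - by rewrite -[X in measurable X]setTI; exact: (mrho measurableT _ (measurable_itv _)).
  - by apply: measurableI => //; exact: measurable_alive1.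
  by rewrite setIC.
have m2E p q : m2 `]p, q]%classic = (\int[leb]_(x in `]p, q]) (length_weight x)%:E)%E by [].
have m_neg p q : q < 0 -> m1 `]p, q]%classic = 0%E /\ m2 `]p, q]%classic = 0%E.
  move=> q0; split.
    rewrite m1E [X in lebesgue_measure X](_ : _ = set0) ?measure0//.
    apply/seteqP; split=> // v /= []; rewrite !in_itv/= andbT => /andP[_ vq] [v0 va].
    have [r0 _] := cum_rho v0 va.
    by have := le_lt_trans (le_trans r0 vq) q0; rewrite ltxx.
  rewrite m2E; apply: integral0_eq => r /=; rewrite in_itv/= => /andP[_ rq].
  by rewrite /length_weight indicE memNset ?mul0r//= in_itv/= andbT leNgt (le_lt_trans rq q0).
(* Here the interval contains 0, so that the preimage under [rho] is closed at time 0. *)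
have m_mid p q : p < 0 -> 0 <= q -> m1 `]p, q]%classic = (cum b q)%:E /\ m2 `]p, q]%classic = (cum b q)%:E.
  move=> p0 q0; split.
    rewrite m1E [X in lebesgue_measure X](_ : _ = `[0, cum b q]%classic).
      rewrite /= lebesgue_measure_itv/= lte_fin; case: ltP => [_|].
        by rewrite -EFinB subr0.
      by move=> c0; congr EFin; apply/eqP; rewrite eq_le c0 cum_ge0// => v; exact: ltW.
    apply/seteqP; split=> v /=; rewrite !in_itv/= andbT.
      move=> [/andP[_ vq] [v0 va]]; have [r0 <-] := cum_rho v0 va.
      by rewrite le_cumE// vq cum_ge0// => w; exact: ltW.
    move=> /andP[v0 vq].
    have va : alive b v by have [n] := alive_cum q0; exists n; exact: le_lt_trans vq _.
    split => //; have [r0 rv] := cum_rho v0 va.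
    by rewrite (lt_le_trans p0 r0)/= -le_cumE// rv.
  rewrite -cumE// /m2 densityE integral_mkcond [RHS]integral_mkcond.
  apply: eq_integral => r _; rewrite !patchE /length_weight indicE !mem_setE !in_itv/= andbT.
  have [r0|r0] := leP 0 r; last by rewrite mul0r if_same.
  by rewrite (lt_le_trans p0 r0)/= mul1r.
have m_pos p q : 0 <= p -> p <= q -> m1 `]p, q]%classic = (cum b q - cum b p)%:E /\
    m2 `]p, q]%classic = (cum b q - cum b p)%:E.
  move=> p0 pq; have q0 := le_trans p0 pq; split.
    rewrite m1E [X in lebesgue_measure X](_ : _ = `]cum b p, cum b q]%classic).
      rewrite /= lebesgue_measure_itv/= lte_fin; case: ltP => // qp.
      by congr EFin; apply/esym/eqP; rewrite subr_eq0 eq_le qp le_cum.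
    apply/seteqP; split=> v /=; rewrite !in_itv/= andbT.
      move=> [/andP[pv vq] [v0 va]]; have [r0 <-] := cum_rho v0 va.
      by rewrite le_cumE// vq lt_cum.
    move=> /andP[pv vq].
    have va : alive b v by have [n] := alive_cum q0; exists n; exact: le_lt_trans vq _.
    have v0 : 0 <= v by apply: le_trans (ltW pv); apply: cum_ge0 => w; exact: ltW.
    split => //; have [r0 rv] := cum_rho v0 va.
    by rewrite -[_ <= q]le_cumE// rv vq andbT ltNge -le_cumE// rv -ltNge.
  rewrite cumB// /Rintegral fineK; last first.
    by apply: integrable_fin_num => //; exact: rate_integrable.
  rewrite m2E; apply: eq_integral => r; rewrite inE/= in_itv/= => /andP[pr _].
  by rewrite /length_weight indicE mem_set ?mul1r//= in_itv/= andbT (le_trans p0 (ltW pr)).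
have m12 (A : set (measurableTypeR R)) : measurable A -> m1 A = m2 A.
  apply: (@measure_unique _ R (measurableTypeR R) (@ocitv R) (fun n => `](- n.+1%:R), n.+1%:R]%classic) _ _ _ _ m1 m2) => //.
  - exact: ocitvI.
  - by move=> n; exists (- n.+1%:R, n.+1%:R).
  - apply/seteqP; split=> // x _; exists (Num.bound `|x|) => //=.
    rewrite /= in_itv/=.
    have : `|x| < (Num.bound `|x|).+1%:R.
      by apply: lt_trans (archi_boundP (normr_ge0 x)) _; rewrite ltr_nat.
    by rewrite ltr_norml => /andP[-> /ltW].
  - move=> _ [[p q] _ <-]/=.
    have [q0|q0] := ltP q 0; first by have [h1 h2] := m_neg p q q0; exact: etrans h1 (esym h2).
    have [p0|p0] := ltP p 0; first by have [h1 h2] := m_mid p q p0 q0; exact: etrans h1 (esym h2).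
    have [pq|qp] := leP p q; first by have [h1 h2] := m_pos p q p0 pq; exact: etrans h1 (esym h2).
    have -> : `]p, q]%classic = set0 by rewrite set_itv_ge// bnd_simp -leNgt ltW.
    exact: etrans (measure0 m1) (esym (measure0 m2)).
  - by move=> n; have [-> _] := m_mid (- n.+1%:R) n.+1%:R ltac:(by rewrite oppr_lt0) ltac:(by []); rewrite ltry.
transitivity (\int[m2]_r H r)%E.
  rewrite ge0_integral_density// [LHS]integral_mkcond; apply: eq_integral => r _.
  rewrite patchE /length_weight indicE; case: ifPn => _ /=.
    by rewrite mul1r.
  by rewrite mul0r mule0.
transitivity (\int[m1]_r H r)%E.
  by apply: (@eq_measure_integral _ _ _ setT m1) => A mA _; rewrite m12.
transitivity (\int[m0]_v H (rho b v))%E.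
  exact: ge0_integral_pushforward.
rewrite ge0_integral_density//; last exact: measurableT_comp mH mrho.
rewrite [RHS]integral_mkcond; apply: eq_integral => r _.
rewrite patchE /alive_weight indicE; case: ifPn => _ /=.
  by rewrite mule1.
by rewrite mule0.
Qed.

End speed.

(** * Lebesgue measure on R^d *)

Section lebesgue_rV_theory.
Context (R : realType).
Notation leb := (@lebesgue_measure R).
Local Open Scope ereal_scope.

Lemma ge0_integral_lebesgue_rVS n (f : 'rV[R]_n.+1 -> \bar R) :
  measurable_fun setT f -> (forall x, 0 <= f x) ->
  \int[lebesgue_rV R n.+1]_x f x =
  \int[leb]_a \int[lebesgue_rV R n]_x f (cons_rV (a, x)).
Proof.
move=> mf f0.
transitivity (\int[(leb \x lebesgue_rV R n)]_p f (cons_rV p)).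
  have := @ge0_integral_pushforward _ _ (measurableTypeR R * 'rV[R]_n)%type
    _ R _ (@measurable_cons_rV R n) (leb \x lebesgue_rV R n) setT f measurableT mf.
  by rewrite preimage_setT => /(_ (fun y _ => f0 y)) <-.
by rewrite fubini_tonelli1//; apply: measurableT_comp => //; exact: measurable_cons_rV.
Qed.

Lemma measurable_rV_shift n (c : 'rV[R]_n) : measurable_fun setT (fun x : 'rV[R]_n => x + c)%R.
Proof.
apply: measurable_fun_rVP => i; under eq_fun do rewrite mxE.
by apply: measurable_funD => //; exact: measurable_coor.
Qed.

Lemma ge0_integral_rV_shift n (c : 'rV[R]_n) (f : 'rV[R]_n -> \bar R) :
  measurable_fun setT f -> (forall x, 0 <= f x) ->
  \int[lebesgue_rV R n]_x f (x + c)%R = \int[lebesgue_rV R n]_x f x.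
Proof.
elim: n c f => [|n IH] c f mf f0.
  by apply: eq_integral => x _; congr f; rewrite !thinmx0.
rewrite (ge0_integral_lebesgue_rVS mf f0).
rewrite (ge0_integral_lebesgue_rVS (measurableT_comp mf (measurable_rV_shift c)) (fun x => f0 _)).
have mfc a : measurable_fun setT (fun x : 'rV[R]_n => f (cons_rV (a, x))).
  apply: measurableT_comp => //; apply: measurableT_comp; first exact: measurable_cons_rV.
  exact: measurable_pair1.
pose G a := \int[lebesgue_rV R n]_x f (cons_rV (a, x)).
have mG : measurable_fun [set: R] G.
  apply: (measurable_fun_fubini_tonelli_F (fun p : R * 'rV[R]_n => f (cons_rV p))) => //.
  exact: (measurableT_comp mf (@measurable_cons_rV R n)).
have G0 a : 0 <= G a by apply: integral_ge0.
transitivity (\int[leb]_a G (a + c 0 ord0)%R); last exact: ge0_integral_shift.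
apply: eq_integral => a _.
rewrite /G -(IH (\row_i c 0 (lift ord0 i))%R _ (mfc _) (fun x => f0 _)); apply: eq_integral => x _.
congr f; apply/rowP => i; rewrite !mxE.
by case: unliftP => [j|] -> /=; rewrite ?mxE.
Qed.

Definition box n (r : R) : set 'rV[R]_n := [set x | forall i, (`|x 0 i| <= r)%R].

Lemma measurable_box n r : measurable (@box n r).
Proof.
rewrite (_ : box r = \bigcap_(i in [set: 'I_n]) ((fun x : 'rV[R]_n => x 0%R i) @^-1` `[(- r)%R, r]%classic)).
  apply: fin_bigcap_measurable => // i _; rewrite -[X in measurable X]setTI.
  exact: (@measurable_coor R n i).
apply/seteqP; split=> x H i; first by move=> _ /=; rewrite in_itv/= -ler_norml.
by have := H i I; rewrite /= in_itv/= -ler_norml.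
Qed.

Lemma lebesgue_rV_box n (r : R) : (0 <= r)%R ->
  lebesgue_rV R n (box r) = ((2 * r) ^+ n)%:E.
Proof.
move=> r0; elim: n => [|n IH].
  by rewrite /= diracE mem_set// => -[].
transitivity ((leb \x lebesgue_rV R n) (`[(- r)%R, r]%classic `*` @box n r)).
  rewrite /= /pushforward; congr ((_ \x _) _).
  apply/seteqP; split=> [[a x]|[a x] []]/=; rewrite in_itv/= -ler_norml.
    move=> H; split; first by have := H ord0; rewrite mxE unlift_none.
    by move=> i; have := H (lift ord0 i); rewrite mxE liftK.
  by move=> ar xr i; rewrite mxE; case: unliftP => [j|] _ //=.
rewrite product_measure1E//; last exact: measurable_box.
rewrite IH /= lebesgue_measure_itv/= lte_fin.
case: ltP => [_|rr]; first by rewrite -EFinB -EFinM exprS; congr (_%:E); rewrite opprK -mulr2n mulr_natl.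
have -> : r = 0%R by lra.
by rewrite mulr0 exprS mul0r mul0e.
Qed.

End lebesgue_rV_theory.

Section velocity_integral.
Context (R : realType) (d : nat).
Notation E := ('rV[R]_d * velocity d)%type.

Lemma ge0_integral_counting_velocity (g : velocity d -> \bar R) :
  (forall th, 0 <= g th)%E ->
  (\int[counting_velocity R d]_th g th = \sum_(th : velocity d) g th)%E.
Proof.
move=> g0.
have -> : [set: velocity d] = \big[setU/set0]_(th <- index_enum (velocity d)) [set th].
  apply/seteqP; split=> // th _.
  by rewrite -bigcup_seq; exists th => //=; rewrite mem_index_enum.
rewrite ge0_integral_bigsetU//=.
- apply: eq_bigr => th _; rewrite (eq_integral (cst (g th))); last first.
    by move=> x; rewrite inE => ->.
  rewrite integral_cst// [X in (_ * X)%E](_ : _ = 1%E) ?mule1//.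
  rewrite /= /counting_velocity /counting/= asboolT; last exact: finite_set1.
  by rewrite fset_set1 finmap.cardfs1.
- exact: index_enum_uniq.
- by apply/trivIsetP => i j _ _ ij; apply/seteqP; split=> // x [/= -> /eqP]; rewrite (negbTE ij).
Qed.

Lemma measurable_fun_velocity d1 d2 (T1 : measurableType d1) (T2 : measurableType d2)
    (f : T1 * velocity d -> T2) :
  (forall th, measurable_fun setT (fun x => f (x, th))) -> measurable_fun setT f.
Proof.
move=> mf _ A mA; rewrite setTI.
rewrite (_ : f @^-1` A = \big[setU/set0]_(th <- index_enum (velocity d))
    (((fun x => f (x, th)) @^-1` A) `*` [set th])).
  apply: bigsetU_measurable => th _; apply: measurableX => //.
  by rewrite -[X in measurable X]setTI; exact: mf.
rewrite -bigcup_seq; apply/seteqP; split=> [[x th] Ax|[x th] [th' _ [/= + ->]]//].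
by exists th => //=; rewrite mem_index_enum.
Qed.

Lemma ge0_integral_base_measure (f : E -> \bar R) :
  measurable_fun setT f -> (forall z, 0 <= f z)%E ->
  (\int[base_measure R d]_z f z =
   \sum_(th : velocity d) \int[lebesgue_rV R d]_x f (x, th))%E.
Proof.
move=> mf f0; rewrite /base_measure fubini_tonelli1// fubini_tonelli//.
rewrite ge0_integral_counting_velocity// => th.
by apply: integral_ge0.
Qed.

End velocity_integral.

(** * Trajectories and their weights *)

Section rays.
Context (R : realType) (d : nat).
Notation E := ('rV[R]_d * velocity d)%type.

Definition ray (z : E) (r : R) : E := (z.1 + r *: velocity_rV R z.2, z.2).

Definition negv (th : velocity d) : velocity d := [ffun i => ~~ th i].

Definition negz (z : E) : E := (z.1, negv z.2).

Lemma negvK : involutive negv.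
Proof. by move=> th; apply/ffunP => i; rewrite !ffunE negbK. Qed.

Lemma negzK : involutive negz.
Proof. by case=> x th; rewrite /negz/= negvK. Qed.

Lemma flipK j : involutive (@flip d j).
Proof.
by move=> th; apply/ffunP => i; rewrite !ffunE; case: (i == j); rewrite ?negbK.
Qed.

Lemma sgn_negv (th : velocity d) (i : 'I_d) : sgn R (negv th) i = - sgn R th i.
Proof. by rewrite /sgn ffunE; case: (th i); rewrite /= ?opprK. Qed.

Lemma sgn_flip (th : velocity d) (i : 'I_d) : sgn R (flip i th) i = - sgn R th i.
Proof. by rewrite /sgn ffunE eqxx; case: (th i); rewrite /= ?opprK. Qed.

Lemma sgn_sqr (th : velocity d) (i : 'I_d) : sgn R th i * sgn R th i = 1.
Proof. by rewrite /sgn; case: (th i); rewrite ?mulr1// mulrNN mulr1. Qed.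

Lemma normr_sgn (th : velocity d) (i : 'I_d) : `|sgn R th i| = 1.
Proof. by rewrite /sgn; case: (th i); rewrite ?normrN normr1. Qed.

Lemma velocity_rV_negv (th : velocity d) : velocity_rV R (negv th) = - velocity_rV R th.
Proof. by apply/rowP => i; rewrite !mxE sgn_negv. Qed.

Lemma ray0 z : ray z 0 = z.
Proof. by case: z => x th; rewrite /ray scale0r addr0. Qed.

(** Retracing a segment from its end: this converts what is seen from the start into what is seen
    from the end, for [weight_reverse]. *)
Lemma ray_shift (x : 'rV[R]_d) (th : velocity d) (r v : R) :
  ray (x - r *: velocity_rV R th, th) v = negz (ray (negz (x, th)) (r - v)).
Proof.
rewrite /ray /negz/= negvK velocity_rV_negv scalerN scalerBl; congr (_, _).
by rewrite opprB addrA addrAC.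
Qed.

Lemma measurable_velocity d2 (T2 : measurableType d2) (f : velocity d -> T2) :
  measurable_fun setT f.
Proof. by []. Qed.

Lemma measurable_ray : measurable_fun setT (fun p : E * R => ray p.1 p.2).
Proof.
apply: measurable_fun_pair => /=; last exact: (measurableT_comp measurable_snd measurable_fst).
apply: measurable_fun_rVP => i; under eq_fun do rewrite !mxE.
apply: measurable_funD.
  apply: (measurableT_comp (@measurable_coor R d i)).
  exact: (measurableT_comp measurable_fst measurable_fst).
apply: measurable_funM; first exact: measurable_snd.
exact: (measurableT_comp (@measurable_velocity _ _ (fun th => sgn R th i))
  (measurableT_comp measurable_snd measurable_fst)).
Qed.

Lemma measurable_negz : measurable_fun setT negz.
Proof.
apply: measurable_fun_pair => /=; first exact: measurable_fst.
exact: (measurableT_comp (measurable_velocity negv) measurable_snd).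
Qed.

Lemma measurable_flipz j : measurable_fun setT (fun z : E => (z.1, flip j z.2)).
Proof.
apply: measurable_fun_pair => /=; first exact: measurable_fst.
exact: (measurableT_comp (measurable_velocity (flip j)) measurable_snd).
Qed.

Lemma measurable_ray1 z : measurable_fun setT (ray z).
Proof.
exact: (measurableT_comp measurable_ray (measurable_pair1 z)).
Qed.

Lemma continuous_ray (z : E) : continuous (fun r : R => (ray z r).1).
Proof.
move=> r; apply: cvgD; first exact: cvg_cst.
by apply: cvgZl; exact: cvg_id.
Qed.

Lemma is_derive_ray (f : 'rV[R]_d -> R) (z : E) (r : R) : C1 f ->
  is_derive r (1 : R) (fun v : R => f (ray z v).1)
    (\sum_i sgn R z.2 i * partial i f (ray z r).1).
Proof.
move=> [df _].
set v := velocity_rV R z.2; set x := (ray z r).1.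
have E1 : (fun h : R => h^-1 *: ((f \o (fun w : R => (ray z w).1)) (h *: (1 : R) + r) - f x)) =
  (fun h : R => h^-1 *: ((f \o shift x) (h *: v) - f x)).
  apply/funext => h; congr (_ *: (f _ - _)); rewrite /= /x /ray/=.
  by rewrite scalerDl addrCA; congr (_ *: _ + _); exact: mulr1.
have dfx : derivable f x v by exact: diff_derivable.
have val : 'D_v f x = \sum_i sgn R z.2 i * partial i f x.
  rewrite deriveE// [in LHS](row_sum_delta v) linear_sum; apply: eq_bigr => i _.
  by rewrite linearZ/= /v mxE /partial deriveE.
apply: DeriveDef.
  by rewrite /derivable E1.
by rewrite -val /derive E1.
Qed.

End rays.

Lemma continuous_sumr (R : realType) (X : topologicalType) n (F : 'I_n -> X -> R) :
  (forall i, continuous (F i)) -> continuous (fun x => \sum_i F i x).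
Proof. by move=> cF; apply: continuous_big => // [[x y]]; exact: add_continuous. Qed.

Record regular_suzz (R : realType) (d : nat) (U s : 'rV[R]_d -> R)
    (gamma : 'I_d -> 'rV[R]_d -> velocity d -> R) (gbar : R) : Prop := {
  regular_U : C1 U;
  regular_s : C1 s;
  regular_s_gt0 : forall x, 0 < s x;
  regular_gamma_ge0 : forall i x th, 0 <= gamma i x th;
  regular_gamma_measurable :
    forall i th, measurable_fun [set: 'rV[R]_d] (gamma i ^~ th);
  regular_gamma_indep : forall i x th th', gamma i x th = gamma i x th';
  regular_gamma_le : forall i x th, gamma i x th <= gbar }.

Section suzz_weight.
Context (R : realType) (d : nat) (U s : 'rV[R]_d -> R)
  (gamma : 'I_d -> 'rV[R]_d -> velocity d -> R) (gbar : R).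
Hypothesis reg : regular_suzz U s gamma gbar.
Let U_C1 := regular_U reg.
Let s_C1 := regular_s reg.
Let s_gt0 := regular_s_gt0 reg.
Let gamma_ge0 := regular_gamma_ge0 reg.
Let gamma_measurable := regular_gamma_measurable reg.
Let gamma_indep := regular_gamma_indep reg.
Let gamma_le := regular_gamma_le reg.
Notation E := ('rV[R]_d * velocity d)%type.
Notation leb := (@lebesgue_measure R).
Notation lam := (suzz_rate U s gamma).

Lemma continuous_drift i : continuous (drift U s i).
Proof.
case: U_C1 => _ cU; case: (s_C1) => _ cs x.
apply: (@continuousB _ _ _ (fun x => s x * partial i U x) (partial i s)); last exact: cs.
by apply: continuousM; [exact: (C1_continuous s_C1)|exact: cU].
Qed.

Let continuous_comp_ray (f : 'rV[R]_d -> R) z : continuous f ->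
  continuous (fun r => f (ray z r).1).
Proof.
move=> cf r; apply: (@continuous_comp _ _ _ (fun r => (ray z r).1) f r).
  exact: continuous_ray.
exact: cf.
Qed.

Definition total_rate (z : E) : R := \sum_i lam i z.

Lemma suzz_rate_ge0 i z : 0 <= lam i z.
Proof. by rewrite addr_ge0// le_max lexx orbT. Qed.

Lemma total_rate_ge0 z : 0 <= total_rate z.
Proof. by apply: sumr_ge0 => i _; exact: suzz_rate_ge0. Qed.

Lemma suzz_rate_le i z : lam i z <= `|drift U s i z.1| + gbar.
Proof.
rewrite lerD// ge_max normr_ge0 andbT.
by rewrite (le_trans (ler_norm _))// normrM normr_sgn mul1r.
Qed.

(** Rate i sees the velocity only through its i-th sign, which the flip and the reversal change
    alike. This is the skew balance behind [jump_dual]. *)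
Lemma suzz_rate_flip i x th : lam i (x, flip i th) = lam i (x, negv th).
Proof. by rewrite /suzz_rate/= sgn_flip sgn_negv (gamma_indep _ _ _ (negv th)). Qed.

(** From max (y, 0) - max (- y, 0) = y; the refreshment terms cancel, as they do not see the
    velocity. *)
Lemma total_rate_negz z :
  total_rate (negz z) = total_rate z - \sum_i sgn R z.2 i * drift U s i z.1.
Proof.
rewrite /total_rate -sumrB; apply: eq_bigr => i _.
rewrite /suzz_rate/= sgn_negv (gamma_indep _ _ _ z.2) mulNr.
set y := sgn _ _ _ * _; case: (leP y 0) => y0.
  by rewrite max_l ?oppr_ge0//; ring.
by rewrite max_r ?oppr_le0 ?ltW//; ring.
Qed.

Lemma measurable_suzz_rate i : measurable_fun setT (lam i).
Proof.
apply: measurable_fun_velocity => th.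
apply: measurable_funD; last exact: gamma_measurable.
apply: measurable_maxr => //; apply: measurable_funM => //.
by apply: continuous_measurable_rV; exact: continuous_drift.
Qed.

Lemma measurable_total_rate : measurable_fun setT total_rate.
Proof. by apply: measurable_sum => i; exact: measurable_suzz_rate. Qed.

Lemma measurable_speed : measurable_fun setT (fun z : E => s z.1).
Proof.
exact: (measurableT_comp (continuous_measurable_rV (C1_continuous s_C1)) measurable_fst).
Qed.

(* Rates are per unit of the parameter [r] of the ray, which elapses at speed [s],
   and include killing at rate [a] per unit of time. *)
Definition ray_rate (a : R) (z : E) (r : R) : R :=
  (a + total_rate (ray z r)) / s (ray z r).1.

Definition ray_speed (z : E) (r : R) : R := (s (ray z r).1)^-1.

Lemma continuous_ray_speed z : continuous (ray_speed z).
Proof.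
move=> r; apply: cvgV; first by rewrite gt_eqF.
exact: (continuous_comp_ray (C1_continuous s_C1)).
Qed.

Lemma ray_speed_gt0 z r : 0 < ray_speed z r.
Proof. by rewrite invr_gt0. Qed.

Lemma measurable_ray_speed : measurable_fun setT (fun p : E * R => ray_speed p.1 p.2).
Proof.
have cs : continuous (fun x => (s x)^-1).
  by move=> x; apply: continuousV; [rewrite lt0r_neq0|exact: C1_continuous].
have ms : measurable_fun setT (fun z : E => (s z.1)^-1).
  exact: (measurableT_comp (continuous_measurable_rV cs) measurable_fst).
exact: (measurableT_comp ms (@measurable_ray R d)).
Qed.

Lemma measurable_ray_rate a :
  measurable_fun setT (fun p : E * R => ray_rate a p.1 p.2).
Proof.
apply: measurable_funM; last exact: measurable_ray_speed.
apply: measurable_funD => //.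
exact: (measurableT_comp measurable_total_rate (@measurable_ray R d)).
Qed.

Lemma ray_rate_ge0 a z r : 0 <= a -> 0 <= ray_rate a z r.
Proof. by move=> a0; rewrite divr_ge0 ?addr_ge0 ?total_rate_ge0// ltW. Qed.

Lemma locally_bounded_ray_rate a z : 0 <= a -> locally_bounded_rate (ray_rate a z).
Proof.
move=> a0; split.
- exact: (measurableT_comp (measurable_ray_rate a) (measurable_pair1 z)).
- by move=> v; exact: ray_rate_ge0.
move=> r; have [r0|r0] := leP 0 r; last first.
  by exists 0 => v /andP[v0 vr]; have := le_lt_trans (le_trans v0 vr) r0; rewrite ltxx.
(* A continuous envelope of the rate, which attains its maximum on [0, r]; refreshment enters it
   only through the bound [gbar]. *)
pose h i v := `|drift U s i (ray z v).1| + gbar.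
pose g v := (a + \sum_i h i v) * ray_speed z v.
have cg : continuous g.
  move=> v; apply: (@continuousM _ _ (fun v => a + \sum_i h i v) (ray_speed z)); last exact: continuous_ray_speed.
  apply: (@continuousD _ _ _ (cst a) (fun v => \sum_i h i v)); first exact: cst_continuous.
  apply: continuous_sumr => i w.
  apply: (@continuousD _ _ _ (fun v => `|drift U s i (ray z v).1|) (cst gbar)); last exact: cst_continuous.
  apply: cvg_norm; exact: (continuous_comp_ray (@continuous_drift i)).
have [c _ cP] := EVT_max r0 (continuous_subspaceT cg).
exists (g c) => v vr; apply: (@le_trans _ _ (g v)); last by apply: cP; rewrite in_itv.
apply: ler_wpM2r; first exact/ltW/ray_speed_gt0.
rewrite lerD2l; apply: ler_sum => i _.
exact: suzz_rate_le.
Qed.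

Definition ray_weight a (z : E) (r : R) : R :=
  expR (- cum (ray_rate a z) r) * ray_speed z r.

Lemma weight_ge0 a z r : 0 <= ray_weight a z r.
Proof. by rewrite mulr_ge0 ?expR_ge0// ltW ?ray_speed_gt0. Qed.

Lemma measurable_cum_ray_rate a : 0 <= a ->
  measurable_fun setT (fun p : E * R => cum (ray_rate a p.1) p.2).
Proof.
move=> a0; apply: (measurable_cum (F := fun p : E * R => ray_rate a p.1 p.2)).
  exact: measurable_ray_rate.
by move=> p; exact: ray_rate_ge0.
Qed.

Lemma measurable_weight a : 0 <= a ->
  measurable_fun setT (fun p : E * R => ray_weight a p.1 p.2).
Proof.
move=> a0; apply: measurable_funM; last exact: measurable_ray_speed.
apply: measurableT_comp => //; apply: measurable_funN.
exact: measurable_cum_ray_rate.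
Qed.

(** exp (- potential) is s exp (- U), that is the speed times the unnormalized target density. Its
    derivative along a ray is [ray_drift]. *)
Let potential (x : 'rV[R]_d) : R := U x - ln (s x).

Let ray_drift (z : E) (r : R) : R :=
  (\sum_i sgn R z.2 i * drift U s i (ray z r).1) * ray_speed z r.

Let continuous_ray_drift z : continuous (ray_drift z).
Proof.
move=> v; apply: (@continuousM _ _ (fun v => \sum_i sgn R z.2 i * drift U s i (ray z v).1) (ray_speed z)); last exact: continuous_ray_speed.
apply: continuous_sumr => i w.
apply: (@continuousM _ _ (cst (sgn R z.2 i)) (fun v => drift U s i (ray z v).1)); first exact: cst_continuous.
exact: (continuous_comp_ray (@continuous_drift i)).
Qed.

Let is_derive_potential z (r : R) :
  is_derive r (1 : R) (fun v => potential (ray z v).1) (ray_drift z r).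
Proof.
have dU := is_derive_ray z r U_C1.
have ds := is_derive_ray z r s_C1.
have dln := @is_derive1_comp R (@ln R) _ r _ _ (is_derive1_ln (s_gt0 _)) ds.
have h := is_deriveB dU dln.
apply: (is_derive_eq h).
rewrite /ray_drift /ray_speed /drift.
rewrite [RHS]mulrC mulr_sumr mulr_sumr -sumrB; apply: eq_bigr => i _.
by field; rewrite gt_eqF.
Qed.

Let cum_ray_drift z r : 0 <= r ->
  \int[leb]_(v in `[0, r]) ray_drift z v = potential (ray z r).1 - potential z.1.
Proof.
rewrite le_eqVlt => /predU1P[<-|r0].
  by rewrite set_itv1 Rintegral_set1 ray0 subrr.
have cP t : {for t, continuous (fun v => potential (ray z v).1)}.
  by apply/differentiable_continuous/derivable1_diffP; case: (is_derive_potential z t).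
rewrite /Rintegral (continuous_FTC2 (F := fun v => potential (ray z v).1) r0).
- by rewrite -EFinB/= scale0r addr0.
- exact: continuous_subspaceT.
- split.
  + by move=> t _; case: (is_derive_potential z t).
  + by apply: cvg_at_right_filter; exact: cP.
  + by apply: cvg_at_left_filter; exact: cP.
- by move=> t _; rewrite derive1E; case: (is_derive_potential z t).
Qed.

(* The change of the total rate under reversal of the velocity is the
   derivative of [U - ln s] along the line, so that reversing a segment of a
   trajectory changes its ray_weight by the ratio of the densities. *)
Lemma weight_reverse a x th r : 0 <= a -> 0 <= r ->
  ray_weight a (x - r *: velocity_rV R th, th) r * expR (- U (x - r *: velocity_rV R th)) =
  ray_weight a (x, negv th) r * expR (- U x).
Proof.
move=> a0 r0; set z := (x, negv th).
set y := x - r *: velocity_rV R th.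
have yE : y = (ray z r).1 by rewrite /ray/= velocity_rV_negv scalerN.
have ray_r : (ray (y, th) r).1 = x by rewrite /ray/= /y subrK.
(* The rate, killing included, of the reversed states met along the ray from z; the rate seen from y
   at v is its value at r - v. Only the drift part has to be integrated explicitly, and it is the
   derivative of the potential. *)
pose phi w := ray_rate a z w - ray_drift z w.
have phiE v : ray_rate a (y, th) v = phi (r - v).
  rewrite /ray_rate ray_shift /phi /ray_rate /ray_drift /ray_speed -mulrBl.
  by rewrite /= -/z total_rate_negz -addrA.
have phi_ge0 v : 0 <= phi v.
  by rewrite -(subKr r v) -phiE ray_rate_ge0.
have mphi : measurable_fun setT phi.
  apply: measurable_funB; first by case: (locally_bounded_ray_rate z a0).
  by apply: continuous_measurable_fun; exact: continuous_ray_drift.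
have cumE1 : cum (ray_rate a (y, th)) r =
    cum (ray_rate a z) r - (potential y - potential x).
  have -> : cum (ray_rate a (y, th)) r = \int[leb]_(v in `[0, r]) phi v.
    rewrite /cum /Rintegral; congr fine.
    rewrite -(ge0_integral_reflect r (f := EFin \o phi)).
    - by apply: eq_integral => v _; rewrite phiE.
    - exact/measurable_EFinP.
    - by move=> v; rewrite lee_fin.
  rewrite RintegralB//.
  - by rewrite cum_ray_drift// yE.
  - by apply: rate_integrable => //; exact: locally_bounded_ray_rate.
  - apply: continuous_compact_integrable; first exact: segment_compact.
    exact/continuous_subspaceT/continuous_ray_drift.
rewrite /ray_weight cumE1 /ray_speed ray_r -yE -/y /potential.
have sx := s_gt0 x; have sy := s_gt0 y.
(* The ln s part of the potential difference trades the speed factor at x for the one at y, while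
   the U part trades the densities. *)
have -> : (s x)^-1 = expR (- ln (s x)) by rewrite expRN lnK.
have -> : (s y)^-1 = expR (- ln (s y)) by rewrite expRN lnK.
rewrite -!expRD; congr expR; ring.
Qed.

End suzz_weight.

(** * Duality and the resolvent *)

Section duality.
Context (R : realType) (d : nat) (U s : 'rV[R]_d -> R)
  (gamma : 'I_d -> 'rV[R]_d -> velocity d -> R) (gbar : R).
Hypothesis reg : regular_suzz U s gamma gbar.
Let U_C1 := regular_U reg.
Notation E := ('rV[R]_d * velocity d)%type.
Notation leb := (@lebesgue_measure R).
Notation lam := (suzz_rate U s gamma).
Notation weight := (ray_weight U s gamma).
Notation mu := (target_measure U_C1).
Local Open Scope ereal_scope.

Definition nn_measurable (f : E -> \bar R) :=
  measurable_fun setT f /\ forall z, 0 <= f z.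

Definition fly (a : R) (f : E -> \bar R) (z : E) : \bar R :=
  \int[leb]_(r in `[0%R, +oo[) (f (ray z r) * (weight a z r)%:E).

Definition jump (f : E -> \bar R) (z : E) : \bar R :=
  \sum_(j < d) (lam j z)%:E * f (z.1, flip j z.2).

Lemma nn_ray_weight a f : (0 <= a)%R -> nn_measurable f ->
  measurable_fun setT (fun p : E * R => f (ray p.1 p.2) * (weight a p.1 p.2)%:E).
Proof.
move=> a0 [mf _]; apply: emeasurable_funM.
  exact: (measurableT_comp mf (@measurable_ray R d)).
by apply/measurable_EFinP; exact: (measurable_weight reg a0).
Qed.

Lemma nn_fly a f : (0 <= a)%R -> nn_measurable f -> nn_measurable (fly a f).
Proof.
move=> a0 nf; have w0 := weight_ge0 reg; split; last first.
  by move=> z; apply: integral_ge0 => r _; rewrite mule_ge0 ?lee_fin//; case: nf.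
apply: (measurable_integral_half_line (nn_ray_weight a0 nf)) => -[z r].
by rewrite mule_ge0 ?lee_fin//; case: nf.
Qed.

Lemma nn_jump f : nn_measurable f -> nn_measurable (jump f).
Proof.
move=> [mf f0]; split; last first.
  by move=> z; apply: sume_ge0 => j _; rewrite mule_ge0// lee_fin (suzz_rate_ge0 reg).
apply: emeasurable_sum => j; apply: emeasurable_funM.
  by apply/measurable_EFinP; exact: (measurable_suzz_rate reg).
exact: (measurableT_comp mf (@measurable_flipz R d j)).
Qed.

Lemma nn_negz f : nn_measurable f -> nn_measurable (f \o @negz R d).
Proof.
by move=> [mf f0]; split => [|z]; [exact: (measurableT_comp mf (@measurable_negz R d))|exact: f0].
Qed.

Lemma nn_mul f g : nn_measurable f -> nn_measurable g ->
  nn_measurable (fun z => f z * g z).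
Proof.
by move=> [mf f0] [mg g0]; split => [|z]; [exact: emeasurable_funM|rewrite mule_ge0].
Qed.

Lemma nn_cst c : 0 <= c -> nn_measurable (cst c).
Proof. by move=> c0; split => [|z]. Qed.

Let c : R := ((2 ^+ d * normalization U)^-1)%R.

Let c_ge0 : (0 <= c)%R.
Proof.
rewrite invr_ge0 mulr_ge0 ?exprn_ge0//.
by apply: Rintegral_ge0 => x _; exact: expR_ge0.
Qed.

Lemma ge0_integral_target f : nn_measurable f ->
  \int[mu]_z f z =
  \sum_(th : velocity d) \int[lebesgue_rV R d]_x (f (x, th) * (c * expR (- U x))%:E).
Proof.
move=> [mf f0]; rewrite /target_measure ge0_integral_density//.
rewrite ge0_integral_base_measure//.
  apply: emeasurable_funM => //; apply/measurable_EFinP.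
  exact: (measurable_target_pdf (C1_continuous U_C1)).
by move=> z; rewrite mule_ge0// lee_fin target_pdf_ge0.
Qed.

Let measurable_dens : measurable_fun setT (fun x => (c * expR (- U x))%:E).
Proof.
apply/measurable_EFinP; apply: measurable_funM => //.
apply: measurableT_comp => //; apply: measurable_funN.
exact: (continuous_measurable_rV (C1_continuous U_C1)).
Qed.

Let dens_ge0 x : 0 <= (c * expR (- U x))%:E.
Proof. by rewrite lee_fin mulr_ge0// expR_ge0. Qed.

Let measurable_section f th : nn_measurable f -> measurable_fun setT (fun x => f (x, th)).
Proof. by move=> [mf _]; exact: (measurableT_comp mf (measurable_pair2 th)). Qed.

Lemma integral_negz f : nn_measurable f -> \int[mu]_z f (negz z) = \int[mu]_z f z.
Proof.
move=> nf; rewrite (ge0_integral_target (nn_negz nf)) (ge0_integral_target nf).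
by rewrite (reindex_inj (inv_inj (@negvK d)))/=; apply: eq_bigr => th _;
  apply: eq_integral => x _; rewrite /= /negz/= negvK.
Qed.

(** Holds position by position: in the sum over velocities, the substitution theta |-> flip j theta
    exchanges the arguments of f and g, and [suzz_rate_flip] rewrites rate j at the reversed
    velocity. *)
Lemma jump_dual f g : nn_measurable f -> nn_measurable g ->
  \int[mu]_z (f z * jump g z) = \int[mu]_z (g z * jump (f \o @negz R d) (negz z)).
Proof.
move=> nf ng; have nfn := nn_negz nf.
rewrite (ge0_integral_target (nn_mul nf (nn_jump ng))).
rewrite (ge0_integral_target (nn_mul ng (nn_negz (nn_jump nfn)))).
have H (F : velocity d -> 'rV[R]_d -> \bar R) :
    (forall th, measurable_fun setT (F th)) -> (forall th x, 0 <= F th x) ->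
    \sum_(th : velocity d) \int[lebesgue_rV R d]_x F th x =
    \int[lebesgue_rV R d]_x \sum_(th : velocity d) F th x.
  by move=> mF F0; rewrite ge0_integral_sum.
rewrite H; last 2 first.
- move=> th; apply: emeasurable_funM => //.
  exact: (measurable_section th (nn_mul nf (nn_jump ng))).
- by move=> th x; rewrite mule_ge0// (nn_mul nf (nn_jump ng)).2.
rewrite H; last 2 first.
- move=> th; apply: emeasurable_funM => //.
  exact: (measurable_section th (nn_mul ng (nn_negz (nn_jump nfn)))).
- by move=> th x; rewrite mule_ge0// (nn_mul ng (nn_negz (nn_jump nfn))).2.
apply: eq_integral => x _.
rewrite -!ge0_sume_distrl//; last 2 first.
- by move=> th _; exact: (nn_mul ng (nn_negz (nn_jump nfn))).2.
- by move=> th _; exact: (nn_mul nf (nn_jump ng)).2.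
congr (_ * _).
have lam0 j z : 0 <= (lam j z)%:E by rewrite lee_fin (suzz_rate_ge0 reg).
under eq_bigr => th _.
  rewrite /jump ge0_sume_distrr; last by move=> j _; rewrite mule_ge0//; case: ng.
  over.
under [RHS]eq_bigr => th _.
  rewrite /jump ge0_sume_distrr; last first.
    by move=> j _; rewrite mule_ge0//; case: nfn => _; exact.
  over.
rewrite /= exchange_big [RHS]exchange_big/=; apply: eq_bigr => j _.
rewrite (reindex_inj (inv_inj (@flipK d j)))/=; apply: eq_bigr => th _.
rewrite flipK (suzz_rate_flip reg) muleCA [RHS]muleCA; congr (_ * _).
rewrite muleC; congr (g _ * f _).
rewrite /negz/=; congr (_, _); apply/ffunP => i; rewrite !ffunE.
by case: ifP; rewrite ?negbK.
Qed.

(** At a fixed velocity and a fixed r, translating x by - r theta takes the end of the segment as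
    base point; [weight_reverse] then moves the density from one end to the other. Tonelli allows r
    to be fixed. *)
Lemma fly_dual a f g : (0 <= a)%R -> nn_measurable f -> nn_measurable g ->
  \int[mu]_z (f z * fly a g z) =
  \int[mu]_z (g z * fly a (f \o @negz R d) (negz z)).
Proof.
move=> a0 nf ng; have nfn := nn_negz nf; have w0 := weight_ge0 reg.
have wE0 z r : 0 <= (weight a z r)%:E by rewrite lee_fin.
rewrite (ge0_integral_target (nn_mul nf (nn_fly a0 ng))).
rewrite (ge0_integral_target (nn_mul ng (nn_negz (nn_fly a0 nfn)))).
apply: eq_bigr => th _.
pose F (p : 'rV[R]_d * R) : \bar R := f (p.1, th) *
  (g (ray (p.1, th) p.2) * (weight a (p.1, th) p.2)%:E) * (c * expR (- U p.1))%:E.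
pose G (p : 'rV[R]_d * R) : \bar R := g (p.1, th) *
  (f (negz (ray (negz (p.1, th)) p.2)) * (weight a (negz (p.1, th)) p.2)%:E) *
  (c * expR (- U p.1))%:E.
have mpair : measurable_fun setT (fun p : 'rV[R]_d * R => ((p.1, th), p.2)).
  apply: measurable_fun_pair; last exact: measurable_snd.
  exact: (measurableT_comp (measurable_pair2 th) measurable_fst).
have mfst : measurable_fun setT (fun p : 'rV[R]_d * R => (p.1, th)).
  exact: (measurableT_comp (measurable_pair2 th) measurable_fst).
have mdens : measurable_fun setT (fun p : 'rV[R]_d * R => (c * expR (- U p.1))%:E).
  exact: (measurableT_comp measurable_dens measurable_fst).
have mF : measurable_fun setT F.
  apply: emeasurable_funM => //; apply: emeasurable_funM.
    by case: nf => mf _; exact: (measurableT_comp mf mfst).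
  exact: (measurableT_comp (nn_ray_weight a0 ng) mpair).
have F0 p : 0 <= F p.
  exact: mule_ge0 (mule_ge0 (nf.2 _) (mule_ge0 (ng.2 _) (wE0 _ _))) (dens_ge0 _).
have mG : measurable_fun setT G.
  apply: emeasurable_funM => //; apply: emeasurable_funM.
    by case: ng => mg _; exact: (measurableT_comp mg mfst).
  have mnp : measurable_fun setT (fun p : 'rV[R]_d * R => (negz (p.1, th), p.2)).
    apply: measurable_fun_pair; last exact: measurable_snd.
    exact: (measurableT_comp (@measurable_negz R d) mfst).
  exact: (measurableT_comp (nn_ray_weight a0 nfn) mnp).
have G0 p : 0 <= G p.
  exact: mule_ge0 (mule_ge0 (ng.2 _) (mule_ge0 (nf.2 _) (wE0 _ _))) (dens_ge0 _).
have mulint (k : \bar R) (h : R -> \bar R) : 0 <= k -> measurable_fun setT h ->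
    (forall r, 0 <= h r) ->
    k * \int[leb]_(r in `[0%R, +oo[) h r = \int[leb]_(r in `[0%R, +oo[) (k * h r).
  by move=> k0 mh h0; rewrite ge0_integralZl//; exact: measurable_funTS.
have mh f' z : nn_measurable f' ->
    measurable_fun setT (fun r => f' (ray z r) * (weight a z r)%:E).
  by move=> nf'; exact: (measurableT_comp (nn_ray_weight a0 nf') (measurable_pair1 z)).
transitivity (\int[lebesgue_rV R d]_x \int[leb]_(r in `[0%R, +oo[) F (x, r)).
  apply: eq_integral => x _; rewrite muleAC /fly mulint//.
  - by apply: eq_integral => r _; rewrite /F/= muleAC.
  - exact: mule_ge0 (nf.2 _) (dens_ge0 _).
  - exact: mh.
  - by move=> r; exact: mule_ge0 (ng.2 _) (wE0 _ _).
transitivity (\int[lebesgue_rV R d]_x \int[leb]_(r in `[0%R, +oo[) G (x, r)); last first.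
  apply: eq_integral => x _; rewrite muleAC /fly mulint//.
  - by apply: eq_integral => r _; rewrite /G/= muleAC.
  - exact: mule_ge0 (ng.2 _) (dens_ge0 _).
  - exact: mh.
  - by move=> r; exact: mule_ge0 (nfn.2 _) (wE0 _ _).
rewrite (tonelli_half_line _ mF F0) (tonelli_half_line _ mG G0).
apply: eq_integral => r; rewrite inE/= in_itv/= andbT => r0.
rewrite -(ge0_integral_rV_shift (- (r *: velocity_rV R th))%R
  (measurableT_comp mF (measurable_pair2 r)) (fun x => F0 _)).
apply: eq_integral => x _; rewrite /F /G/=.
have -> : ray ((x - r *: velocity_rV R th)%R, th) r = (x, th).
  by rewrite /ray/= subrK.
rewrite -!muleA muleCA; congr (_ * _).
have -> : negz (ray (negz (x, th)) r) = ((x - r *: velocity_rV R th)%R, th).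
  by rewrite /negz /ray/= negvK velocity_rV_negv scalerN.
congr (_ * _); rewrite -!EFinM; congr EFin.
rewrite mulrCA [RHS]mulrCA; congr (_ * _)%R.
exact: (weight_reverse reg x th a0 r0).
Qed.

End duality.

Lemma ge0_integral_half_line_le (R : realType) (h : R -> \bar R) (c : \bar R) :
  measurable_fun setT h -> (forall r, 0 <= h r)%E ->
  (forall n : nat, \int[@lebesgue_measure R]_(r in `[0%R, n%:R]) h r <= c)%E ->
  (\int[@lebesgue_measure R]_(r in `[0%R, +oo[) h r <= c)%E.
Proof.
move=> mh h0 hc.
have -> : `[0%R, +oo[%classic = \bigcup_n (`[0%R, n%:R]%classic : set R).
  apply/seteqP; split=> [r /=|r [n _ /=]]; rewrite !in_itv/= ?andbT.
    move=> r0; exists (Num.bound r) => //=; rewrite in_itv/= r0 ltW//.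
    exact: archi_boundP.
  by move=> /andP[].
have nd : nondecreasing_seq (fun n : nat => `[0%R, n%:R]%classic : set R).
  move=> m n mn; apply/subsetPset => r /=; rewrite !in_itv/= => /andP[-> rm].
  by rewrite (le_trans rm)// ler_nat.
have mf i : measurable_fun (`[0%R, i%:R]%classic : set R) h by exact: measurable_funTS.
have cv := @ge0_nondecreasing_set_cvg_integral _ (measurableTypeR R) R _ h
  (@lebesgue_measure R) nd (fun i => measurable_itv _) mf (fun i x _ => h0 x).
rewrite -(cvg_lim _ cv)//; apply: lime_le; first by apply/cvg_ex; eexists; exact: cv.
by apply: nearW.
Qed.

(** * The resolvent of the killed process: duality, mass, comparison with test functions *)

Section resolvent.
Context (R : realType) (d : nat) (U s : 'rV[R]_d -> R)
  (gamma : 'I_d -> 'rV[R]_d -> velocity d -> R) (gbar : R).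
Hypothesis reg : regular_suzz U s gamma gbar.
Let U_C1 := regular_U reg.
Notation E := ('rV[R]_d * velocity d)%type.
Notation leb := (@lebesgue_measure R).
Notation lam := (suzz_rate U s gamma).
Notation weight := (ray_weight U s gamma).
Notation mu := (target_measure U_C1).
Notation fly := (fly U s gamma).
Notation jump := (jump U s gamma).
Notation negz := (@negz R d).
Local Open Scope ereal_scope.

Definition flyjump (a : R) (f : E -> \bar R) := fly a (jump f).

Definition resolvent_term (a : R) (n : nat) (f : E -> \bar R) :=
  iter n (flyjump a) (fly a f).

Definition resolvent (a : R) (f : E -> \bar R) (z : E) :=
  \sum_(n <oo) resolvent_term a n f z.

Let weight_ge0E a z r : 0 <= (weight a z r)%:E.
Proof. by rewrite lee_fin (weight_ge0 reg). Qed.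

Let rate_ge0E j z : 0 <= (lam j z)%:E.
Proof. by rewrite lee_fin (suzz_rate_ge0 reg). Qed.

Let nnD (f g : E -> \bar R) : nn_measurable f -> nn_measurable g ->
  nn_measurable (fun z => f z + g z).
Proof.
by move=> [mf f0] [mg g0]; split => [|z]; [exact: emeasurable_funD|rewrite adde_ge0].
Qed.

Let measurable_ray_weight a f z : (0 <= a)%R -> nn_measurable f ->
  measurable_fun setT (fun r => f (ray z r) * (weight a z r)%:E).
Proof.
by move=> a0 nf; exact: (measurableT_comp (nn_ray_weight reg a0 nf) (measurable_pair1 z)).
Qed.

Lemma fly_le a f g : (0 <= a)%R -> nn_measurable f -> nn_measurable g ->
  (forall z, f z <= g z) -> forall z, fly a f z <= fly a g z.
Proof.
move=> a0 nf ng fg z; apply: ge0_le_integral => //.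
- by move=> r _; rewrite mule_ge0//; case: nf.
- by apply: measurable_funTS; exact: measurable_ray_weight.
- by apply: measurable_funTS; exact: measurable_ray_weight.
- by move=> r _; rewrite lee_wpmul2r.
Qed.

Lemma flyD a f g : (0 <= a)%R -> nn_measurable f -> nn_measurable g ->
  forall z, fly a (fun y => f y + g y) z = fly a f z + fly a g z.
Proof.
move=> a0 nf ng z; rewrite /fly -ge0_integralD//.
- by apply: eq_integral => r _; rewrite ge0_muleDl//; [case: nf|case: ng].
- by move=> r _; rewrite mule_ge0//; case: nf.
- by apply: measurable_funTS; exact: measurable_ray_weight.
- by move=> r _; rewrite mule_ge0//; case: ng.
- by apply: measurable_funTS; exact: measurable_ray_weight.
Qed.

Lemma flyZ a (k : R) f : (0 <= a)%R -> (0 <= k)%R -> nn_measurable f ->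
  forall z, fly a (fun y => k%:E * f y) z = k%:E * fly a f z.
Proof.
move=> a0 k0 nf z; rewrite /fly -ge0_integralZl//.
- by apply: eq_integral => r _; rewrite muleA.
- by apply: measurable_funTS; exact: measurable_ray_weight.
- by move=> r _; rewrite mule_ge0//; case: nf.
Qed.

Lemma jump_le f g : (forall z, f z <= g z) -> forall z, jump f z <= jump g z.
Proof. by move=> fg z; apply: lee_sum => j _; rewrite lee_wpmul2l. Qed.

Lemma jumpD f g : nn_measurable f -> nn_measurable g ->
  forall z, jump (fun y => f y + g y) z = jump f z + jump g z.
Proof.
move=> nf ng z; rewrite /jump -big_split/=; apply: eq_bigr => j _.
by rewrite ge0_muleDr//; [case: nf|case: ng].
Qed.

Lemma jumpZ (k : R) f : (0 <= k)%R -> nn_measurable f ->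
  forall z, jump (fun y => k%:E * f y) z = k%:E * jump f z.
Proof.
move=> k0 [_ f0] z; rewrite /jump ge0_sume_distrr; last by move=> j _; rewrite mule_ge0.
by apply: eq_bigr => j _; rewrite muleCA.
Qed.

Lemma jump_const f z : (forall th th', f (z.1, th) = f (z.1, th')) ->
  jump f z = (total_rate U s gamma z)%:E * f z.
Proof.
move=> fE; rewrite /total_rate -sumEFin ge0_sume_distrl//.
by apply: eq_bigr => j _; congr (_ * _); rewrite [in RHS](surjective_pairing z); exact: fE.
Qed.

Lemma nn_flyjump a f : (0 <= a)%R -> nn_measurable f -> nn_measurable (flyjump a f).
Proof. by move=> a0 nf; exact: (nn_fly reg a0 (nn_jump reg nf)). Qed.

Lemma nn_iter a n f : (0 <= a)%R -> nn_measurable f ->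
  nn_measurable (iter n (flyjump a) f).
Proof. by move=> a0 nf; elim: n => //= n; exact: nn_flyjump. Qed.

Lemma nn_resolvent_term a n f : (0 <= a)%R -> nn_measurable f ->
  nn_measurable (resolvent_term a n f).
Proof. by move=> a0 nf; exact: (nn_iter n a0 (nn_fly reg a0 nf)). Qed.

Lemma nn_resolvent a f : (0 <= a)%R -> nn_measurable f -> nn_measurable (resolvent a f).
Proof.
move=> a0 nf; have nt n := nn_resolvent_term n a0 nf; split.
  by apply: ge0_emeasurable_sum => // n; [move=> z _ _; case: (nt n)|case: (nt n)].
by move=> z; apply: nneseries_ge0 => n _ _; case: (nt n).
Qed.

Lemma flyjump_le a f g : (0 <= a)%R -> nn_measurable f -> nn_measurable g ->
  (forall z, f z <= g z) -> forall z, flyjump a f z <= flyjump a g z.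
Proof.
move=> a0 nf ng fg; apply: fly_le => //; [exact: (nn_jump reg)|exact: (nn_jump reg)|].
exact: jump_le.
Qed.

Lemma iter_le a n f g : (0 <= a)%R -> nn_measurable f -> nn_measurable g ->
  (forall z, f z <= g z) ->
  forall z, iter n (flyjump a) f z <= iter n (flyjump a) g z.
Proof.
move=> a0 nf ng fg; elim: n => //= n IH; apply: flyjump_le => //; exact: nn_iter.
Qed.

Lemma flyjumpD a f g : (0 <= a)%R -> nn_measurable f -> nn_measurable g ->
  flyjump a (fun y => f y + g y) = (fun z => flyjump a f z + flyjump a g z).
Proof.
move=> a0 nf ng; apply/funext => z; rewrite /flyjump -flyD//; try exact: (nn_jump reg).
by congr (fly _ _ _); apply/funext => y; rewrite jumpD.
Qed.

Lemma flyjumpZ a (k : R) f : (0 <= a)%R -> (0 <= k)%R -> nn_measurable f ->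
  flyjump a (fun y => k%:E * f y) = (fun z => k%:E * flyjump a f z).
Proof.
move=> a0 k0 nf; apply/funext => z; rewrite /flyjump -flyZ//; last exact: (nn_jump reg).
by congr (fly _ _ _); apply/funext => y; rewrite jumpZ.
Qed.

Lemma iterD a n f g : (0 <= a)%R -> nn_measurable f -> nn_measurable g ->
  iter n (flyjump a) (fun y => f y + g y) =
  (fun z => iter n (flyjump a) f z + iter n (flyjump a) g z).
Proof.
move=> a0 nf ng; elim: n => //= n ->; rewrite flyjumpD//; exact: nn_iter.
Qed.

Lemma iterZ a n (k : R) f : (0 <= a)%R -> (0 <= k)%R -> nn_measurable f ->
  iter n (flyjump a) (fun y => k%:E * f y) = (fun z => k%:E * iter n (flyjump a) f z).
Proof.
move=> a0 k0 nf; elim: n => //= n ->; rewrite flyjumpZ//; exact: nn_iter.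
Qed.

Lemma flyjump_dual a f g : (0 <= a)%R -> nn_measurable f -> nn_measurable g ->
  \int[mu]_z (f (negz z) * flyjump a g z) =
  \int[mu]_z ((jump (fly a f)) (negz z) * g z).
Proof.
move=> a0 nf ng.
have EK h : (h \o negz) \o negz = h :> (E -> \bar R).
  by apply/funext => z /=; rewrite negzK.
rewrite (fly_dual reg a0 (nn_negz nf) (nn_jump reg ng)) EK.
under eq_integral do rewrite muleC.
have nKf := nn_fly reg a0 nf.
rewrite (jump_dual reg (nn_negz nKf) ng).
by rewrite EK; apply: eq_integral => z _; exact: muleC.
Qed.

(** The word fly jump fly ... jump fly is a palindrome: moving its factors across one at a time
    reverses it onto itself. [iterSr] reads the factor moved last at the other end. *)
Lemma resolvent_term_dual a n f g : (0 <= a)%R -> nn_measurable f -> nn_measurable g ->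
  \int[mu]_z (f (negz z) * resolvent_term a n g z) =
  \int[mu]_z (g z * resolvent_term a n f (negz z)).
Proof.
move=> a0 nf ng; rewrite /resolvent_term.
elim: n f nf => [|n IH] f nf.
  rewrite /= (fly_dual reg a0 (nn_negz nf) ng); apply: eq_integral => z _.
  by congr (_ * fly _ _ _); apply/funext => y /=; rewrite negzK.
rewrite iterS (flyjump_dual a0 nf); last exact: (nn_iter n a0 (nn_fly reg a0 ng)).
have nKf := nn_fly reg a0 nf.
by rewrite (IH _ (nn_jump reg nKf)) iterSr.
Qed.

(** Duality term by term against a constant. At k = a the resolvent on the right is at most 1, so
    that a times the mass of the resolvent of g is at most the mass of g. *)
Lemma integral_resolvent a (k : R) (g : E -> R) : (0 <= a)%R -> (0 <= k)%R ->
  nn_measurable (EFin \o g) ->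
  k%:E * \int[mu]_z resolvent a (EFin \o g) z =
  \int[mu]_z ((g z)%:E * resolvent a (cst k%:E) (negz z)).
Proof.
move=> a0 k0 ng.
have nk : @nn_measurable R d (cst k%:E) by exact: nn_cst.
have nt n := nn_resolvent_term n a0 ng.
have ntk n := nn_resolvent_term n a0 nk.
rewrite /resolvent integral_nneseries//; last 2 first.
- by move=> n; case: (nt n).
- by move=> n z _; case: (nt n).
rewrite -nneseriesZl; last first.
  by move=> n _; apply: integral_ge0 => z _; case: (nt n).
under [RHS]eq_integral => z _.
  rewrite -nneseriesZl; last by move=> n _; case: (ntk n).
  over.
rewrite integral_nneseries//; last 2 first.
- by move=> n; exact: (nn_mul ng (nn_negz (ntk n))).1.
- by move=> n z _; exact: (nn_mul ng (nn_negz (ntk n))).2.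
apply: eq_eseriesr => n _; rewrite -ge0_integralZl//; last 2 first.
- by case: (nt n).
- by move=> z _; case: (nt n).
exact: (resolvent_term_dual n a0 nk ng).
Qed.

(** The integrand is the density of the first event along the ray, switch or killing; [cum_discount]
    integrates it up to n. A deficit is the probability that the whole ray is travelled without any
    event. *)
Lemma fly_total_rate_le a z : (0 <= a)%R ->
  fly a (fun y => a%:E + (total_rate U s gamma y)%:E) z <= 1.
Proof.
move=> a0; have bP := locally_bounded_ray_rate reg z a0.
have H r : (a%:E + (total_rate U s gamma (ray z r))%:E) * (weight a z r)%:E =
  (ray_rate U s gamma a z r * expR (- cum (ray_rate U s gamma a z) r))%:E.
  rewrite -EFinD -EFinM; congr EFin.
  by rewrite /ray_weight /ray_rate /ray_speed; ring.
rewrite /fly; under eq_integral do rewrite H.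
have mh : measurable_fun setT (fun r => (ray_rate U s gamma a z r *
    expR (- cum (ray_rate U s gamma a z) r))%:E).
  apply/measurable_EFinP; apply: measurable_funM; first by case: bP.
  apply: measurableT_comp => //; apply: measurable_funN; exact: measurable_cum1 bP.
apply: ge0_integral_half_line_le => //.
  by move=> r; rewrite lee_fin mulr_ge0 ?expR_ge0// (ray_rate_ge0 reg).
move=> n; have [_ _ /(_ n%:R)[C bC]] := bP.
have int_n : leb.-integrable `[0%R, n%:R] (EFin \o (fun r => ray_rate U s gamma a z r *
    expR (- cum (ray_rate U s gamma a z) r))%R).
  apply: (@expR_cum_integrable _ _ bP _ _ _ _ _ C) => //; first by case: bP.
  by move=> v vn; rewrite ger0_norm ?bC// (ray_rate_ge0 reg).
have := cum_discount bP (ler0n R n); rewrite /Rintegral => disc.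
rewrite -[leLHS]fineK; last exact: integrable_fin_num int_n.
by rewrite lee_fin [leLHS]disc lerBlDr lerDl expR_ge0.
Qed.

Lemma flyjump1_le a z : (0 <= a)%R ->
  fly a (cst a%:E) z + flyjump a (cst 1) z <= 1.
Proof.
move=> a0; have j1 : jump (cst 1) = (fun y => (total_rate U s gamma y)%:E).
  by apply/funext => y; rewrite jump_const// mule1.
have n1 : @nn_measurable R d (cst 1) by exact: nn_cst.
have na : @nn_measurable R d (cst a%:E) by apply: nn_cst; rewrite lee_fin.
rewrite /flyjump -(flyD a0 na (nn_jump reg n1)).
by rewrite j1; exact: fly_total_rate_le.
Qed.

(** The sum is the probability of being killed before the n-th switch, the other term that of making
    n switches before killing. The step replaces a last factor 1 by fly a + flyjump 1, which is at
    most 1. *)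
Let partial_le a n z : (0 <= a)%R ->
  \sum_(0 <= i < n) resolvent_term a i (cst a%:E) z + iter n (flyjump a) (cst 1) z <= 1.
Proof.
move=> a0; elim: n => [|n IH]; first by rewrite big_geq//= add0e.
have n1 : @nn_measurable R d (cst 1) by exact: nn_cst.
have na : @nn_measurable R d (cst a%:E) by apply: nn_cst; rewrite lee_fin.
have nK := nn_fly reg a0 na; have nW := nn_flyjump a0 n1.
rewrite big_nat_recr//= -addeA; apply: le_trans IH; rewrite leeD2l//.
have -> : resolvent_term a n (cst a%:E) z + flyjump a (iter n (flyjump a) (cst 1)) z =
    iter n (flyjump a) (fun y => fly a (cst a%:E) y + flyjump a (cst 1) y) z.
  by rewrite iterD// -iterS iterSr.
by apply: iter_le => // [|y]; [exact: nnD|exact: flyjump1_le].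
Qed.

Lemma resolvent_cst_le1 a z : (0 <= a)%R -> resolvent a (cst a%:E) z <= 1.
Proof.
move=> a0; have na : @nn_measurable R d (cst a%:E) by apply: nn_cst; rewrite lee_fin.
apply: lime_le.
  by apply: is_cvg_nneseries => n _ _; case: (nn_resolvent_term n a0 na).
apply: nearW => n; apply: le_trans (partial_le n z a0).
rewrite leeDl//; exact: (nn_iter n a0 (@nn_cst R d 1 lee01)).2.
Qed.

(** Iterating the hypothesis n times leaves a remainder, the n-th iterate of [flyjump] on chi. It
    cannot stay away from 0: the switches counted by chi occur where the total rate is controlled by
    C, and the killed process makes at most C / a of them on average. *)
Lemma resolvent_ge a (chi : E -> R) (g : E -> \bar R) (C : R) : (0 < a)%R ->
  nn_measurable (EFin \o chi) -> nn_measurable g -> (forall z, (chi z <= 1)%R) ->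
  (forall x th th', chi (x, th) = chi (x, th')) ->
  (0 <= C)%R -> (forall z, (total_rate U s gamma z * chi z <= C)%R) ->
  (forall z, (chi z)%:E <=
     fly a (fun y => (a * chi y)%:E + g y) z + flyjump a (EFin \o chi) z) ->
  forall z, (chi z)%:E <= resolvent a (cst a%:E) z + resolvent a g z.
Proof.
move=> a_gt0 nchi ng chi1 chith C0 chiC chi_le z.
have a0 := ltW a_gt0.
have na : @nn_measurable R d (cst a%:E) by apply: nn_cst; rewrite lee_fin.
pose h y := (a * chi y)%:E + g y.
have nh : nn_measurable h.
  apply: nnD => //; have [mchi chi0] := nchi; split.
    by apply/measurable_EFinP; apply: measurable_funM => //; exact/measurable_EFinP.
  by move=> y; rewrite lee_fin mulr_ge0// -lee_fin; exact: chi0.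
have nKh := nn_fly reg a0 nh; have nWchi := nn_flyjump a0 nchi.
have part n : (chi z)%:E <= \sum_(0 <= i < n) resolvent_term a i h z +
    iter n (flyjump a) (EFin \o chi) z.
  elim: n => [|n IH]; first by rewrite big_geq//= add0e.
  apply: (le_trans IH); rewrite big_nat_recr//= -addeA leeD2l//.
  have -> : resolvent_term a n h z + flyjump a (iter n (flyjump a) (EFin \o chi)) z =
      iter n (flyjump a) (fun y => fly a h y + flyjump a (EFin \o chi) y) z.
    by rewrite iterD// -iterS iterSr.
  by apply: iter_le => //; exact: nnD.
have Sn n : \sum_(0 <= i < n) resolvent_term a i h z <= resolvent a h z.
  by apply: nneseries_lim_ge => i _ _; case: (nn_resolvent_term i a0 nh).
(* The jump of chi is at most C, which is C / a times the killing rate. So the remainders are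
   dominated, term by term, by C / a times the series of the resolvent of a, whose sum is at most
   1. *)
have tail n : \sum_(0 <= i < n) iter i.+1 (flyjump a) (EFin \o chi) z <= (C / a)%:E.
  have Ca0 : (0 <= C / a)%R by rewrite divr_ge0.
  apply: (@le_trans _ _ (\sum_(0 <= i < n) (C / a)%:E * resolvent_term a i (cst a%:E) z)).
    have nKa := nn_fly reg a0 na.
    apply: lee_sum => i _; rewrite iterSr.
    have <- : iter i (flyjump a) (fun y => (C / a)%:E * fly a (cst a%:E) y) z =
        (C / a)%:E * resolvent_term a i (cst a%:E) z by rewrite iterZ.
    apply: iter_le => //.
      split; first by apply: measurable_funeM; case: nKa.
      by move=> y; rewrite mule_ge0 ?lee_fin//; case: nKa.
    move=> y; rewrite -flyZ//; apply: fly_le => //; first exact: (nn_jump reg).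
      apply: (@nn_cst R d ((C / a)%:E * a%:E)).
      by rewrite -EFinM lee_fin mulr_ge0.
    move=> w; rewrite jump_const; last by move=> th th' /=; rewrite (chith _ th th').
    by rewrite /= -!EFinM lee_fin divfK ?gt_eqF.
  rewrite -ge0_sume_distrr; last by move=> i _; case: (nn_resolvent_term i a0 na).
  rewrite -[leRHS]mule1 lee_wpmul2l//.
  apply: le_trans (resolvent_cst_le1 z a0).
  by apply: nneseries_lim_ge => i _ _; case: (nn_resolvent_term i a0 na).
have chi_res : (chi z)%:E <= resolvent a h z.
  rewrite leNgt; apply/negP => lt_chi.
  have S0 : 0 <= resolvent a h z by case: (nn_resolvent a0 nh).
  have Sfin : resolvent a h z \is a fin_num.
    by rewrite ge0_fin_numE// (lt_trans lt_chi)// ltry.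
  set S := fine (resolvent a h z).
  have SE : resolvent a h z = S%:E by rewrite fineK.
  have e0 : (0 < chi z - S)%R by rewrite subr_gt0 -lte_fin -SE.
  have lb n : (chi z - S)%:E <= iter n (flyjump a) (EFin \o chi) z.
    rewrite EFinB leeBlDl//; apply: (le_trans (part n)).
    by rewrite leeD2r// -SE.
  (* If chi exceeded the resolvent of h, every remainder would be at least the gap chi z - S, and
     this many of them would add up to more than C / a. *)
  pose n := (Num.bound (C / a / (chi z - S))%R).
  have : ((chi z - S) *+ n)%:E <= (C / a)%:E.
    apply: le_trans (tail n).
    rewrite -(subn0 n) -sumr_const_nat -sumEFin subn0.
    by apply: lee_sum => i _; exact: lb.
  rewrite lee_fin -mulr_natr mulrC -ler_pdivlMr// leNgt => /negP; apply.
  by apply: archi_boundP; rewrite !divr_ge0// ltW.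
apply: (le_trans chi_res); rewrite /resolvent -nneseriesD; last 2 first.
- by move=> n _ _; case: (nn_resolvent_term n a0 na).
- by move=> n _ _; case: (nn_resolvent_term n a0 ng).
apply: lee_nneseries => [n _|n _]; first by case: (nn_resolvent_term n a0 nh).
have -> : resolvent_term a n (cst a%:E) z + resolvent_term a n g z =
    iter n (flyjump a) (fun y => fly a (cst a%:E) y + fly a g y) z.
  by rewrite iterD//; exact: (nn_fly reg).
apply: iter_le => //; first by apply: nnD; exact: (nn_fly reg).
move=> y; rewrite -flyD//; apply: fly_le => //; first exact: nnD.
by move=> w; rewrite /h leeD2r// lee_fin ler_piMr.
Qed.

End resolvent.

(** * Conservation of mass *)

Section cutoff.
Context (R : realType) (d : nat).
Hypothesis d_gt0 : (0 < d)%N.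
Notation E := ('rV[R]_d * velocity d)%type.
Notation leb := (@lebesgue_measure R).

Lemma normr_coor_le (x : 'rV[R]_d) i : `|x 0 i| <= `|x|.
Proof.
by rewrite [leRHS]/Num.Def.normr/= mx_normrE; apply/bigmax_geP; right => /=; exists (0, i).
Qed.

Lemma normr_rV_le (x : 'rV[R]_d) r : 0 <= r -> (forall i, `|x 0 i| <= r) -> `|x| <= r.
Proof.
move=> r0 xr; rewrite [leLHS]/Num.Def.normr/= mx_normrE; apply: bigmax_le => // -[i j] _ /=.
by rewrite ord1.
Qed.

(** In the sup norm the parameter of a ray is thus the distance travelled. Positivity of d provides
    the coordinate at which the norm is attained. *)
Lemma normr_velocity (th : velocity d) : `|velocity_rV R th| = 1.
Proof.
apply/eqP; rewrite eq_le normr_rV_le// => [|i]; last by rewrite mxE normr_sgn.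
by rewrite -(normr_sgn R th (Ordinal d_gt0)) (le_trans _ (normr_coor_le _ (Ordinal d_gt0)))// mxE.
Qed.

Lemma normr_rV_le_eucl (x : 'rV[R]_d) : `|x| <= eucl_norm x.
Proof.
apply: normr_rV_le => [|i]; first exact: sqrtr_ge0.
rewrite -sqrtr_sqr ler_sqrt; last by apply: sumr_ge0 => j _; exact: sqr_ge0.
by rewrite (bigD1 i)//= lerDl sumr_ge0// => j _; exact: sqr_ge0.
Qed.

Lemma normr_ray_sub (z : E) p q : `|(ray z q).1 - (ray z p).1| = `|q - p|.
Proof.
rewrite /ray/= opprD addrACA subrr add0r -scalerBl normrZ normr_velocity.
by rewrite mulr1.
Qed.

Definition cutoff (N : R) (x : 'rV[R]_d) : R :=
  Num.min 1 (Num.max 0 (2 - `|x| / N)).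

(** The height is the Lipschitz constant of [cutoff]. The region is wider than the shell between N
    and 2 N where the cutoff varies, so that a segment of length at most N / 4 that touches this
    shell lies entirely inside. *)
Definition annulus (N : R) (x : 'rV[R]_d) : R :=
  if (N / 4 <= `|x|) && (`|x| <= 4 * N) then N^-1 else 0.

Lemma cutoff_ge0 N x : 0 <= cutoff N x.
Proof. by rewrite le_min ler01 le_max lexx. Qed.

Lemma cutoff_le1 N x : cutoff N x <= 1.
Proof. by rewrite ge_min lexx. Qed.

Lemma cutoff1 N x : 0 < N -> `|x| <= N -> cutoff N x = 1.
Proof.
move=> N0 xN; rewrite /cutoff min_l// le_max; apply/orP; right.
by rewrite lerBrDr -lerBrDl; rewrite (_ : 2 - 1 = 1) ?ler_pdivrMr ?mul1r//; ring.
Qed.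

Lemma cutoff0 N x : 0 < N -> 2 * N <= `|x| -> cutoff N x = 0.
Proof.
move=> N0 xN; rewrite /cutoff max_l ?min_r//.
by rewrite subr_le0 ler_pdivlMr.
Qed.

Lemma cutoff_lip N x y : 0 < N -> cutoff N x <= cutoff N y + N^-1 * `|x - y|.
Proof.
move=> N0; have H : 2 - `|x| / N <= 2 - `|y| / N + N^-1 * `|x - y|.
  have Ni0 : 0 <= N^-1 by rewrite invr_ge0 ltW.
  have := ler_wpM2r Ni0 (lerB_dist y x).
  by rewrite distrC mulrBl [N^-1 * _]mulrC; lra.
have xy0 : 0 <= N^-1 * `|x - y| by rewrite mulr_ge0// invr_ge0 ltW.
rewrite /cutoff; move: H; set A := 2 - _; set B := 2 - _ => H.
case: (leP 1 (Num.max 0 A)) => hA; case: (leP 1 (Num.max 0 B)) => hB.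
- by rewrite lerDl.
- apply: le_trans hA _; rewrite ge_max; apply/andP; split.
    by rewrite addr_ge0// le_max lexx.
  by apply: (le_trans H); rewrite lerD2r le_max lexx orbT.
- by apply: (le_trans (ltW hA)); rewrite lerDl.
- rewrite ge_max; apply/andP; split; first by rewrite addr_ge0// le_max lexx.
  by apply: (le_trans H); rewrite lerD2r le_max lexx orbT.
Qed.

Lemma measurable_norm_rV : measurable_fun setT (fun x : 'rV[R]_d => `|x|).
Proof. by apply: continuous_measurable_rV => x; exact: norm_continuous. Qed.

Lemma measurable_cutoff N : measurable_fun setT (cutoff N).
Proof.
apply: measurable_minr => //; apply: measurable_maxr => //.
apply: measurable_funB => //; apply: measurable_funM => //; exact: measurable_norm_rV.
Qed.

Lemma measurable_annulus N : measurable_fun setT (annulus N).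
Proof.
apply: measurable_fun_ifT => //; apply: measurable_and; apply: measurable_fun_ler => //;
  exact: measurable_norm_rV.
Qed.

Lemma annulus_bound N x : 0 < N -> 0 <= annulus N x <= N^-1.
Proof.
by move=> N0; rewrite /annulus; case: ifP => _; rewrite lexx ?andbT// invr_ge0 ltW.
Qed.

(* Along a line the cutoff only decreases while in the annulus. *)
Lemma cutoff_decrease N z p q : 0 < N -> p <= q -> q - p <= N / 4 ->
  cutoff N (ray z p).1 - cutoff N (ray z q).1 <=
  \int[leb]_(v in `]p, q]) annulus N (ray z v).1.
Proof.
move=> N0 pq qpN.
have I0 : 0 <= \int[leb]_(v in `]p, q]) annulus N (ray z v).1.
  by apply: Rintegral_ge0 => v _; case/andP: (annulus_bound (ray z v).1 N0).
have dist v : p <= v <= q -> `| `|(ray z v).1| - `|(ray z p).1| | <= N / 4.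
  move=> /andP[pv vq]; apply: (le_trans (ler_dist_dist _ _)).
  rewrite normr_ray_sub ger0_norm ?subr_ge0//; apply: le_trans qpN.
  by rewrite lerD2r.
(* Starting below N / 2, the segment ends where the cutoff is 1; starting above 3 N, it starts where
   the cutoff is 0. In between it stays in the annulus, and the Lipschitz bound is the integral. *)
have [small|large] := ltP `|(ray z p).1| (N / 2).
  rewrite (cutoff1 (x := (ray z q).1))//.
    by rewrite (le_trans _ I0)// subr_le0 cutoff_le1.
  have := dist q; rewrite pq lexx => /(_ isT); rewrite ler_norml => /andP[_ h].
  lra.
have [far|near] := ltP (3 * N) `|(ray z p).1|.
  rewrite (cutoff0 (x := (ray z p).1))//; last by lra.
  by rewrite (le_trans _ I0)// sub0r oppr_le0 cutoff_ge0.
have -> : \int[leb]_(v in `]p, q]) annulus N (ray z v).1 = N^-1 * (q - p).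
  rewrite (eq_Rintegral _ _ (g := cst N^-1)).
    rewrite Rintegral_cst//= lebesgue_measure_itv/= lte_fin.
    by case: (ltgtP p q) pq => // -> _; rewrite subrr.
  move=> v; rewrite inE/= in_itv/= => /andP[pv vq].
  have := dist v; rewrite (ltW pv) vq => /(_ isT); rewrite ler_norml => /andP[h1 h2].
  rewrite /annulus ifT//; apply/andP; split; lra.
rewrite lerBlDl; apply: (le_trans (cutoff_lip _ (ray z q).1 N0)).
by rewrite distrC normr_ray_sub ger0_norm// subr_ge0.
Qed.

End cutoff.

(** * Flux through large annuli and conservation of mass by the resolvent *)

Section conservation.
Context (R : realType) (d : nat) (U s : 'rV[R]_d -> R)
  (gamma : 'I_d -> 'rV[R]_d -> velocity d -> R) (gbar : R).
Hypothesis d_gt0 : (0 < d)%N.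
Hypothesis reg : regular_suzz U s gamma gbar.
Hypothesis U_int : (\int[lebesgue_rV R d]_x (expR (- U x))%:E < +oo)%E.
Hypothesis flux : (eucl_norm x ^+ d.-1 * s x * expR (- U x)) @[x --> eucl_infty]
  --> (0 : R).
Let U_C1 := regular_U reg.
Let s_gt0 := regular_s_gt0 reg.
Notation E := ('rV[R]_d * velocity d)%type.
Notation leb := (@lebesgue_measure R).
Notation mu := (target_measure U_C1).
Notation fly := (fly U s gamma).
Notation jump := (jump U s gamma).
Notation resolvent := (resolvent U s gamma).

Let c : R := ((2 ^+ d * normalization U)^-1)%R.

Let c_ge0 : 0 <= c.
Proof.
rewrite invr_ge0 mulr_ge0 ?exprn_ge0//.
by apply: Rintegral_ge0 => x _; exact: expR_ge0.
Qed.

Let measurable_expU : measurable_fun setT (fun x => expR (- U x)).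
Proof.
apply: measurableT_comp => //; apply: measurable_funN.
exact: continuous_measurable_rV (C1_continuous U_C1).
Qed.

Lemma target_measure_fin : (mu setT < +oo)%E.
Proof.
have n1 : @nn_measurable R d (cst 1%E) by exact: nn_cst.
have -> : mu setT = (\int[mu]_z (cst 1%E : E -> \bar R) z)%E by rewrite integral_cst// mul1e.
rewrite (ge0_integral_target reg n1).
apply: lte_sum_pinfty => th _ /=.
under eq_integral do rewrite mul1e EFinM.
rewrite ge0_integralZl_EFin//; last exact/measurable_EFinP.
by rewrite lte_mul_pinfty// lee_fin.
Qed.

(** The factor s cancels the 1 / s of the ray weight, so that [fly] integrates the bare annulus in
    the line parameter. *)
Definition flux_density (N : R) (z : E) : R := s z.1 * annulus N z.1.

Lemma nn_flux_density N : 0 < N -> nn_measurable (EFin \o flux_density N).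
Proof.
move=> N0; split.
  apply/measurable_EFinP; apply: measurable_funM; first exact: measurable_speed reg.
  exact: (measurableT_comp (measurable_annulus N) measurable_fst).
move=> z; rewrite lee_fin mulr_ge0//; first exact: ltW.
by case/andP: (annulus_bound z.1 N0).
Qed.

(** In the annulus s exp (- U) is at most e' / (N / 4)^(d-1), since the Euclidean norm dominates the
    sup norm; the annulus function is 1 / N, and its support lies in a cube of volume (8 N)^d. The
    powers of N cancel. *)
Lemma flux_small (e : R) : 0 < e -> exists N0 : nat, forall n : nat, (N0 <= n)%N ->
  (\int[mu]_z (flux_density n.+1%:R z)%:E <= e%:E)%E.
Proof.
move=> e0.
(* The factors are the number of velocities, the normalization of the target, and what is left of (N
   / 4)^(d-1) and (8 N)^d once N has cancelled; the added 1 makes C positive. *)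
pose C : R := #|velocity d|%:R * c * 4 ^+ d.-1 * 8 ^+ d + 1.
have C0 : 0 < C by rewrite ltr_wpDl// !mulr_ge0// ?exprn_ge0.
pose e' := e / C.
have e'0 : 0 < e' by rewrite divr_gt0.
have [M HM] : \forall x \near eucl_infty, `|eucl_norm x ^+ d.-1 * s x * expR (- U x)| < e'.
  by have /cvgr0Pnorm_lt := flux; exact.
exists (Num.bound (4 * `|M|)) => n nM.
set N : R := n.+1%:R.
have N0 : 0 < N by rewrite ltr0n.
have N4 : 0 < N / 4 by rewrite divr_gt0.
have MN : M < N / 4.
  rewrite ltr_pdivlMr// mulrC (le_lt_trans (ler_wpM2l _ (ler_norm M)))//.
  apply: (lt_le_trans (archi_boundP _)); first by rewrite mulr_ge0.
  by rewrite ler_nat (leq_trans nM).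
have Ann x : N / 4 <= `|x| -> s x * expR (- U x) <= e' / (N / 4) ^+ d.-1.
  move=> Nx; have Nex := le_trans Nx (normr_rV_le_eucl x).
  have := HM x (lt_le_trans MN Nex).
  rewrite ger0_norm; last by rewrite !mulr_ge0 ?exprn_ge0 ?sqrtr_ge0 ?expR_ge0// ltW.
  move=> /ltW h; rewrite ler_pdivlMr ?exprn_gt0//.
  apply: le_trans h; rewrite [leLHS]mulrC -[leRHS]mulrA.
  apply: ler_wpM2r; first by rewrite mulr_ge0 ?expR_ge0// ltW.
  by apply: lerXn2r; rewrite ?nnegrE// ltW// (lt_le_trans N4).
pose K := c * N^-1 * (e' / (N / 4) ^+ d.-1).
have K0 : 0 <= K.
  apply: mulr_ge0; first by rewrite mulr_ge0// invr_ge0 ltW.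
  by apply: divr_ge0; [exact: ltW|apply: exprn_ge0; exact: ltW].
rewrite (ge0_integral_target reg (nn_flux_density N0)).
have bound th : (\int[lebesgue_rV R d]_x ((flux_density N (x, th))%:E * (c * expR (- U x))%:E) <=
    (K * (8 * N) ^+ d)%:E)%E.
  apply: (@le_trans _ _ (\int[lebesgue_rV R d]_x (K%:E * (\1_(@box R d (4 * N)) x)%:E))%E).
    apply: ge0_le_integral => //.
    - move=> x _; rewrite mule_ge0 ?lee_fin//; last by rewrite mulr_ge0 ?expR_ge0.
      by have [_ +] := nn_flux_density N0; move=> /(_ (x, th)); rewrite lee_fin.
    - apply: emeasurable_funM.
        have [m _] := nn_flux_density N0; exact: (measurableT_comp m (measurable_pair2 th)).
      by apply/measurable_EFinP; apply: measurable_funM.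
    - apply: measurable_funeM; apply/measurable_EFinP.
      by apply: measurable_indic; exact: measurable_box.
    - move=> x _; rewrite -!EFinM lee_fin /flux_density/= /annulus.
      case: ifPn => [/andP[x1 x2]|_]; last by rewrite mulr0 mul0r mulr_ge0.
      rewrite indicE mem_set ?mulr1; last by move=> i; exact: le_trans (normr_coor_le x i) x2.
      rewrite (_ : _ * _ * _ = c * N^-1 * (s x * expR (- U x))); last by ring.
      by rewrite ler_wpM2l ?Ann// mulr_ge0// invr_ge0 ltW.
  rewrite ge0_integralZl_EFin//.
  - rewrite integral_indic ?setIT//; last exact: measurable_box.
    rewrite [X in (_ * X)%E]lebesgue_rV_box; last by rewrite mulr_ge0// ltW.
    by rewrite -EFinM lee_fin mulrA (_ : 2 * 4 = 8 :> R)//; ring.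
  - by apply/measurable_EFinP; apply: measurable_indic; exact: measurable_box.
apply: (@le_trans _ _ (\sum_(th : velocity d) (K * (8 * N) ^+ d)%:E)%E).
  by apply: lee_sum => th _; exact: bound.
rewrite sumEFin lee_fin sumr_const -[_ *+ _]mulr_natl.
apply: (@le_trans _ _ (e' * C)); last by rewrite /e' divfK// gt_eqF.
rewrite /C mulrDr mulr1 (_ : _ * (K * _) = e' * (#|velocity d|%:R * c * 4 ^+ d.-1 * 8 ^+ d)).
  by rewrite lerDl ltW.
have -> : (8 * N) ^+ d = 8 ^+ d * (N * (4 ^+ d.-1 * (N / 4) ^+ d.-1)).
  rewrite exprMn; congr (_ * _); rewrite -exprMn (_ : 4 * (N / 4) = N).
    by rewrite -exprS prednK.
  by field.
rewrite /K; field.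
by rewrite expf_neq0 ?gt_eqF.
Qed.

Let nn_cutoff N : nn_measurable (fun z : E => (cutoff N z.1)%:E).
Proof.
split; last by move=> z; rewrite lee_fin cutoff_ge0.
by apply/measurable_EFinP; exact: (measurableT_comp (measurable_cutoff N) measurable_fst).
Qed.

Lemma total_rate_cutoff_bounded N : 0 < N ->
  exists2 C, 0 <= C & forall z, total_rate U s gamma z * cutoff N z.1 <= C.
Proof.
move=> N0; pose g (x : 'rV[R]_d) := \sum_i (`|drift U s i x| + gbar).
have cg : continuous g.
  apply: continuous_sumr => i x; apply: (@continuousD _ _ _ (fun x => `|drift U s i x|) (cst gbar)).
    exact: (cvg_norm (@continuous_drift _ _ _ _ _ _ reg i x)).
  exact: cst_continuous.
pose A := [set x : 'rV[R]_d | forall i, `[- (2 * N), 2 * N]%classic (x ord0 i)].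
have cA : compact A.
  by apply: (rV_compact (A := fun i => `[- (2 * N), 2 * N]%classic)) => i; exact: segment_compact.
have A0 : A !=set0.
  by exists 0 => i; rewrite /= mxE in_itv/= oppr_le0 mulr_ge0// ltW.
have [y _ yP] := EVT_max_rV A0 cA (continuous_subspaceT cg).
exists (Num.max 0 (g y)); first by rewrite le_max lexx.
move=> z; have [zN|zN] := leP (2 * N) `|z.1|; first by rewrite cutoff0// mulr0 le_max lexx.
rewrite le_max; apply/orP; right; apply: (@le_trans _ _ (g z.1)).
  rewrite -[leRHS]mulr1 ler_pM ?cutoff_ge0 ?cutoff_le1 ?(total_rate_ge0 reg)//.
  by apply: ler_sum => i _; exact: (suzz_rate_le reg).
apply: yP; rewrite inE => i; rewrite /= in_itv/= -ler_norml.
by rewrite (le_trans (normr_coor_le _ i))// ltW.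
Qed.

(** This is [le_cum_discount] along the ray, with f the cutoff and l the annulus. The cutoff does
    not see the velocity, so that its jump is the total rate times itself and joins the killing term
    in b f. *)
Lemma cutoff_le_fly a N z : 0 <= a -> 0 < N ->
  ((cutoff N z.1)%:E <=
    fly a (fun y => (a * cutoff N y.1)%:E + (flux_density N y)%:E) z +
    flyjump U s gamma a (fun y => (cutoff N y.1)%:E) z)%E.
Proof.
move=> a0 N0.
have nc := nn_cutoff N; have nf := nn_flux_density N0.
pose f v := cutoff N (ray z v).1.
pose l v := annulus N (ray z v).1.
have bP := locally_bounded_ray_rate reg z a0.
set b := ray_rate U s gamma a z in bP *.
have mf : measurable_fun setT f.
  exact: (measurableT_comp (measurableT_comp (measurable_cutoff N) measurable_fst) (measurable_ray1 z)).
have ml : measurable_fun setT l.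
  exact: (measurableT_comp (measurableT_comp (measurable_annulus N) measurable_fst) (measurable_ray1 z)).
(* At this distance the ray has left the support of the cutoff, and the boundary term vanishes. *)
pose r := 2 * N + `|z.1|.
have r0 : 0 <= r by rewrite addr_ge0// mulr_ge0// ltW.
have fr : f r = 0.
  apply: cutoff0 => //.
  have := ler_normB (ray z r).1 (ray z 0).1.
  by rewrite normr_ray_sub// subr0 ger0_norm// ray0 /r lerD2r.
have lip p q : p <= q -> f q - N^-1 * (q - p) <= f p <= f q + N^-1 * (q - p).
  move=> pq; have h1 := cutoff_lip (ray z p).1 (ray z q).1 N0.
  have h2 := cutoff_lip (ray z q).1 (ray z p).1 N0.
  rewrite normr_ray_sub// distrC ger0_norm ?subr_ge0// in h1.
  rewrite normr_ray_sub// ger0_norm ?subr_ge0// in h2.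
  by rewrite lerBlDr h1 h2.
have e0 : 0 < N / 4 by rewrite divr_gt0.
have f01 v : 0 <= f v <= 1 by rewrite cutoff_ge0 cutoff_le1.
have l01 v : 0 <= l v <= N^-1 by exact: annulus_bound.
have := le_cum_discount bP r0 e0 mf ml f01 l01 lip
  (fun p q _ pq _ qpe => cutoff_decrease d_gt0 z N0 pq qpe).
rewrite fr mul0r addr0 {1}/f ray0 => disc.
have mg : measurable_fun setT (fun v => b v * f v + l v).
  by apply: measurable_funD => //; apply: measurable_funM => //; case: bP.
have g0 v : 0 <= (b v * f v + l v) * expR (- cum b v).
  have /andP[? _] := f01 v; have /andP[? _] := l01 v; case: bP => _ b0 _.
  by rewrite mulr_ge0 ?expR_ge0// addr_ge0// mulr_ge0.
have int_r : leb.-integrable `[0, r] (EFin \o (fun v => (b v * f v + l v) * expR (- cum b v))).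
  have [_ b0 /(_ r)[C bC]] := bP.
  apply: (@expR_cum_integrable _ _ bP _ _ _ _ _ (C + N^-1)) => // v vr.
  have /andP[f0 f1] := f01 v; have /andP[l0 l1] := l01 v.
  rewrite ger0_norm; last by rewrite addr_ge0// mulr_ge0.
  by apply: lerD => //; rewrite -[leRHS]mulr1 ler_pM// bC.
apply: (@le_trans _ _ (\int[leb]_(v in `[0%R, r]) ((b v * f v + l v) * expR (- cum b v))%:E)%E).
  rewrite -[leRHS]fineK; first by rewrite lee_fin.
  exact: integrable_fin_num int_r.
have nh : @nn_measurable R d (fun y => (a * cutoff N y.1)%:E + (flux_density N y)%:E)%E.
  have [mc c0] := nc; have [mfl fl0] := nf; split.
    apply: emeasurable_funD => //; apply/measurable_EFinP; apply: measurable_funM => //.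
    exact/measurable_EFinP.
  by move=> y; rewrite adde_ge0//; [rewrite lee_fin mulr_ge0// cutoff_ge0|exact: fl0].
rewrite /flyjump -(flyD reg a0 nh (nn_jump reg nc)).
have me : measurable_fun setT (fun v => ((b v * f v + l v) * expR (- cum b v))%:E).
  apply/measurable_EFinP; apply: measurable_funM => //.
  apply: measurableT_comp => //; apply: measurable_funN; exact: measurable_cum1 bP.
apply: (@le_trans _ _ (\int[leb]_(v in `[0%R, +oo[) ((b v * f v + l v) * expR (- cum b v))%:E)%E).
  apply: ge0_subset_integral => //.
  - exact: measurable_funTS.
  - by move=> v _; rewrite lee_fin.
  - by move=> v /=; rewrite !in_itv/= andbT => /andP[].
apply: ge0_le_integral => //.
- by move=> v _; rewrite lee_fin.
- exact: measurable_funTS.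
- apply: measurable_funTS.
  have nsum : @nn_measurable R d (fun y => (a * cutoff N y.1)%:E + (flux_density N y)%:E + jump (fun y => (cutoff N y.1)%:E) y)%E.
    have [m1 p1] := nh; have [m2 p2] := nn_jump reg nc.
    by split => [|y]; [exact: emeasurable_funD|rewrite adde_ge0].
  exact: (measurableT_comp (nn_ray_weight reg a0 nsum) (measurable_pair1 z)).
- move=> v _; rewrite (jump_const reg)//=.
  rewrite -!EFinM lee_fin /b /f /l /flux_density /ray_weight /ray_rate /ray_speed.
  by rewrite le_eqVlt; apply/orP; left; apply/eqP; field; rewrite gt_eqF.
Qed.

(** Integrate [resolvent_ge] with a cutoff as test function. By duality the resolvent of
    [flux_density] has mass at most 1 / a times that of [flux_density], which is arbitrarily small;
    the cutoffs then increase to 1. *)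
Lemma resolvent_mass a : 0 < a -> (mu setT <= \int[mu]_z resolvent a (cst a%:E) z)%E.
Proof.
move=> a_gt0; have a0 := ltW a_gt0.
have na : @nn_measurable R d (cst a%:E) by apply: nn_cst; rewrite lee_fin.
set I := (\int[mu]_z _)%E.
have nres := nn_resolvent reg a0 na.
have cut_le n (e : R) : 0 < e -> (forall m : nat, (n <= m)%N ->
    (\int[mu]_z (flux_density m.+1%:R z)%:E <= (a * e)%:E)%E) ->
    forall m : nat, (n <= m)%N -> (\int[mu]_z (cutoff m.+1%:R z.1)%:E <= I + e%:E)%E.
  move=> e0 He m nm; have m0 : 0 < m.+1%:R :> R by rewrite ltr0n.
  have nf := nn_flux_density m0.
  have nresf := nn_resolvent reg a0 nf.
  have [C C0 CP] := total_rate_cutoff_bounded m0.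
  apply: (@le_trans _ _ (\int[mu]_z (resolvent a (cst a%:E) z + resolvent a (EFin \o flux_density m.+1%:R) z))%E).
    apply: ge0_le_integral => //.
    - by move=> z _; rewrite lee_fin cutoff_ge0.
    - by case: (nn_cutoff m.+1%:R).
    - by case: nres => ? _; case: nresf => ? _; exact: emeasurable_funD.
    - move=> z _; apply: (resolvent_ge reg a_gt0 (nn_cutoff m.+1%:R) nf _ _ C0 CP) => //.
      + by move=> y; exact: cutoff_le1.
      + by move=> y; exact: cutoff_le_fly.
  rewrite ge0_integralD//; last 4 first.
  - by move=> z _; case: nres.
  - by case: nres.
  - by move=> z _; case: nresf.
  - by case: nresf.
  rewrite leeD2l// -(@lee_pmul2l _ a%:E)// -EFinM.
  rewrite (integral_resolvent reg a0 a0 nf).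
  apply: le_trans (He m nm); apply: ge0_le_integral => //.
  - by move=> z _; exact: (nn_mul nf (nn_negz nres)).2.
  - exact: (nn_mul nf (nn_negz nres)).1.
  - by case: nf.
  - move=> z _; rewrite -[leRHS]mule1 lee_wpmul2l//; last exact: (resolvent_cst_le1 reg).
    by case: nf => _ /(_ z).
apply/lee_addgt0Pr => e e0.
(* The tolerance a e compensates the factor 1 / a produced by duality. *)
have [n0 Hn0] := flux_small (mulr_gt0 a_gt0 e0).
pose G (n : nat) (z : E) : \bar R := (cutoff n.+1%:R z.1)%:E.
have mG n : measurable_fun setT (G n) by case: (nn_cutoff n.+1%:R).
have G0 n z : setT z -> (0 <= G n z)%E by rewrite lee_fin cutoff_ge0.
have ndG z : setT z -> nondecreasing_seq (G ^~ z).
  move=> _ n m nm; rewrite lee_fin /cutoff.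
  have le_arg : 2 - `|z.1| / n.+1%:R <= 2 - `|z.1| / m.+1%:R.
    by rewrite lerD2l lerN2 ler_wpM2l// lef_pV2 ?posrE ?ltr0n// ler_nat.
  rewrite le_min ge_min lexx/= ge_min; apply/orP; right.
  by rewrite ge_max !le_max lexx le_arg orbT.
have limG z : limn (G ^~ z) = 1%E.
  apply: cvg_lim => //; apply: cvg_near_cst; near=> n.
  rewrite /G cutoff1//.
  have : (Num.bound `|z.1| <= n)%N by near: n; exact: nbhs_infty_ge.
  rewrite -(ler_nat R) => zn.
  apply: ltW; apply: lt_le_trans (archi_boundP (normr_ge0 _)) _.
  by apply: le_trans zn _; rewrite ler_nat.
have lim1 : (\int[mu]_z G n z @[n --> \oo] --> mu setT)%E.
  have := @cvg_monotone_convergence _ _ _ mu setT measurableT G mG G0 ndG.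
  rewrite (eq_integral (cst 1%E)); first by rewrite integral_cst// mul1e.
  by move=> z _; rewrite limG.
rewrite -(cvg_lim (@ereal_hausdorff R) lim1); apply: lime_le; first by apply/cvg_ex; eexists; exact: lim1.
by near=> n; apply: (cut_le n0 e e0 Hn0); near: n; exact: nbhs_infty_ge.
Unshelve. all: by end_near. Qed.

(* The mass that could be lost by [g] would also be lost by the constant 1. *)
Lemma resolvent_invariant a (g : E -> R) : 0 < a ->
  measurable_fun setT g -> (forall z, 0 <= g z <= 1) ->
  (a%:E * \int[mu]_z resolvent a (EFin \o g) z = \int[mu]_z (g z)%:E)%E.
Proof.
move=> a_gt0 mg g01; have a0 := ltW a_gt0.
have na : @nn_measurable R d (cst a%:E) by apply: nn_cst; rewrite lee_fin.
have ng : nn_measurable (EFin \o g).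
  by split => [|z]; [exact/measurable_EFinP|rewrite lee_fin; case/andP: (g01 z)].
have ng' : nn_measurable (EFin \o (fun z => 1 - g z)).
  split => [|z]; last by rewrite lee_fin subr_ge0; case/andP: (g01 z).
  by apply/measurable_EFinP; apply: measurable_funB.
have nh := nn_negz (nn_resolvent reg a0 na).
set h := _ \o _ in nh.
have h1 z : (h z <= 1)%E by exact: (resolvent_cst_le1 reg).
rewrite (integral_resolvent reg a0 a0 ng).
have le1 (f : E -> R) : nn_measurable (EFin \o f) -> (\int[mu]_z ((f z)%:E * h z) <= \int[mu]_z (f z)%:E)%E.
  move=> nf; apply: ge0_le_integral => //.
  - by move=> z _; exact: (nn_mul nf nh).2.
  - exact: (nn_mul nf nh).1.
  - by case: nf.
  - by move=> z _; rewrite -[leRHS]mule1 lee_wpmul2l//; case: nf => _ /(_ z).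
have fin (f : E -> R) : nn_measurable (EFin \o f) -> (forall z, f z <= 1) ->
    (\int[mu]_z (f z)%:E)%E \is a fin_num.
  move=> nf f1; rewrite ge0_fin_numE; last by apply: integral_ge0 => z _; exact: nf.2.
  apply: le_lt_trans target_measure_fin.
  rewrite -[leRHS]mul1e -integral_cst//; apply: ge0_le_integral => //.
  - by move=> z _; exact: nf.2.
  - by case: nf.
  - by move=> z _; rewrite lee_fin.
have fing : (\int[mu]_z (g z)%:E)%E \is a fin_num by apply: fin => // z; case/andP: (g01 z).
have fing' : (\int[mu]_z (1 - g z)%:E)%E \is a fin_num.
  by apply: fin => // z; rewrite gerBl; case/andP: (g01 z).
have sum_h : (\int[mu]_z ((g z)%:E * h z) + \int[mu]_z ((1 - g z)%:E * h z) =
    \int[mu]_z h z)%E.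
  rewrite -ge0_integralD//.
  - apply: eq_integral => z _; rewrite -ge0_muleDl.
    + by rewrite -EFinD addrC subrK mul1e.
    + exact: ng.2.
    + exact: ng'.2.
  - by move=> z _; exact: (nn_mul ng nh).2.
  - exact: (nn_mul ng nh).1.
  - by move=> z _; exact: (nn_mul ng' nh).2.
  - exact: (nn_mul ng' nh).1.
have sum_1 : (\int[mu]_z (g z)%:E + \int[mu]_z (1 - g z)%:E = mu setT)%E.
  rewrite -ge0_integralD//.
  - rewrite -[RHS]mul1e -integral_cst//; apply: eq_integral => z _.
    by rewrite -EFinD addrC subrK.
  - by move=> z _; exact: ng.2.
  - by case: ng.
  - by move=> z _; exact: ng'.2.
  - by case: ng'.
have mass : (mu setT <= \int[mu]_z h z)%E.
  apply: (le_trans (resolvent_mass a_gt0)).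
  by rewrite -(integral_negz reg (nn_resolvent reg a0 na)).
(* Neither g nor 1 - g can gain mass, and together they lose none. As the total mass is finite, a
   strict loss for g would survive the addition and contradict [mass]. *)
apply/eqP; rewrite eq_le le1//= leNgt; apply/negP => lt_g.
have : (\int[mu]_z ((g z)%:E * h z) + \int[mu]_z ((1 - g z)%:E * h z) < mu setT)%E.
  rewrite -sum_1; apply: (lte_leD _ lt_g (le1 _ ng')).
  rewrite ge0_fin_numE; last by apply: integral_ge0 => z _; exact: (nn_mul ng' nh).2.
  by apply: (le_lt_trans (le1 _ ng')); rewrite -ge0_fin_numE//; apply: integral_ge0 => z _; exact: ng'.2.
by rewrite sum_h ltNge mass.
Qed.

End conservation.

(** * Laplace inversion *)

Section laplace.
Context (R : realType).
Notation leb := (@lebesgue_measure R).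

Lemma integral_exp_half_line (a : R) : 0 < a ->
  (\int[leb]_(t in `[0%R, +oo[) (expR (- (a * t)))%:E = (a^-1)%:E)%E.
Proof.
move=> a0.
have one : (\int[leb]_(t in `[0%R, +oo[) (a%:E * (expR (- (a * t)))%:E) = 1)%E.
  rewrite integral_mkcond -[RHS](integral_exponential_pdf a0).
  apply: eq_integral => t _; rewrite /exponential_pdf !patchE.
  by case: ifP => // _; rewrite -EFinM mulNr.
move: one; rewrite ge0_integralZl_EFin//; last 2 first.
- apply: measurable_funTS; apply/measurable_EFinP; apply: measurableT_comp => //.
  by apply: measurable_funN; apply: measurable_funM.
- exact: ltW.
set I := (\int[_]_(_ in _) _)%E => aI.
have -> : I = ((a^-1)%:E * (a%:E * I))%E by rewrite muleA -EFinM mulVf ?gt_eqF// mul1e.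
by rewrite aI mule1.
Qed.

Lemma bernoulli_ge (x : R) n : -1 <= x -> 1 + n%:R * x <= (1 + x) ^+ n.
Proof.
move=> x1; elim: n => [|n IH]; first by rewrite mul0r addr0 expr0.
have x0 : 0 <= 1 + x by lra.
rewrite exprS; apply: le_trans (ler_wpM2l x0 IH).
have : 0 <= n%:R * (x * x) by rewrite mulr_ge0// -expr2 sqr_ge0.
by rewrite -natr1; lra.
Qed.

Lemma integrable_exp (a : R) : 0 < a ->
  leb.-integrable `[0, +oo[ (EFin \o (fun t => expR (- (a * t)))).
Proof.
move=> a0; apply/integrableP; split.
  apply: measurable_funTS; apply/measurable_EFinP; apply: measurableT_comp => //.
  by apply: measurable_funN; apply: measurable_funM.
under eq_integral => t _ do rewrite /= ger0_norm ?expR_ge0//.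
by rewrite integral_exp_half_line// ltry.
Qed.

Section transform.
Variables (X : Type) (V : set (X -> R)) (phi : X -> R -> R) (M : R).
Hypothesis V_add : forall f g, V f -> V g -> V (fun x => f x + g x).
Hypothesis V_scale : forall k f, V f -> V (fun x => k * f x).
Hypothesis V_lim : forall (f : nat -> X -> R) g C, (forall n, V (f n)) ->
  (forall n x, `|f n x| <= C) -> (forall x, f n x @[n --> \oo] --> g x) -> V g.
Hypothesis mphi : forall x, measurable_fun setT (phi x).
Hypothesis phiM : forall x t, `|phi x t| <= M.
Hypothesis M0 : 0 <= M.
Hypothesis V_laplace : forall a : R, 0 < a ->
  V (fun x => \int[leb]_(t in `[0, +oo[) (expR (- (a * t)) * phi x t)).

Let mexp a : measurable_fun setT (fun t : R => expR (- (a * t))).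
Proof.
apply: measurableT_comp => //.
by apply: measurable_funN; apply: measurable_funM.
Qed.

Let integrable_bounded (g : R -> R) C : measurable_fun setT g -> (forall t, 0 <= t -> `|g t| <= C) ->
  leb.-integrable `[0, +oo[ (EFin \o (fun t => expR (- t) * g t)).
Proof.
move=> mg gC.
have C0 : 0 <= C by apply: le_trans (gC 0 _).
have me : measurable_fun setT (fun t : R => expR (- t)).
  by have := mexp 1; under eq_fun do rewrite mul1r.
have int1 := integrable_exp (@ltr01 R).
apply: (@le_integrable _ _ _ leb _ _ _ (EFin \o (fun t => C * expR (- (1 * t))))) => //.
- by apply: measurable_funTS; apply/measurable_EFinP; exact: measurable_funM.
- move=> t /=; rewrite in_itv/= andbT => t0; rewrite lee_fin mul1r.
  rewrite !normrM (ger0_norm (expR_ge0 _)) (ger0_norm C0) mulrC.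
  by apply: ler_wpM2r; [exact: expR_ge0|exact: gC].
- exact: (lebesgue_integrableM _ _ int1).
Qed.

Let integral_le (g : R -> R) : measurable_fun setT g -> (forall t, 0 <= t -> `|g t| <= M) ->
  `|\int[leb]_(t in `[0, +oo[) (expR (- t) * g t)| <= M.
Proof.
move=> mg gM; have intg := integrable_bounded mg gM.
have intM : leb.-integrable `[0, +oo[ (EFin \o (fun t => expR (- t) * cst M t)).
  by apply: (integrable_bounded (C := M)) => // t _; rewrite /= ger0_norm.
apply: (le_trans (le_normr_Rintegral _ intg)) => //.
apply: (@le_trans _ _ (\int[leb]_(t in `[0, +oo[) (expR (- t) * cst M t))).
  apply: le_Rintegral => //; first exact: integrable_norm.
  move=> t /=; rewrite in_itv/= andbT => t0.
  by rewrite normrM (ger0_norm (expR_ge0 _)) ler_wpM2l ?expR_ge0// gM.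
have := integral_exp_half_line (@ltr01 R); rewrite invr1 => exp1.
rewrite /Rintegral /=; under eq_integral do rewrite mulrC EFinM.
rewrite ge0_integralZl_EFin//; last by apply: measurable_funTS; apply/measurable_EFinP; have := mexp 1; under eq_fun do rewrite mul1r.
by under eq_integral do rewrite -[X in - X]mul1r; rewrite exp1 mule1.
Qed.

(** A polynomial in exp (- b t) against exp (- t) is a combination of exponentials of rates 1 + k b.
    The free power k lets the induction on p pass: multiplication by 'X raises k. The factor exp (-
    t) keeps everything integrable. *)
Let laplace_poly (b : R) (p : {poly R}) : 0 < b ->
  [/\ measurable_fun setT (fun t : R => p.[expR (- (b * t))]),
      exists C, forall t, 0 <= t -> `|p.[expR (- (b * t))]| <= C &
      forall k, V (fun x => \int[leb]_(t in `[0, +oo[)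
        (expR (- t) * (expR (- (b * t)) ^+ k * p.[expR (- (b * t))] * phi x t)))].
Proof.
move=> b0; pose y t := expR (- (b * t)).
have y01 t : 0 <= t -> 0 <= y t <= 1.
  by move=> t0; rewrite expR_ge0 -expR0 ler_expR oppr_le0 mulr_ge0// ltW.
have yk01 k t : 0 <= t -> `|y t ^+ k| <= 1.
  by move=> t0; have /andP[? ?] := y01 t t0; rewrite ger0_norm ?exprn_ge0// exprn_ile1.
have my : measurable_fun setT y by exact: mexp.
have int_p x k (q : {poly R}) C : measurable_fun setT (fun t : R => q.[y t]) ->
    (forall t, 0 <= t -> `|q.[y t]| <= C) ->
    leb.-integrable `[0, +oo[ (EFin \o (fun t => expR (- t) * (y t ^+ k * q.[y t] * phi x t))).
  move=> mq qC; apply: (integrable_bounded (C := C * M)).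
    by apply: measurable_funM => //; apply: measurable_funM => //; exact: measurable_funX.
  move=> t t0; rewrite !normrM ler_pM// -[leRHS]mul1r ler_pM//; [exact: yk01|exact: qC].
elim/poly_ind: p => [|p r [mp [C pC] Ip]].
  split.
  - by under eq_fun do rewrite horner0; exact: measurable_cst.
  - by exists 0 => t _; rewrite horner0 normr0.
  - move=> k; rewrite (_ : (fun x => _) = (fun x => 0 *
      \int[leb]_(t in `[0, +oo[) (expR (- (1 * t)) * phi x t))).
      by apply: V_scale; exact: V_laplace.
    apply/funext => x; rewrite mul0r.
    under eq_Rintegral do rewrite horner0 mulr0 mul0r mulr0.
    by rewrite Rintegral_cst// mul0r.
have hE t : (p * 'X + r%:P).[y t] = p.[y t] * y t + r by rewrite !hornerE.
split.
- by under eq_fun do rewrite hE; apply: measurable_funD => //; exact: (measurable_funM mp my).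
- exists (C + `|r|) => t t0; rewrite hE (le_trans (ler_normD _ _))// lerD2r.
  rewrite normrM -[leRHS]mulr1 ler_pM// ?pC//.
  by have := yk01 1%N t t0; rewrite expr1.
move=> k.
have int1 x : leb.-integrable `[0, +oo[ (EFin \o (fun t => expR (- t) * (y t ^+ k * phi x t))).
  have := int_p x k 1%:P 1; rewrite (_ : (fun t => _) = cst 1); last first.
    by apply/funext => t; rewrite hornerC.
  move=> /(_ (measurable_cst _)) h.
  rewrite (_ : _ \o _ = EFin \o (fun t => expR (- t) * (y t ^+ k * 1%:P.[y t] * phi x t))).
    by apply: h => t _; rewrite hornerC normr1.
  by apply/funext => t /=; rewrite hornerC mulr1.
rewrite (_ : (fun x => _) = (fun x =>
    \int[leb]_(t in `[0, +oo[) (expR (- t) * (y t ^+ k.+1 * p.[y t] * phi x t)) +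
    r * \int[leb]_(t in `[0, +oo[) (expR (- ((1 + k%:R * b) * t)) * phi x t))).
  by apply: V_add => //; apply: V_scale; apply: V_laplace; rewrite ltr_wpDr// mulr_ge0// ltW.
apply/funext => x.
rewrite (_ : \int[_]_(_ in _) _ = \int[leb]_(t in `[0, +oo[)
    (expR (- t) * (y t ^+ k.+1 * p.[y t] * phi x t) +
     r * (expR (- t) * (y t ^+ k * phi x t)))); last first.
  by apply: eq_Rintegral => t _; rewrite hE exprS -/(y t); ring.
rewrite RintegralD//.
- congr (_ + _); rewrite RintegralZl//; congr (_ * _).
  apply: eq_Rintegral => t _; rewrite mulrA /y -expRM_natl -expRD.
  by congr (expR _ * _); ring.
- exact: (int_p _ _ _ C).
- exact: lebesgue_integrableM.
Qed.

(* [(1 - y ^+ n) ^+ (2 ^ n)] tends to the indicator function of [y < 1/2]. *)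
Let one_minus_pow_cvg1 (y : R) : 0 <= y < 2^-1 -> (1 - y ^+ n) ^+ (2 ^ n) @[n --> \oo] --> (1 : R).
Proof.
move=> /andP[y0 y2]; have z1 : `|2 * y| < 1 by rewrite ger0_norm ?mulr_ge0//; lra.
have yn n : 0 <= y ^+ n <= 1 by rewrite exprn_ge0// exprn_ile1//; lra.
apply: (@squeeze_cvgr _ _ _ _ (fun n => 1 - (2 * y) ^+ n) (cst 1)).
- apply: nearW => n; have /andP[h0 h1] := yn n; apply/andP; split.
    have := @bernoulli_ge (- y ^+ n) (2 ^ n) ltac:(lra).
    by rewrite mulrN natrX -exprMn.
  by rewrite exprn_ile1//; lra.
- rewrite -[X in _ --> X]subr0; apply: cvgB; first exact: cvg_cst.
  exact: cvg_expr.
- exact: cvg_cst.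
Qed.

Let one_minus_pow_cvg0 (y : R) : 2^-1 < y <= 1 -> (1 - y ^+ n) ^+ (2 ^ n) @[n --> \oo] --> (0 : R).
Proof.
move=> /andP[y2 y1]; have y0 : 0 < y by lra.
have z0 : 0 < 2 * y by lra.
have z1 : `|(2 * y)^-1| < 1 by rewrite ger0_norm ?invr_ge0 ?ltW// invf_lt1//; lra.
have yn n : 0 <= y ^+ n <= 1 by rewrite exprn_ge0 ?exprn_ile1// ltW.
apply: (@squeeze_cvgr _ _ _ _ (cst 0) (fun n => (2 * y)^-1 ^+ n)).
- apply: nearW => n; have /andP[h0 h1] := yn n; apply/andP; split.
    by rewrite exprn_ge0//; lra.
  rewrite exprVn -[leRHS]mul1r ler_pdivlMr ?exprn_gt0//.
  (* By Bernoulli, (1 + y^n)^(2^n) is at least (2 y)^n, and its product with (1 - y^n)^(2^n) is a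
     power of 1 - y^(2 n), hence at most 1. *)
  apply: (@le_trans _ _ ((1 - y ^+ n) ^+ (2 ^ n) * (1 + y ^+ n) ^+ (2 ^ n))).
    rewrite ler_wpM2l ?exprn_ge0//; first lra.
    have := @bernoulli_ge (y ^+ n) (2 ^ n) ltac:(lra).
    by rewrite natrX -exprMn; lra.
  rewrite -exprMn exprn_ile1//; nra.
- exact: cvg_cst.
- exact: cvg_expr.
Qed.

(** The polynomials above turn exponentials into an approximation of the indicator of t > c; the
    limit is dominated by M exp (- t). *)
Let laplace_tail (c : R) : 0 < c ->
  V (fun x => \int[leb]_(t in `]c, +oo[) (expR (- t) * phi x t)).
Proof.
move=> c0; pose b := ln 2 / c.
have ln2 : 0 < ln 2 :> R by rewrite ln_gt0// ltr1n.
have b0 : 0 < b by rewrite divr_gt0.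
pose y t := expR (- (b * t)).
have y01 t : 0 <= t -> 0 <= y t <= 1.
  by move=> t0; rewrite expR_ge0 -expR0 ler_expR oppr_le0 mulr_ge0// ltW.
have half : 2^-1 = expR (- ln 2) :> R by rewrite expRN lnK// posrE.
have bc : b * c = ln 2 by rewrite divfK// gt_eqF.
pose p n : {poly R} := (1 - 'X^n) ^+ (2 ^ n).
have pE n t : (p n).[y t] = (1 - y t ^+ n) ^+ (2 ^ n).
  by rewrite /p horner_exp hornerD hornerN hornerXn hornerC.
have p01 n t : 0 <= t -> 0 <= (p n).[y t] <= 1.
  move=> t0; have /andP[y0 y1] := y01 t t0.
  have h1 : y t ^+ n <= 1 by rewrite exprn_ile1.
  have h0 : 0 <= y t ^+ n by rewrite exprn_ge0.
  by rewrite pE exprn_ge0 ?exprn_ile1//; lra.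
have mp n : measurable_fun setT (fun t : R => (p n).[y t]) by case: (laplace_poly (p n) b0).
apply: (V_lim (C := M) (f := fun n x => \int[leb]_(t in `[0, +oo[) (expR (- t) * ((p n).[y t] * phi x t)))).
  move=> n; have [_ _ /(_ 0%N)] := laplace_poly (p n) b0.
  rewrite (_ : (fun x => _) = (fun x => \int[leb]_(t in `[0, +oo[) (expR (- t) * ((p n).[y t] * phi x t))))//.
  by apply/funext => x; apply: eq_Rintegral => t _; rewrite expr0 mul1r.
  move=> n x; apply: integral_le; first exact: measurable_funM.
  move=> t t0; have /andP[p0 p1] := p01 n t t0.
  by rewrite normrM -[leRHS]mul1r ler_pM// ger0_norm.
move=> x; pose f n (t : R) : \bar R := (expR (- t) * ((p n).[y t] * phi x t))%:E.
pose g (t : R) : \bar R := (expR (- t) * ((if c < t then 1 else 0) * phi x t))%:E.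
have int_f n : leb.-integrable `[0, +oo[ (f n).
  apply: (integrable_bounded (C := M)); first exact: measurable_funM.
  move=> t t0; have /andP[p0 p1] := p01 n t t0.
  by rewrite normrM -[leRHS]mul1r ler_pM// ger0_norm.
have me : measurable_fun setT (fun t : R => expR (- t)).
  by have := mexp 1; under eq_fun do rewrite mul1r.
have mg : measurable_fun setT g.
  apply/measurable_EFinP; apply: measurable_funM => //; apply: measurable_funM => //.
  by apply: measurable_fun_ifT => //; exact: measurable_fun_ltr.
have lim_f t : 0 <= t -> t != c -> f ^~ t @ \oo --> g t.
  move=> t0 tc; apply: cvg_EFin; first by apply: nearW.
  apply: (@cvgM _ _ _ _ (cst (expR (- t))) (fun n => (p n).[y t] * phi x t)); first exact: cvg_cst.
  apply: (@cvgM _ _ _ _ (fun n => (p n).[y t]) (cst (phi x t))); last exact: cvg_cst.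
  under eq_cvg do rewrite pE.
  have /andP[y0 y1] := y01 t t0.
  case: (ltgtP c t) tc => // [ct|tc] _.
    by apply: one_minus_pow_cvg1; rewrite y0/= half ltr_expR ltrN2 -bc ltr_pM2l.
  by apply: one_minus_pow_cvg0; rewrite y1 andbT half ltr_expR ltrN2 -bc ltr_pM2l.
have [] := @dominated_convergence _ _ _ leb `[0%R, +oo[%classic (measurable_itv _) f g
    (EFin \o (fun t => expR (- t) * M)).
- by move=> n; case/integrableP: (int_f n).
- exact: measurable_funTS.
(* At t = c the base is 1/2 and the powers tend neither to 0 nor to 1; a single point is
   negligible. *)
- exists [set c]; split => //; first exact: lebesgue_measure_set1.
  move=> t /= /not_implyP[]; rewrite in_itv/= andbT => t0 nl.
  by apply: contrapT => /eqP tc; apply: nl; exact: lim_f.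
- by apply: (integrable_bounded (g := cst M) (C := M)) => // t _; rewrite /= ger0_norm.
- apply: aeW => t n /=; rewrite in_itv/= andbT => t0; rewrite lee_fin.
  have /andP[p0 p1] := p01 n t t0.
  rewrite normrM (ger0_norm (expR_ge0 _)) ler_wpM2l ?expR_ge0//.
  by rewrite normrM -[leRHS]mul1r ler_pM// ger0_norm.
move=> int_g _; rewrite (_ : \int[_]_(_ in _) _ = fine (\int[leb]_(t in `[0%R, +oo[) g t)).
  move=> h; apply: fine_cvg; rewrite fineK//.
  exact: integrable_fin_num.
rewrite /Rintegral; congr fine.
rewrite integral_mkcond [RHS]integral_mkcond.
apply: eq_integral => t _; rewrite !patchE !mem_setE !in_itv/= !andbT /g.
case: ltP => [ct|tc]; first by rewrite (ltW (lt_trans c0 ct)) mul1r.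
by rewrite mul0r mulr0 if_same.
Qed.

(* [V] is a class of functions of the parameter, such as the measurable ones or those
   satisfying a linear identity, that the inversion of the transform cannot leave. *)
Lemma laplace_inversion (t : R) : 0 <= t ->
  (forall x, phi x u @[u --> t^'+] --> phi x t) -> V (fun x => phi x t).
Proof.
move=> t0 phi_right.
(* Windows that shrink to t from the right; their left ends are positive even for t = 0, as
   [laplace_tail] requires. Each window is a difference of two tails, and has length 1 / (n + 1),
   whence the factor in the averages. *)
pose I n : interval R := `]t + n.+1%:R^-1, t + 2 * n.+1%:R^-1].
have e0 n : 0 < n.+1%:R^-1 :> R by rewrite invr_gt0.
have int_e x : leb.-integrable `[0, +oo[ (EFin \o (fun t => expR (- t) * phi x t)).
  by apply: (integrable_bounded (C := M)).
have lebI n : leb [set` I n] = (n.+1%:R^-1)%:E.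
  rewrite lebesgue_measure_itv/= lte_fin ltrD2l ltr_pMl// ltr1n -EFinB.
  by rewrite opprD addrACA subrr add0r mulr2n mulrDl mul1r addrK.
have int_h x n : leb.-integrable [set` I n] (EFin \o (fun u => expR (- u) * phi x u)).
  apply: integrableS (int_e x) => // u /=; rewrite !in_itv/= andbT => /andP[tu _].
  by rewrite (le_trans t0)// ltW// (lt_trans _ tu)// ltrDl.
have int_cst n (k : R) : leb.-integrable [set` I n] (EFin \o cst k).
  apply/integrableP; split; first by apply/measurable_EFinP.
  change ((\int[leb]_(u in [set` I n]) cst `|k|%:E u) < +oo)%E.
  have lebI_lty : (leb [set` I n] < +oo)%E by rewrite lebI ltry.
  by rewrite integral_cst// lte_mul_pinfty.
have Rint_cst n (k : R) : \int[leb]_(u in [set` I n]) cst k u = k * n.+1%:R^-1.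
  rewrite Rintegral_cst//; transitivity (k * fine (leb [set` I n])) => //.
  by rewrite lebI.
apply: (V_lim (C := expR t * M) (f := fun n x => (expR t * n.+1%:R) * \int[leb]_(u in [set` I n]) (expR (- u) * phi x u))).
  move=> n; apply: V_scale.
  pose c := t + n.+1%:R^-1; pose c' := t + 2 * n.+1%:R^-1.
  have c0 : 0 < c by rewrite ltr_wpDl.
  have cc' : c < c' by rewrite ltrD2l ltr_pMl// ltr1n.
  rewrite (_ : (fun x => _) = (fun x => \int[leb]_(u in `]c, +oo[) (expR (- u) * phi x u) +
      -1 * \int[leb]_(u in `]c', +oo[) (expR (- u) * phi x u))).
    by apply: V_add; [|apply: V_scale]; apply: laplace_tail => //; exact: lt_trans cc'.
  apply/funext => x.
  have int_c : leb.-integrable `]c, +oo[ (EFin \o (fun t => expR (- t) * phi x t)).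
    apply: integrableS (int_e x) => // u /=; rewrite !in_itv/= !andbT => cu.
    exact: ltW (lt_trans c0 cu).
  have := @Rintegral_itvB R (fun t => expR (- t) * phi x t) (BRight c) +oo%O c' int_c.
  rewrite !bnd_simp mulN1r => /(_ (ltW cc') isT) <-.
  by rewrite opprB addrCA subrr addr0.
  move=> n x; rewrite -mulrA normrM (ger0_norm (expR_ge0 _)) ler_wpM2l ?expR_ge0//.
  rewrite normrM ger0_norm// -ler_pdivlMl// mulrC -Rint_cst.
  apply: (le_trans (le_normr_Rintegral _ (int_h x n))) => //.
  apply: le_Rintegral => //; first exact: (integrable_norm (int_h x n)).
  move=> u /=; rewrite in_itv/= => /andP[tu _].
  rewrite normrM (ger0_norm (expR_ge0 _)) -[leRHS]mul1r ler_pM ?expR_ge0//.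
  by rewrite -expR0 ler_expR oppr_le0 (le_trans t0)// ltW// (lt_trans _ tu)// ltrDl.
move=> x; pose h (u : R) := expR (- u) * phi x u.
have h_right : h u @[u --> t^'+] --> h t.
  apply: cvgM; last exact: phi_right.
  apply: cvg_at_right_filter; apply: (@continuous_comp _ _ _ -%R (@expR R) t); last exact: continuous_expR.
  exact: oppr_continuous.
suff H : n.+1%:R * \int[leb]_(u in [set` I n]) h u @[n --> \oo] --> h t.
  have -> : phi x t = expR t * h t.
    by rewrite /h mulrA -expRD subrr expR0 mul1r.
  under eq_cvg do rewrite -mulrA.
  by apply: cvgM; [exact: cvg_cst|exact: H].
apply/cvgrPdist_le => e egt0.
have /cvgrPdist_le/(_ e egt0)[d /= d0 dP] := h_right.
near=> n.
have In u : u \in I n -> `|h t - h u| <= e.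
  rewrite in_itv/= => /andP[tu ut]; apply: dP; last by rewrite (lt_trans _ tu)// ltrDl.
  rewrite /= distrC gtr0_norm ?subr_gt0 ?(lt_trans _ tu)// ?ltrDl//.
  rewrite ltrBlDl (le_lt_trans ut)// ltrD2l -ltr_pdivlMl// mulrC.
  near: n; exact: near_infty_natSinv_lt (PosNum (divr_gt0 d0 (ltr0n R 2))).
have -> : h t = n.+1%:R * \int[leb]_(u in [set` I n]) cst (h t) u.
  by rewrite Rint_cst mulrCA mulfV ?mulr1.
rewrite -mulrBr -RintegralB//; last exact: int_h.
rewrite normrM ger0_norm//.
rewrite -ler_pdivlMl//.
have int_d : leb.-integrable [set` I n] (EFin \o (fun u => h t - h u)).
  by rewrite (_ : _ \o _ = (EFin \o cst (h t)) \- (EFin \o h))%E //; exact: (integrableB _ (int_cst n (h t)) (int_h x n)).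
apply: (le_trans (le_normr_Rintegral _ int_d)) => //.
apply: (@le_trans _ _ (\int[leb]_(u in [set` I n]) cst e u)).
  by apply: le_Rintegral => //; exact: integrable_norm.
by rewrite Rint_cst mulrC.
Unshelve. all: by end_near. Qed.

End transform.
End laplace.

(** * The law of the process *)

Section flow.
Context (R : realType) (d : nat) (s : 'rV[R]_d -> R).
Hypothesis d_gt0 : (0 < d)%N.
Hypothesis s_cont : continuous s.
Hypothesis s_gt0 : forall x, 0 < s x.
Notation E := ('rV[R]_d * velocity d)%type.
Notation tau z := (cum (ray_speed s z)).

Let speed_cont z : continuous (ray_speed s z).
Proof.
move=> r; apply: cvgV; first by rewrite gt_eqF.
apply: (@continuous_comp _ _ _ (fun r => (ray z r).1) s r); last exact: s_cont.
exact: continuous_ray.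
Qed.

Let speed_gt0 z r : 0 < ray_speed s z r.
Proof. by rewrite invr_gt0. Qed.

Let MVT_right (h dh : R -> R) v : 0 < v ->
  (forall t : R, 0 < t <= v -> is_derive t (1 : R) h (dh t)) ->
  h t @[t --> 0^'+] --> h 0 ->
  exists2 c, 0 < c < v & h v - h 0 = dh c * v.
Proof.
move=> v0 dhP h0.
have dh' (t : R) : t \in `]0, v[ -> is_derive t (1 : R) h (dh t).
  by rewrite in_itv/= => /andP[t0 tv]; apply: dhP; rewrite t0 ltW.
have [|c] := MVT v0 dh'; last first.
  by rewrite in_itv/= subr0 => cv hE; exists c.
apply: derivable_oo_LRcontinuous_within; split => //.
  by move=> t /dh'[].
apply: cvg_at_left_filter; apply/differentiable_continuous/derivable1_diffP.
have vv : 0 < v <= v by rewrite v0 lexx.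
by case: (dhP v vv).
Qed.

Let i0 : 'I_d := Ordinal d_gt0.

(** The equation separates. The coordinates, corrected by their signs, all have derivative s (psi
    t), so they coincide and the solution stays on the ray; [tau] composed with their common value
    has derivative 1, so it is the time. *)
Lemma solves_flow_ray (z : E) (b : \bar R) (psi : R -> 'rV[R]_d) (v : R) :
  solves_flow s z b psi -> 0 <= v -> (v%:E < b)%E ->
  exists2 r, 0 <= r & psi v = (ray z r).1 /\ tau z r = v.
Proof.
move=> [psi0 psi_right psiD]; rewrite le_eqVlt => /predU1P[<-|v0] vb.
  by exists 0 => //; rewrite ray0 cum0.
have coordD i (t : R) : 0 < t <= v ->
    is_derive t (1 : R) (fun t => psi t 0 i) (s (psi t) * sgn R z.2 i).
  move=> /andP[t0 tv]; have tb : (t%:E < b)%E by apply: le_lt_trans vb; rewrite lee_fin.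
  have [dpsi psiE] := psiD t t0 tb.
  apply: DeriveDef; first exact: ((derivable_mxP _ _ _).1 dpsi).
  by have := derive_mx dpsi; rewrite psiE => /matrixP/(_ 0 i); rewrite !mxE.
have coord_right i : psi t 0 i @[t --> 0^'+] --> z.1 0 i.
  rewrite -psi0; apply: (@cvg_comp _ _ _ psi (fun x : 'rV[R]_d => x 0 i) _ _ _ psi_right).
  exact: coord_continuous.
(* The signed displacement of the i-th coordinate, which on a ray is the parameter. *)
pose c i (t : R) := sgn R z.2 i * (psi t 0 i - z.1 0 i).
have c0 i : c i 0 = 0 by rewrite /c psi0 subrr mulr0.
have c_right i : c i t @[t --> 0^'+] --> c i 0.
  rewrite c0 -[X in _ --> X](mulr0 (sgn R z.2 i)); apply: cvgM; first exact: cvg_cst.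
  by rewrite -[X in _ --> X](subrr (z.1 0 i)); apply: cvgB => //; exact: cvg_cst.
have cD i (t : R) : 0 < t <= v -> is_derive t (1 : R) (c i) (s (psi t)).
  move=> tv; have h1 := is_deriveB (coordD i t tv) (is_derive_cst (z.1 0 i) t (1 : R)).
  have h2 := is_deriveZ (sgn R z.2 i) h1.
  apply: (is_derive_eq h2); rewrite subr0.
  by rewrite [LHS]mulrCA sgn_sqr mulr1.
have cE i t : 0 < t <= v -> c i t = c i0 t.
  move=> /andP[t0 tv].
  have [||e _] := @MVT_right (c i \- c i0) (cst 0) t t0.
  - move=> u /andP[u0 ut]; have uv : 0 < u <= v by rewrite u0 (le_trans ut).
    by apply: (is_derive_eq (is_deriveB (cD i u uv) (cD i0 u uv))); rewrite subrr.
  - by apply: cvgB; exact: c_right.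
  by rewrite /= mul0r !c0 !subr0 => /eqP; rewrite subr_eq0 => /eqP.
have psiE t : 0 < t <= v -> psi t = (ray z (c i0 t)).1.
  move=> tv; apply/rowP => i; rewrite !mxE -(cE i t tv) /c.
  by rewrite mulrAC sgn_sqr mul1r addrC subrK.
have c_gt0 t : 0 < t <= v -> 0 < c i0 t.
  move=> /andP[t0 tv].
  have [||e _] := @MVT_right (c i0) (fun u => s (psi u)) t t0.
  - by move=> u /andP[u0 ut]; apply: cD; rewrite u0 (le_trans ut).
  - exact: c_right.
  by rewrite c0 subr0 => ->; rewrite mulr_gt0.
have vv : 0 < v <= v by rewrite v0 lexx.
exists (c i0 v); first exact/ltW/c_gt0.
split; first exact: psiE.
have tauD (t : R) : 0 < t <= v -> is_derive t (1 : R) (tau z \o c i0) 1.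
  move=> tv.
  have h := is_derive1_comp (is_derive_cum (@speed_cont z) (speed_gt0 z) (c_gt0 t tv)) (cD i0 t tv).
  apply: (is_derive_eq h); rewrite /ray_speed -(psiE t tv) mulVf//.
  by rewrite gt_eqF.
have tau_right : (tau z \o c i0) t @[t --> 0^'+] --> (tau z \o c i0) 0.
  rewrite /= c0 cum0.
  have [C C0 CP] : exists2 C, 0 <= C & forall r, 0 <= r <= 1 -> tau z r <= C * r.
    have bP := continuous_rate (@speed_cont z) (speed_gt0 z).
    have [_ b0 /(_ 1)[C bC]] := bP.
    exists C; first by apply: le_trans (b0 0) (bC 0 _); rewrite lexx ler01.
    move=> r /andP[r0 r1].
    by have := cumB_le bP bC (lexx 0) r0 r1; rewrite cum0 !subr0.
  have c_right0 : C * c i0 t @[t --> 0^'+] --> 0.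
    rewrite -[X in _ --> X](mulr0 C); apply: cvgM; first exact: cvg_cst.
    by have := c_right i0; rewrite c0.
  apply: (@squeeze_cvgr _ _ _ _ (cst 0) (fun t => C * c i0 t)) => //; last exact: cvg_cst.
  have := c_right i0; rewrite c0 => /cvgrPdist_lt/(_ 1 ltr01) h.
  near=> t.
  have tv : 0 < t <= v by apply/andP; split; [|apply: ltW; near: t; exact: nbhs_right_lt].
  rewrite cum_ge0; last by move=> u; exact: ltW.
  apply: CP; rewrite ltW ?c_gt0//=.
  suff : `|0 - c i0 t| < 1 by rewrite sub0r normrN => /(le_lt_trans (ler_norm _))/ltW.
  by near: t.
have [e _] := @MVT_right (tau z \o c i0) (cst 1) v v0 tauD tau_right.
by rewrite /= c0 cum0 subr0 mul1r.
Unshelve. all: by end_near. Qed.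

Lemma ray_solves_flow (z : E) (r : R) : 0 < r ->
  solves_flow s z (tau z r)%:E (fun v => (ray z (rho (ray_speed s z) v)).1).
Proof.
move=> r0; have sc := @speed_cont z; have sg := speed_gt0 z.
have rho0 : rho (ray_speed s z) 0 = 0 by rewrite -{1}(cum0 (ray_speed s z)) (rho_cum sc sg).
split.
- by rewrite rho0 ray0.
- rewrite rho0; apply: (@cvg_comp _ _ _ (rho (ray_speed s z)) (fun r => (ray z r).1)).
    exact: (rho_cvg0 sc sg).
  exact: continuous_ray.
move=> t t0; rewrite lte_fin => tr.
have al : alive (ray_speed s z) t.
  by have [n nr] := alive_cum sc sg (ltW r0); exists n; exact: lt_trans tr nr.
have [drho rhoE] := is_derive_rho sc sg t0 al.
have coordE i : (fun t => (ray z (rho (ray_speed s z) t)).1 0 i) =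
    (fun t => z.1 0 i + sgn R z.2 i *: rho (ray_speed s z) t).
  by apply/funext => u; rewrite !mxE mulrC.
have coordD i : is_derive t (1 : R) (fun t => (ray z (rho (ray_speed s z) t)).1 0 i)
    (s (ray z (rho (ray_speed s z) t)).1 * sgn R z.2 i).
  rewrite coordE.
  have h := is_deriveD (is_derive_cst (z.1 0 i) t (1 : R)) (is_deriveZ (sgn R z.2 i) (is_derive_rho sc sg t0 al)).
  apply: (is_derive_eq h).
  by rewrite add0r /ray_speed invrK; exact: mulrC.
have dray : derivable (fun v => (ray z (rho (ray_speed s z) v)).1) t 1.
  by apply/derivable_mxP => i j; rewrite ord1; case: (coordD j).
apply: DeriveDef => //.
rewrite derive_mx//; apply/rowP => i; rewrite !mxE.
by case: (coordD i).
Qed.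

Section maximal.
Variables (Phi : R -> E -> 'rV[R]_d) (tstar : E -> \bar R).
Hypothesis flowP : maximal_flow s Phi tstar.

(** A solution that lives at time v places v in the range of the clock [tau z]. Conversely the ray
    followed at [rho] is a solution up to [tau z n] for each n, and maximality applies. The
    explosion time is thus the total integral of 1 / s along the ray. *)
Lemma lt_tstarE z v : 0 <= v -> (v%:E < tstar z)%E <-> alive (ray_speed s z) v.
Proof.
move=> v0; have [_ sol maxi] := flowP z; split.
  move=> /(solves_flow_ray sol v0)[r r0 [_ <-]].
  exact: (alive_cum (@speed_cont z) (speed_gt0 z)).
move=> [n vn]; apply: (@lt_le_trans _ _ (tau z n%:R)%:E); first by rewrite lte_fin.
have tn0 : 0 < tau z n%:R by exact: le_lt_trans v0 vn.
apply: (maxi _ (fun v => (ray z (rho (ray_speed s z) v)).1)); first by rewrite lte_fin.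
apply: ray_solves_flow; rewrite lt_neqAle ler0n andbT.
by apply/eqP => n0; move: tn0; rewrite -n0 cum0 ltxx.
Qed.

Lemma flow_rayE z v : 0 <= v -> (v%:E < tstar z)%E ->
  Phi v z = (ray z (rho (ray_speed s z) v)).1.
Proof.
move=> v0 vt; have [_ sol _] := flowP z.
have [r r0 [-> <-]] := solves_flow_ray sol v0 vt.
by rewrite (rho_cum (@speed_cont z) (speed_gt0 z)).
Qed.

End maximal.
End flow.

(** * Weighted image laws and their determination by rectangles *)

Section image_law.
Context d1 d2 d' (T1 : measurableType d1) (T2 : measurableType d2)
  (T' : measurableType d') (R : realType).
Variables (m1 : {measure set T1 -> \bar R}) (m2 : {measure set T2 -> \bar R}).
Variables (X1 : T1 -> T') (X2 : T2 -> T') (h1 : T1 -> R) (h2 : T2 -> R).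
Hypothesis mX1 : measurable_fun setT X1.
Hypothesis mX2 : measurable_fun setT X2.
Hypothesis mh1 : measurable_fun setT h1.
Hypothesis mh2 : measurable_fun setT h2.
Hypothesis h1_ge0 : forall w, 0 <= h1 w.
Hypothesis h2_ge0 : forall w, 0 <= h2 w.
Local Open Scope ereal_scope.

(** The weight h restricts to an event or carries a conditional probability, so that identities
    between expectations become equalities of measures on the target space. *)
Definition image_law d (T : measurableType d) (m : {measure set T -> \bar R})
    (X : T -> T') (h : T -> R) (mX : measurable_fun setT X) (mh : measurable_fun setT h)
    (h0 : forall w, (0 <= h w)%R) : {measure set T' -> \bar R} :=
  measure_function_pushforward__canonical__measure_function_Measure (density m mh h0) mX.

Lemma image_lawE d (T : measurableType d) (m : {measure set T -> \bar R})
    (X : T -> T') (h : T -> R) (mX : measurable_fun setT X) (mh : measurable_fun setT h)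
    (h0 : forall w, (0 <= h w)%R) C :
  image_law m mX mh h0 C = \int[m]_(w in X @^-1` C) (h w)%:E.
Proof. by []. Qed.

Lemma ge0_integral_image_law d (T : measurableType d) (m : {measure set T -> \bar R})
    (X : T -> T') (h : T -> R) (mX : measurable_fun setT X) (mh : measurable_fun setT h)
    (h0 : forall w, (0 <= h w)%R) (g : T' -> \bar R) :
  measurable_fun setT g -> (forall y, 0 <= g y) ->
  \int[image_law m mX mh h0]_y g y = \int[m]_w (g (X w) * (h w)%:E).
Proof.
move=> mg g0.
transitivity (\int[density m mh h0]_w (g \o X) w).
  exact: ge0_integral_pushforward.
rewrite (ge0_integral_density m mh h0 (g := g \o X))//.
  exact: measurableT_comp.
by move=> w; exact: g0.
Qed.

Lemma ge0_integral_image_eq (g : T' -> \bar R) :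
  (forall C, measurable C -> \int[m1]_(w in X1 @^-1` C) (h1 w)%:E =
    \int[m2]_(w in X2 @^-1` C) (h2 w)%:E) ->
  measurable_fun setT g -> (forall y, 0 <= g y) ->
  \int[m1]_w (g (X1 w) * (h1 w)%:E) = \int[m2]_w (g (X2 w) * (h2 w)%:E).
Proof.
move=> m12 mg g0.
rewrite -(ge0_integral_image_law m1 mX1 mh1 h1_ge0 mg g0).
rewrite -(ge0_integral_image_law m2 mX2 mh2 h2_ge0 mg g0).
by apply: eq_measure_integral => C mC _; exact: m12.
Qed.

End image_law.

Section half_line_unique.
Context d (T : measurableType d) (R : realType).
Local Open Scope ereal_scope.

Let half_line_rect := [set C : set (T * R) | exists A v,
  measurable A /\ C = A `*` (`]-oo, v[%classic : set R)].

Let measurable_half_line_rect : @measurable _ (T * R)%type = <<s half_line_rect >>.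
Proof.
apply/seteqP; split; last first.
  apply: smallest_sub; first exact: sigma_algebra_measurable.
  by move=> _ [A [v [mA ->]]]; exact: measurableX.
pose S := g_sigma_algebraType half_line_rect.
suff : measurable_fun [set: S] (fun p : S => (p.1, p.2) : T * R).
  move=> mid C mC; have := mid measurableT C mC.
  by rewrite setTI (_ : _ @^-1` C = C)//; apply/seteqP; split=> -[].
apply: measurable_fun_pair.
  move=> _ A mA; rewrite setTI.
  rewrite (_ : _ @^-1` A = \bigcup_n (A `*` (`]-oo, n%:R[%classic : set R))).
    apply: (@bigcupT_measurable _ S) => n; apply: sub_sigma_algebra.
    by exists A, n%:R.
  apply/seteqP; split => [[x r] /= Ax|[x r] [n _ []]//].
  exists (Num.bound `|r|%R) => //; split => //=; rewrite in_itv/=.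
  by rewrite (le_lt_trans (ler_norm r))// archi_boundP.
apply: (measurability _ (RGenInftyO.measurableE R)) => _ [_ [v ->] <-].
rewrite setTI; apply: sub_sigma_algebra; exists setT, v; split => //.
by apply/seteqP; split => [[x r]|[x r] []].
Qed.

Lemma half_line_rect_unique (n1 n2 : {measure set (T * R) -> \bar R}) :
  n1 setT < +oo -> (forall A v, measurable A ->
    n1 (A `*` (`]-oo, v[%classic : set R)) = n2 (A `*` (`]-oo, v[%classic : set R))) ->
  forall C, measurable C -> n1 C = n2 C.
Proof.
move=> n1fin n12 C mC.
apply: (measure_unique half_line_rect (fun n => [set: T] `*` (`]-oo, n%:R[%classic : set R))) => //.
- move=> _ _ [A [v [mA ->]]] [B [v' [mB ->]]].
  exists (A `&` B), (Num.min v v'); split; first exact: measurableI.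
  apply/seteqP; split => -[x r]; rewrite ?/F /setI/setX/= !in_itv/= lt_min.
    by move=> [[? ->] [? ->]].
  by move=> [[? ?] /andP[-> ->]].
- by move=> n; exists setT, n%:R.
- apply/seteqP; split => // -[x r] _; exists (Num.bound `|r|%R) => //; split => //=.
  by rewrite in_itv/= (le_lt_trans (ler_norm r))// archi_boundP.
- by move=> _ [A [v [mA ->]]]; exact: n12.
- move=> n; apply: le_lt_trans n1fin; apply: le_measure; rewrite ?inE//.
  exact: measurableX.
Qed.

(* Suited to a switching time, whose law is only known on the event that the flow has
   not exploded; the region is that event. *)
Lemma region_unique (n1 n2 : {measure set (T * R) -> \bar R}) (a : R -> set T) :
  (forall v, measurable (a v)) ->
  (forall v v', (v <= v')%R -> a v' `<=` a v) ->
  (forall v x, a v x -> exists2 q : rat, (v < ratr q)%R & a (ratr q) x) ->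
  n1 setT < +oo ->
  n1 (~` [set p | a p.2 p.1]) = 0 -> n2 (~` [set p | a p.2 p.1]) = 0 ->
  (forall A v, measurable A -> A `<=` a v ->
    n1 (A `*` (`]-oo, v[%classic : set R)) = n2 (A `*` (`]-oo, v[%classic : set R))) ->
  forall C, measurable C -> n1 C = n2 C.
Proof.
move=> ma a_dec a_open n1fin n1D n2D n12.
(* Since a point of the region remains in it for some rational q beyond its v, these countably many
   rectangles cover the region. On each of them the restricted measures are compared on half-line
   rectangles, whose sections then lie in a (ratr q). *)
pose F (q : rat) : set (T * R) := a (ratr q) `*` (`]-oo, ratr q[%classic : set R).
have mF q : measurable (F q) by exact: measurableX.
have FE q C : measurable C -> n1 (C `&` F q) = n2 (C `&` F q).
  move=> mC.
  have fin : mrestr n1 (mF q) setT < +oo.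
    apply: le_lt_trans n1fin; rewrite /mrestr.
    by apply: le_measure; rewrite ?inE// setTI.
  apply: (half_line_rect_unique (n1 := mrestr n1 (mF q)) (n2 := mrestr n2 (mF q)) fin _ mC).
  move=> A v mA.
  change (n1 ((A `*` (`]-oo, v[%classic : set R)) `&` F q) =
          n2 ((A `*` (`]-oo, v[%classic : set R)) `&` F q)).
  rewrite (_ : _ `&` F q = (A `&` a (ratr q)) `*` (`]-oo, Num.min v (ratr q)[%classic : set R)).
    apply: n12; first exact: measurableI.
    apply: subset_trans (a_dec (Num.min v (ratr q)) (ratr q) _); last by rewrite ge_min lexx orbT.
    exact: subIsetr.
  apply/seteqP; split => -[x r]; rewrite ?/F /setI/setX/= !in_itv/= lt_min.
    by move=> [[? ->] [? ->]].
  by move=> [[? ?] /andP[-> ->]].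
pose G n := if (unpickle n : option rat) is Some q then F q else set0.
have mG n : measurable (G n) by rewrite /G; case: unpickle.
have GE n C : measurable C -> n1 (C `&` G n) = n2 (C `&` G n).
  by rewrite /G; case: unpickle => [q|] mC; [exact: FE|rewrite setI0 !measure0].
have UG : \bigcup_n G n = [set p | a p.2 p.1].
  apply/seteqP; split => [p [n _]|[x v] /=].
    rewrite /G; case: unpickle => // q [/= ap]; rewrite in_itv/= => pq.
    exact: (a_dec _ _ (ltW pq) _ ap).
  move=> avx; have [q vq aq] := a_open _ _ avx; exists (pickle q); first by [].
  by rewrite /G pickleK; split; [exact: aq|rewrite /= in_itv].
have mUG : measurable [set p : T * R | a p.2 p.1] by rewrite -UG; exact: bigcupT_measurable.
move=> C mC.
have part (n : {measure set (T * R) -> \bar R}) : n (~` [set p | a p.2 p.1]) = 0 ->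
    n C = \sum_(k <oo) n (C `&` seqDU G k).
  move=> nD; have -> : n C = n (C `&` [set p | a p.2 p.1]).
    rewrite -[in LHS](setIT C) -(setUv [set p | a p.2 p.1]) setIUr measureU//.
    - rewrite [X in _ + X](_ : _ = 0) ?adde0//; apply/eqP.
      rewrite eq_le measure_ge0 andbT -nD; apply: le_measure; rewrite ?inE//.
      - by apply: measurableI => //; exact: measurableC.
      - exact: measurableC.
    - exact: measurableI.
    - by apply: measurableI => //; exact: measurableC.
    - by rewrite setIACA setICr setI0.
  rewrite -UG seqDU_bigcup_eq setI_bigcupr measure_bigcup//.
  - by apply: eq_eseriesl => i; rewrite in_setT.
  - by move=> i _; apply: measurableI => //; exact: seqDU_measurable.
  - by apply: trivIset_setIl; exact: trivIset_seqDU.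
rewrite (part n1 n1D) (part n2 n2D); apply: eq_eseriesr => k _.
have mk : measurable (~` (\bigcup_(i in `I_k) G i)).
  by apply: measurableC; apply: bigcup_measurable.
rewrite /seqDU -bigcup_mkord setDE setIA setIAC; apply: GE.
exact: measurableI.
Qed.

End half_line_unique.

Lemma fine_sigma_additive d (X : measurableType d) (R : realType)
    (m : {measure set X -> \bar R}) (A : (set X)^nat) :
  (m setT < +oo)%E -> trivIset setT A -> (forall k, measurable (A k)) ->
  \sum_(0 <= k < n) fine (m (A k)) @[n --> \oo] --> fine (m (\bigcup_k A k)).
Proof.
move=> mT tA mA.
have fin B : measurable B -> m B \is a fin_num.
  move=> mB; rewrite ge0_fin_numE//; apply: le_lt_trans mT.
  by apply: le_measure; rewrite ?inE.
have mU : measurable (\bigcup_k A k) by exact: bigcupT_measurable.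
have := @measure_semi_sigma_additive _ _ _ m A mA tA mU.
rewrite -[X in _ --> X](fineK (fin _ mU)) => /fine_cvg.
rewrite (_ : fine \o _ = (fun n => \sum_(0 <= k < n) fine (m (A k))))//.
apply/funext => n /=; rewrite (eq_bigr (fun k => (fine (m (A k)))%:E)) ?sumEFin// => k _.
by rewrite fineK// fin.
Qed.

(** * The flow in time and in the line parameter *)

Section flow_reg.
Context (R : realType) (d : nat) (U s : 'rV[R]_d -> R)
  (gamma : 'I_d -> 'rV[R]_d -> velocity d -> R) (gbar : R).
Hypothesis reg : regular_suzz U s gamma gbar.
Notation E := ('rV[R]_d * velocity d)%type.
Notation leb := (@lebesgue_measure R).
Notation speed := (ray_speed s).
Notation rate := (ray_rate U s gamma).

Let sc z : continuous (speed z) := @continuous_ray_speed _ _ _ _ _ _ reg z.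
Let sg z r : 0 < speed z r := ray_speed_gt0 reg z r.

Definition flow_state (z : E) (v : R) : E := ray z (rho (speed z) v).

Lemma measurable_cum_speed : measurable_fun setT (fun p : E * R => cum (speed p.1) p.2).
Proof.
apply: (measurable_cum (F := fun p : E * R => speed p.1 p.2)).
  exact: (measurable_ray_speed reg).
by move=> p; exact: ltW.
Qed.

Lemma measurable_rho : measurable_fun setT (fun p : E * R => rho (speed p.1) p.2).
Proof.
apply: measurableT_comp => //.
apply: (measurable_integral_half_line (F := fun q : (E * R) * R =>
  ((if cum (speed q.1.1) q.2 <= q.1.2 then 1 else 0 : R)%:E))); last first.
  by move=> q; case: ifP => _; rewrite ?lee_fin.
have m1 : measurable_fun setT (fun q : (E * R) * R => (q.1.1, q.2)).
  apply: measurable_fun_pair; last exact: measurable_snd.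
  exact: (measurableT_comp measurable_fst measurable_fst).
have m2 : measurable_fun setT (fun q : (E * R) * R => q.1.2).
  exact: (measurableT_comp measurable_snd measurable_fst).
have m3 := measurableT_comp measurable_cum_speed m1.
apply/measurable_EFinP; apply: measurable_fun_ifT; last 2 first.
- exact: measurable_cst.
- exact: measurable_cst.
exact: measurable_fun_ler m3 m2.
Qed.

Lemma measurable_alive : measurable [set p : E * R | alive (speed p.1) p.2].
Proof.
rewrite (_ : [set p | _] = \bigcup_n [set p : E * R | p.2 < cum (speed p.1) n%:R]).
  apply: bigcupT_measurable => n.
  have m1 : measurable_fun setT (fun p : E * R => (p.1, n%:R : R)).
    by apply: measurable_fun_pair.
  have m2 : measurable_fun setT (fun p : E * R => p.2) := measurable_snd.
  have m3 := measurable_fun_ltr m2 (measurableT_comp measurable_cum_speed m1).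
  by have := m3 measurableT [set true]; rewrite setTI; exact.
by apply/seteqP; split=> p /= [n]; [exists n|move=> _ np; exists n].
Qed.

Lemma alive_le z v v' : v <= v' -> alive (speed z) v' -> alive (speed z) v.
Proof. by move=> vv' [n vn]; exists n; exact: le_lt_trans vn. Qed.

Lemma alive_lt z v : alive (speed z) v -> exists2 q : rat, v < ratr q & alive (speed z) (ratr q).
Proof.
move=> [n vn]; have [q] := rat_in_itvoo vn; rewrite in_itv/= => /andP[vq qn].
by exists q => //; exists n.
Qed.

Lemma measurable_flow_state : measurable_fun setT (fun p : E * R => flow_state p.1 p.2).
Proof.
have m1 : measurable_fun setT (fun p : E * R => (p.1, rho (speed p.1) p.2)).
  by apply: measurable_fun_pair; [exact: measurable_fst|exact: measurable_rho].
exact: (measurableT_comp (@measurable_ray R d) m1).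
Qed.

Lemma flow_state_cum z r : 0 <= r -> flow_state z (cum (speed z) r) = ray z r.
Proof. by move=> r0; rewrite /flow_state rho_cum. Qed.

Lemma rho_right_continuous z v : 0 <= v -> alive (speed z) v ->
  rho (speed z) u @[u --> v^'+] --> rho (speed z) v.
Proof.
rewrite le_eqVlt => /predU1P[<- _|v0 av].
  have -> : rho (speed z) 0 = 0 by rewrite -{1}(cum0 (speed z)) rho_cum.
  exact: rho_cvg0.
apply: cvg_at_right_filter; apply/differentiable_continuous/derivable1_diffP.
by case: (is_derive_rho (@sc z) (@sg z) v0 av).
Qed.

Lemma cum_rate_split a z r : 0 <= a -> 0 <= r ->
  cum (rate a z) r = a * cum (speed z) r + cum (rate 0 z) r.
Proof.
move=> a0 r0; rewrite /cum -RintegralZl//; last first.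
  exact: (rate_integrable (continuous_rate (@sc z) (@sg z)) _ _ _ (lexx 0)).
rewrite -RintegralD//.
- by apply: eq_Rintegral => v _; rewrite /ray_rate /ray_speed add0r -mulrDl.
- apply: lebesgue_integrableM => //.
  exact: (rate_integrable (continuous_rate (@sc z) (@sg z)) _ _ _ (lexx 0)).
- exact: (rate_integrable (locally_bounded_ray_rate reg z (lexx 0)) _ _ _ (lexx 0)).
Qed.

Lemma alive_rho z v : 0 <= v -> alive (speed z) v ->
  0 <= rho (speed z) v /\ cum (speed z) (rho (speed z) v) = v.
Proof. by move=> v0 va; exact: cum_rho. Qed.

(** An instance of [time_change], with the total rate truncated at the parameter reached at time v:
    along the flow du is dr / s. It translates the switching intensity of the process into
    [ray_rate]. *)
Lemma integral_rate_flow z v : 0 <= v -> alive (speed z) v ->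
  \int[leb]_(u in `[0, v]) total_rate U s gamma (flow_state z u) =
  cum (rate 0 z) (rho (speed z) v).
Proof.
move=> v0 av; have [r0 rv] := alive_rho v0 av; set r := rho _ _ in r0 rv *.
pose H (u : R) := ((if u <= r then total_rate U s gamma (ray z u) else 0)%:E).
have t0 := total_rate_ge0 reg.
have mtot : measurable_fun setT (fun u => total_rate U s gamma (ray z u)).
  exact: (measurableT_comp (measurable_total_rate reg) (measurable_ray1 z)).
have mH : measurable_fun setT H.
  apply/measurable_EFinP; apply: measurable_fun_ifT => //; exact: measurable_fun_ler.
have H0 u : (0 <= H u)%E by rewrite lee_fin; case: ifP.
rewrite /Rintegral; transitivity (fine (cum (rate 0 z) r)%:E); last by [].
congr fine.
rewrite -(cumE (locally_bounded_ray_rate reg z (lexx 0))).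
transitivity (\int[leb]_(u in `[0%R, +oo[) (H u * (speed z u)%:E))%E; last first.
  rewrite integral_mkcond [RHS]integral_mkcond; apply: eq_integral => u _.
  rewrite !patchE !mem_setE !in_itv/= andbT /H; case: (0 <= u) => //=.
  by case: ifP => _; rewrite ?mul0e// -EFinM /ray_rate add0r.
rewrite (time_change (@sc z) (@sg z) mH H0).
rewrite integral_mkcond [RHS]integral_mkcond; apply: eq_integral => u _.
rewrite !patchE; case: ifPn.
  rewrite inE/= in_itv/= => /andP[u0 uv].
  have au : alive (speed z) u := alive_le uv av.
  rewrite mem_set/=; last by split => //=; rewrite in_itv/= u0.
  have [ru rE] := alive_rho u0 au.
  by rewrite /H -(le_cumE (@sc z) (@sg z))// rE rv uv.
rewrite notin_setE/= => nu; case: ifPn => //; rewrite inE/= in_itv/= andbT => -[u0 au].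
have [ru rE] := alive_rho u0 au.
rewrite /H -(le_cumE (@sc z) (@sg z))// rE rv; case: ifP => // uv.
by exfalso; apply: nu; rewrite /= in_itv/= u0.
Qed.

End flow_reg.

(** * Expectations over the episodes between switches *)

Section process.
Context (R : realType) (d : nat) (U s : 'rV[R]_d -> R)
  (gamma : 'I_d -> 'rV[R]_d -> velocity d -> R) (gbar : R).
Hypothesis d_gt0 : (0 < d)%N.
Hypothesis reg : regular_suzz U s gamma gbar.
Notation E := ('rV[R]_d * velocity d)%type.
Notation leb := (@lebesgue_measure R).
Notation speed := (ray_speed s).
Notation rate := (ray_rate U s gamma).
Notation flow := (flow_state s).
Context (disp : measure_display) (Omega : measurableType disp)
  (P : E -> probability Omega R) (T : nat -> Omega -> \bar R) (Y : nat -> Omega -> E)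
  (Z : R -> Omega -> option E) (Phi : R -> E -> 'rV[R]_d) (tstar : E -> \bar R).
Hypothesis Z_suzz : suzz_process T Y s (suzz_rate U s gamma) P Z Phi tstar.
Let s_cont : continuous s := C1_continuous (regular_s reg).
Let s_gt0 := regular_s_gt0 reg.
Let flowP := suzz_flow Z_suzz.
Let mT n : measurable_fun setT (T n) := suzz_measurable_time Z_suzz n.
Let mY n : measurable_fun setT (Y n) := suzz_measurable_state Z_suzz n.

Lemma switch_time_ge0 n w : (0 <= T n w)%E.
Proof.
elim: n => [|n IH]; first by rewrite (suzz_time0 Z_suzz).
have [Tn|] := ltP (T n w) +oo%E.
  exact: le_trans IH (ltW (suzz_time_incr Z_suzz Tn)).
by rewrite leye_eq => /eqP/(suzz_time_stop Z_suzz) ->.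
Qed.

Lemma switch_time_prev n w : (T n.+1 w < +oo -> T n w < +oo)%E.
Proof.
move=> Tn1; rewrite ltNge; apply/negP; rewrite leye_eq => /eqP/(suzz_time_stop Z_suzz) Toy.
by rewrite Toy ltxx in Tn1.
Qed.

Lemma switch_time_fin n w : (T n w < +oo)%E -> T n w = (fine (T n w))%:E.
Proof. by move=> Tn; rewrite fineK// ge0_fin_numE// switch_time_ge0. Qed.

Lemma flow_state_Phi y v : 0 <= v -> alive (speed y) v -> (Phi v y, y.2) = flow y v.
Proof.
move=> v0 /(lt_tstarE d_gt0 s_cont s_gt0 flowP _ v0).2 vt.
by rewrite (flow_rayE d_gt0 s_cont s_gt0 flowP v0 vt).
Qed.

Let timed n w : \bar R * E := (T n w, Y n w).

Let mtimed n : measurable_fun setT (timed n).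
Proof. by apply: measurable_fun_pair; [exact: mT|exact: mY]. Qed.

Lemma history_timed n C : measurable C -> history T Y n (timed n @^-1` C).
Proof.
move=> mC; pose G := \bigcup_(k in [set k | (k <= n)%N])
        (preimage_set_system setT (T k) measurable `|`
         preimage_set_system setT (Y k) measurable).
pose S := g_sigma_algebraType G.
have mS : measurable_fun [set: S] (fun w : S => (T n w, Y n w)).
  apply: measurable_fun_pair => _ B mB; rewrite setTI; apply: sub_sigma_algebra.
    by exists n => //=; left; exists B => //; rewrite setTI.
  by exists n => //=; right; exists B => //; rewrite setTI.
by have := mS measurableT C mC; rewrite setTI.
Qed.

Definition running n v := [set w | (T n w < +oo)%E /\ alive (speed (Y n w)) v].

Definition unswitched n v := running n v `&` [set w | (T n w + v%:E <= T n.+1 w)%E].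

(** By [integral_rate_flow] this is the probability, prescribed by [suzz_process], of no switch
    before age v, read in the line parameter. *)
Definition survival (y : E) (v : R) : R := expR (- cum (rate 0 y) (rho (speed y) v)).

Lemma measurable_survival : measurable_fun setT (fun p : E * R => survival p.1 p.2).
Proof.
have m1 : measurable_fun setT (fun p : E * R => (p.1, rho (speed p.1) p.2)).
  by apply: measurable_fun_pair; [exact: measurable_fst|exact: (measurable_rho reg)].
have m2 := measurableT_comp (measurable_cum_ray_rate reg (lexx 0)) m1.
by apply: measurableT_comp => //; exact: measurable_funN m2.
Qed.

Lemma measurable_running n : measurable [set p : Omega * R | running n p.2 p.1].
Proof.
have m1 : measurable_fun setT (fun p : Omega * R => (Y n p.1, p.2)).
  by apply: measurable_fun_pair => //; exact: (measurableT_comp (mY n) measurable_fst).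
have mTn : measurable [set w | (T n w < +oo)%E].
  rewrite -[X in measurable X]setTI; exact: emeasurable_fun_infty_o.
rewrite (_ : [set p | _] = ([set w | (T n w < +oo)%E] `*` setT) `&`
    (fun p : Omega * R => (Y n p.1, p.2)) @^-1` [set p : E * R | alive (speed p.1) p.2]).
  apply: measurableI; first exact: measurableX.
  rewrite -[X in measurable X]setTI; apply: m1 => //; exact: (measurable_alive reg).
by apply/seteqP; split=> p /=; [move=> [? ?]|move=> [[]]].
Qed.

Lemma measurable_unswitched n : measurable [set p : Omega * R | unswitched n p.2 p.1].
Proof.
rewrite (_ : [set p | _] = [set p | running n p.2 p.1] `&`
   [set p : Omega * R | (T n p.1 + p.2%:E <= T n.+1 p.1)%E])//.
apply: measurableI; first exact: measurable_running.
rewrite -[X in measurable X]setTI; apply: emeasurable_fun_le => //.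
  apply: emeasurable_funD; first exact: (measurableT_comp (mT n) measurable_fst).
  by apply/measurable_EFinP; exact: measurable_snd.
exact: (measurableT_comp (mT n.+1) measurable_fst).
Qed.

Let section_measurable (A : set (Omega * R)) v : measurable A -> measurable [set w | A (w, v)].
Proof.
move=> mA; have m1 : measurable_fun setT (fun w : Omega => (w, v)) by exact: measurable_pair2.
by have := m1 measurableT A mA; rewrite setTI.
Qed.

(** The prescribed law tests events of the history; those of the form (T n, Y n) in C already
    identify two image laws, hence the integrals of all nonnegative functions of (T n, Y n). *)
Lemma time_law z n v (g : \bar R * E -> \bar R) : 0 <= v ->
  measurable_fun setT g -> (forall x, 0 <= g x)%E ->
  (\int[P z]_w (g (T n w, Y n w) * (\1_(unswitched n v) w)%:E) =
   \int[P z]_w (g (T n w, Y n w) * (\1_(running n v) w * survival (Y n w) v)%:E))%E.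
Proof.
move=> v0 mg g0.
have mU := section_measurable v (measurable_unswitched n).
have mR := section_measurable v (measurable_running n).
have msurv : measurable_fun setT (fun w => survival (Y n w) v).
  have m1 : measurable_fun setT (fun w => (Y n w, v)) by apply: measurable_fun_pair.
  exact: (measurableT_comp measurable_survival m1).
have mh2 : measurable_fun setT (fun w => \1_(running n v) w * survival (Y n w) v).
  by apply: measurable_funM => //; exact: measurable_indic.
have s0 y : 0 <= survival y v by exact: expR_ge0.
apply: (@ge0_integral_image_eq _ _ _ _ _ _ _ (P z) (P z) (timed n) (timed n)) => //.
- by move=> w; rewrite mulr_ge0.
move=> C mC; have mB : measurable (timed n @^-1` C).
  by have := mtimed n measurableT mC; rewrite setTI.
have := @suzz_time_law _ _ _ _ _ _ _ _ _ _ _ _ Z_suzz z n v _ v0 (history_timed mC).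
set B := timed n @^-1` C in mB *.
have -> : B `&` [set w | (T n w < +oo)%E /\ (v%:E < tstar (Y n w))%E] = B `&` running n v.
  congr (_ `&` _); apply/seteqP; split => w [Tn] /(lt_tstarE d_gt0 s_cont s_gt0 flowP _ v0).
    by [].
  by move=> ?; split => //; apply/(lt_tstarE d_gt0 s_cont s_gt0 flowP _ v0).
cbv zeta; rewrite -setIA -/(unswitched n v) => law.
transitivity (P z (B `&` unswitched n v)).
  by rewrite setIC -integral_indic.
rewrite law integral_mkcondr.
apply: eq_integral => w _; rewrite patchE indicE; case: ifPn => [wr|nr].
  have [_ av] := set_mem wr; rewrite mul1r /survival -(integral_rate_flow reg v0 av).
  congr (expR (- _))%:E; apply: eq_Rintegral => u; rewrite inE/= in_itv/= => /andP[u0 uv].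
  by rewrite (flow_state_Phi u0 (alive_le uv av)).
by rewrite mul0r.
Qed.

Let sc z : continuous (speed z) := @continuous_ray_speed _ _ _ _ _ _ reg z.
Let sg z r : 0 < speed z r := ray_speed_gt0 reg z r.

(** Under v = cum (speed y) r, the factor 1 / s is absorbed by dv, and [cum_rate_split] isolates exp
    (- a v). So [fly] is the expected discounted integral of f over one episode. *)
Lemma fly_time_change (a : R) (f : E -> \bar R) y : 0 <= a -> nn_measurable f ->
  (\int[leb]_(v in `[0%R, +oo[) ((\1_[set v | alive (speed y) v] v)%:E *
     ((expR (- (a * v)))%:E * f (flow y v) * (survival y v)%:E)) =
   fly U s gamma a f y)%E.
Proof.
move=> a0 [mf f0].
pose H r : \bar R := ((expR (- (a * cum (speed y) r)))%:E * f (ray y r) *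
   (expR (- cum (rate 0 y) r))%:E)%E.
have mH : measurable_fun setT H.
  apply: emeasurable_funM; first apply: emeasurable_funM.
  - apply/measurable_EFinP; apply: measurableT_comp => //; apply: measurable_funN.
    apply: measurable_funM => //; apply: measurable_cum1; exact: continuous_rate.
  - exact: (measurableT_comp mf (measurable_ray1 y)).
  - apply/measurable_EFinP; apply: measurableT_comp => //; apply: measurable_funN.
    exact: (measurable_cum1 (locally_bounded_ray_rate reg y (lexx 0))).
have H0 r : (0 <= H r)%E by rewrite !mule_ge0// lee_fin expR_ge0.
transitivity (\int[leb]_(r in `[0%R, +oo[) (H r * (speed y r)%:E))%E; last first.
  apply: eq_integral => r; rewrite inE/= in_itv/= andbT => r0.
  rewrite /H muleAC (muleC _ (f _)) -!muleA; congr (_ * _)%E.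
  rewrite -!EFinM /ray_weight (cum_rate_split reg _ a0 r0) opprD expRD.
  by congr (_%:E); ring.
rewrite (time_change (@sc y) (@sg y) mH H0) integral_mkcondr.
apply: eq_integral => v; rewrite inE/= in_itv/= andbT => v0.
rewrite patchE indicE; case: ifPn => [/set_mem av|_]; last by rewrite mul0e.
have [r0 rv] := cum_rho (@sc y) (@sg y) v0 av.
by rewrite mul1e /H rv.
Qed.

(** The test matters: [fine] sends +oo to 0, which would give the discount 1 instead of 0 to a
    switch that never occurs. *)
Definition disc (a : R) (t : \bar R) : R := if (t < +oo)%E then expR (- (a * fine t)) else 0.

Lemma disc_ge0 a t : 0 <= disc a t.
Proof. by rewrite /disc; case: ifP => // _; exact: expR_ge0. Qed.

Lemma measurable_disc a : measurable_fun setT (disc a).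
Proof.
apply: measurable_fun_ifT.
- exact: measurable_fun_lte.
- apply: measurableT_comp => //; apply: measurable_funN.
  by apply: measurable_funM; [exact: measurable_cst|exact: fine_measurable].
- exact: measurable_cst.
Qed.

(** Closed on the left and open on the right, as suits right-continuous paths; the last clause
    excludes that the flow has exploded since the n-th switch. *)
Definition staying n (t : R) := [set w | (T n w <= t%:E)%E /\ (t%:E < T n.+1 w)%E /\
  alive (speed (Y n w)) (t - fine (T n w))].

Let age n (p : Omega * R) : E * R := (Y n p.1, p.2 - fine (T n p.1)).

Let measurable_age n : measurable_fun setT (age n).
Proof.
apply: measurable_fun_pair; first exact: (measurableT_comp (mY n) measurable_fst).
apply: measurable_funB; first exact: measurable_snd.
have mTn := measurableT_comp (mT n) (@measurable_fst _ _ Omega R).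
by apply: measurableT_comp; [exact: fine_measurable|exact: mTn].
Qed.

Lemma measurable_staying n : measurable [set p : Omega * R | staying n p.2 p.1].
Proof.
rewrite (_ : [set p | _] = [set p : Omega * R | (T n p.1 <= p.2%:E)%E] `&`
  ([set p : Omega * R | (p.2%:E < T n.+1 p.1)%E] `&`
   age n @^-1` [set q : E * R | alive (speed q.1) q.2]))//.
have m2 : measurable_fun setT (fun p : Omega * R => p.2%:E).
  by apply/measurable_EFinP; exact: measurable_snd.
have mT1 k := measurableT_comp (mT k) (@measurable_fst _ _ Omega R).
apply: measurableI; [|apply: measurableI].
- rewrite -[X in measurable X]setTI; exact: (emeasurable_fun_le measurableT (mT1 n) m2).
- rewrite -[X in measurable X]setTI; exact: (emeasurable_fun_lt measurableT m2 (mT1 n.+1)).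
- by have := measurable_age n measurableT (measurable_alive reg); rewrite setTI.
Qed.

Definition occupation n a (f : E -> \bar R) (p : Omega * R) : \bar R :=
  ((\1_(staying n p.2) p.1)%:E *
     ((expR (- (a * p.2)))%:E * f (flow (Y n p.1) (p.2 - fine (T n p.1))%R)))%E.

Lemma measurable_occupation n a f : nn_measurable f -> measurable_fun setT (occupation n a f).
Proof.
move=> [mf _]; apply: emeasurable_funM.
  by apply/measurable_EFinP; exact: (measurable_indic (measurable_staying n)).
apply: emeasurable_funM.
  apply/measurable_EFinP; apply: measurableT_comp => //; apply: measurable_funN.
  by apply: measurable_funM => //; exact: measurable_snd.
exact: (measurableT_comp mf (measurableT_comp (measurable_flow_state reg) (measurable_age n))).
Qed.

Lemma occupation_ge0 n a f p : nn_measurable f -> (0 <= occupation n a f p)%E.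
Proof. by move=> [_ f0]; rewrite !mule_ge0// lee_fin ?expR_ge0. Qed.

Definition holding n a (f : E -> \bar R) (p : Omega * R) : \bar R :=
  ((disc a (T n p.1))%:E * ((expR (- (a * p.2)))%:E * f (flow (Y n p.1) p.2)))%E.

Lemma measurable_holding n a f : nn_measurable f -> measurable_fun setT (holding n a f).
Proof.
move=> [mf _]; apply: emeasurable_funM.
  apply/measurable_EFinP; apply: (measurableT_comp (measurable_disc a)).
  exact: (measurableT_comp (mT n) measurable_fst).
apply: emeasurable_funM.
  apply/measurable_EFinP; apply: measurableT_comp => //; apply: measurable_funN.
  by apply: measurable_funM => //; exact: measurable_snd.
have m1 : measurable_fun setT (fun p : Omega * R => (Y n p.1, p.2)).
  apply: measurable_fun_pair; last exact: measurable_snd.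
  exact: (measurableT_comp (mY n) measurable_fst).
exact: (measurableT_comp mf (measurableT_comp (measurable_flow_state reg) m1)).
Qed.

Lemma holding_ge0 n a f p : nn_measurable f -> (0 <= holding n a f p)%E.
Proof. by move=> [_ f0]; rewrite !mule_ge0// lee_fin ?expR_ge0// disc_ge0. Qed.

Let measurable_unswitched_indic n : measurable_fun setT
  (fun p : Omega * R => (\1_(unswitched n p.2) p.1)%:E : \bar R).
Proof.
by apply/measurable_EFinP; exact: (measurable_indic (measurable_unswitched n)).
Qed.

Let measurable_running_indic n : measurable_fun setT
  (fun p : Omega * R => (\1_(running n p.2) p.1)%:E : \bar R).
Proof.
by apply/measurable_EFinP; exact: (measurable_indic (measurable_running n)).
Qed.

(** Translation of the time axis by T n, from absolute time to the age of the episode, at which the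
    law of the next switch is known. *)
Lemma integral_occupation n a (f : E -> \bar R) w : nn_measurable f ->
  (\int[leb]_(t in `[0%R, +oo[) occupation n a f (w, t) =
   \int[leb]_(v in `[0%R, +oo[) (holding n a f (w, v) * (\1_(unswitched n v) w)%:E))%E.
Proof.
move=> nf.
have [Tfin|Toy] := ltP (T n w) +oo%E; last first.
  rewrite !integral0_eq// => t _.
    rewrite /= indicE memNset ?mule0// => -[[+ _] _]; by rewrite ltNge Toy.
  rewrite /occupation/= indicE memNset ?mul0e// => -[+ _]; rewrite leNgt => /negP; apply.
  exact: lt_le_trans (ltry _) Toy.
have TE := switch_time_fin Tfin; set t0 := fine (T n w) in TE *.
have t00 : 0 <= t0 by rewrite -lee_fin -TE switch_time_ge0.
pose F t := occupation n a f (w, t).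
have mF : measurable_fun setT F.
  exact: (measurableT_comp (measurable_occupation n a nf) (measurable_pair1 w)).
have F0 t : (0 <= F t)%E by exact: occupation_ge0.
have FN t : t < t0 -> F t = 0%E.
  by move=> tt0; rewrite /F /occupation indicE memNset ?mul0e// => -[]; rewrite TE lee_fin leNgt tt0.
rewrite -[LHS]/(\int[leb]_(t in `[0%R, +oo[) F t)%E integral_mkcond.
transitivity (\int[leb]_t F t)%E.
  apply: eq_integral => t _; rewrite patchE mem_setE in_itv/= andbT.
  by case: leP => // t_lt0; rewrite FN// (lt_le_trans t_lt0).
rewrite -(ge0_integral_shift t0 mF F0) [RHS]integral_mkcond.
apply: ge0_ae_eq_integral => //.
- by apply: (measurableT_comp mF); exact: measurable_funD.
- apply/(measurable_restrictT _ _).1 => //; apply: measurable_funTS.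
  apply: emeasurable_funM.
    exact: (measurableT_comp (measurable_holding n a nf) (measurable_pair1 w)).
  exact: (measurableT_comp (measurable_unswitched_indic n) (measurable_pair1 w)).
- by move=> t _; rewrite patchE; case: ifP => // _; rewrite mule_ge0// ?holding_ge0// lee_fin.
(* [staying] has a strict inequality at the next switch and [unswitched] a large one: the integrands
   may differ at this single age. *)
exists [set (fine (T n.+1 w) - t0)]; split => //.
  exact: lebesgue_measure_set1.
move=> v /= nv; apply: contrapT => vT; apply: nv => _.
rewrite patchE mem_setE in_itv/= andbT; case: leP => v0; last first.
  by rewrite FN// gtrDr.
rewrite /F /occupation /holding /= -/t0 addrK /disc Tfin.
have -> : (\1_(staying n (v + t0)) w : R) = \1_(unswitched n v) w.
  rewrite !indicE; congr (nat_of_bool _)%:R; apply/idP/idP => /set_mem H; apply/mem_set.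
    case: H => _ [/ltW vT1]; rewrite -/t0 addrK => av; split; first by split.
    by rewrite /= TE -EFinD addrC.
  case: H => -[_ av] /=; rewrite TE -EFinD => T1; split; first by rewrite TE lee_fin lerDr.
  rewrite -/t0 addrK; split => //; rewrite lt_neqAle addrC T1 andbT.
  by apply/eqP => T1E; apply: vT; rewrite -T1E/= addrAC subrr add0r.
rewrite muleC; congr (_ * _)%E.
by rewrite muleA -EFinM -expRD -opprD -mulrDr addrC.
Qed.

(** Tonelli takes the age outside; at a fixed age [time_law] replaces the event of no switch by its
    conditional probability; [fly_time_change] then recognizes [fly]. *)
Lemma expectation_occupation z n a f : 0 <= a -> nn_measurable f ->
  (\int[P z]_w \int[leb]_(t in `[0%R, +oo[) occupation n a f (w, t) =
   \int[P z]_w ((disc a (T n w))%:E * fly U s gamma a f (Y n w)))%E.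
Proof.
move=> a0 nf; have [mf f0] := nf.
have surv0 y v : 0 <= survival y v by exact: expR_ge0.
have surv_meas : measurable_fun setT (fun p : Omega * R => (survival (Y n p.1) p.2)%:E).
  have m1 : measurable_fun setT (fun p : Omega * R => (Y n p.1, p.2)).
    apply: measurable_fun_pair; last exact: measurable_snd.
    exact: (measurableT_comp (mY n) measurable_fst).
  by apply/measurable_EFinP; exact: (measurableT_comp measurable_survival m1).
pose F (p : Omega * R) : \bar R := (holding n a f p * (\1_(unswitched n p.2) p.1)%:E)%E.
pose G (p : Omega * R) : \bar R :=
  (holding n a f p * (\1_(running n p.2) p.1 * survival (Y n p.1) p.2)%:E)%E.
have mF : measurable_fun setT F.
  by apply: emeasurable_funM; [exact: measurable_holding|exact: measurable_unswitched_indic].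
have mG : measurable_fun setT G.
  apply: emeasurable_funM; first exact: measurable_holding.
  by under eq_fun do rewrite EFinM; exact: emeasurable_funM.
have F0 p : (0 <= F p)%E by rewrite mule_ge0 ?holding_ge0// lee_fin.
have G0 p : (0 <= G p)%E by rewrite mule_ge0 ?holding_ge0// lee_fin mulr_ge0.
transitivity (\int[P z]_w \int[leb]_(v in `[0%R, +oo[) F (w, v))%E.
  by apply: eq_integral => w _; exact: integral_occupation.
rewrite (tonelli_half_line (P z) mF F0).
transitivity (\int[leb]_(v in `[0%R, +oo[) \int[P z]_w G (w, v))%E.
  apply: eq_integral => v; rewrite inE/= in_itv/= andbT => v0.
  pose g (x : \bar R * E) : \bar R :=
    ((disc a x.1)%:E * ((expR (- (a * v)))%:E * f (flow x.2 v)))%E.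
  apply: (time_law z n (g := g) v0).
    apply: emeasurable_funM.
      apply/measurable_EFinP; exact: (measurableT_comp (measurable_disc a) measurable_fst).
    apply: emeasurable_funM => //.
    have m1 : measurable_fun setT (fun x : \bar R * E => (x.2, v)).
      by apply: measurable_fun_pair.
    exact: (measurableT_comp mf (measurableT_comp (measurable_flow_state reg) m1)).
  by move=> x; rewrite !mule_ge0// lee_fin ?expR_ge0// disc_ge0.
rewrite -(tonelli_half_line (P z) mG G0).
apply: eq_integral => w _; rewrite -(fly_time_change _ a0 nf).
have mp : measurable_fun setT (fun v : R => (Y n w, v)) := measurable_pair1 (Y n w).
rewrite -ge0_integralZl//; last 3 first.
- apply: measurable_funTS; apply: emeasurable_funM.
    apply/measurable_EFinP; apply: measurable_indic.
    by have := mp measurableT _ (measurable_alive reg); rewrite setTI.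
  apply: emeasurable_funM.
    apply: emeasurable_funM.
      apply/measurable_EFinP; apply: measurableT_comp => //; apply: measurable_funN.
      exact: measurable_funM.
    exact: (measurableT_comp mf (measurableT_comp (measurable_flow_state reg) mp)).
  by apply/measurable_EFinP; exact: (measurableT_comp measurable_survival mp).
- by move=> v _; rewrite !mule_ge0// lee_fin ?expR_ge0.
- by rewrite lee_fin disc_ge0.
apply: eq_integral => v _; rewrite /G /holding/= -!muleA.
have [Tfin|Toy] := ltP (T n w) +oo%E; last by rewrite /disc ltNge Toy !mul0e.
congr (_ * _)%E; rewrite EFinM.
have -> : \1_(running n v) w = \1_[set v | alive (speed (Y n w)) v] v :> R.
  by rewrite !indicE; congr (nat_of_bool _)%:R; apply/idP/idP => /set_mem; [case=> _|] => ?; apply/mem_set.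
by rewrite [RHS]muleCA; congr (_ * _)%E; rewrite muleCA.
Qed.

Let rate_lb z := locally_bounded_ray_rate reg z (lexx 0).

Lemma cum_lt_rho y v r : 0 <= v -> alive (speed y) v -> 0 <= r ->
  (cum (speed y) r < v) = (r < rho (speed y) v).
Proof.
move=> v0 av r0; have [h0 hv] := cum_rho (@sc y) (@sg y) v0 av.
by rewrite -{1}hv !ltNge (le_cumE (@sc y) (@sg y)).
Qed.

(** The parameters covered before time v are those below [rho], up to which [cum_discount]
    integrates the density of the next switch. *)
Lemma integral_switch_density y v : 0 <= v -> alive (speed y) v ->
  (\int[leb]_(r in `[0%R, +oo[) ((\1_[set r | cum (speed y) r < v] r)%:E *
    (rate 0 y r * expR (- cum (rate 0 y) r))%:E) = (1 - survival y v)%:E)%E.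
Proof.
move=> v0 av; have [h0 hv] := cum_rho (@sc y) (@sg y) v0 av.
have [mrate rate0 /(_ (rho (speed y) v))[C rateC]] := rate_lb y.
have mexp : measurable_fun setT (fun r => expR (- cum (rate 0 y) r)).
  by apply: measurableT_comp => //; apply: measurable_funN; exact: measurable_cum1.
rewrite /survival -(cum_discount (rate_lb y) h0).
rewrite /Rintegral fineK; last first.
  apply: integrable_fin_num => //.
  apply: (expR_cum_integrable (rate_lb y) _ _ (lexx 0) mrate (C := C)) => u u_itv.
  by rewrite ger0_norm// rateC.
rewrite -integral_itv_bndo_bndc; last first.
  by apply: measurable_funTS; apply/measurable_EFinP; exact: measurable_funM.
rewrite integral_mkcond [RHS]integral_mkcond; apply: eq_integral => r _.
rewrite !patchE !mem_setE !in_itv/= andbT indicE; case: (leP 0 r) => //= r0.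
rewrite -(cum_lt_rho v0 av r0); case: ltP => cr; first by rewrite mem_set// mul1e.
by rewrite memNset ?mul0e//= ltNge cr.
Qed.

Lemma switch_age n w : (T n.+1 w < +oo)%E ->
  0 < fine (T n.+1 w) - fine (T n w) /\
  alive (speed (Y n w)) (fine (T n.+1 w) - fine (T n w)).
Proof.
move=> T1; have T0 := switch_time_prev T1.
have TE0 := switch_time_fin T0; have TE1 := switch_time_fin T1.
have S0 : 0 < fine (T n.+1 w) - fine (T n w).
  by rewrite subr_gt0 -lte_fin -TE0 -TE1; exact: (suzz_time_incr Z_suzz).
split=> //.
apply/(lt_tstarE d_gt0 (C1_continuous (regular_s reg)) (regular_s_gt0 reg) (suzz_flow Z_suzz) _ (ltW S0)).
by rewrite EFinB -TE0 -TE1 lteBlDl ?(suzz_time_explosion Z_suzz)// TE0.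
Qed.

(* The two laws agree on the rectangles [A * ]-oo, v[] whose sections are alive at
   time [v], by the law of the next switching time and [cum_discount]. *)
Lemma switch_law z n (H : (\bar R * E) * R -> \bar R) :
  measurable_fun setT H -> (forall x, 0 <= H x)%E ->
  (\int[P z]_w (H ((T n w, Y n w), (fine (T n.+1 w) - fine (T n w))%R) *
      (\1_[set w | (T n.+1 w < +oo)%E] w)%:E) =
   \int[P z]_w ((\1_[set w | (T n w < +oo)%E] w)%:E *
      \int[leb]_(r in `[0%R, +oo[) (H ((T n w, Y n w), cum (speed (Y n w)) r) *
        (rate 0 (Y n w) r * expR (- cum (rate 0 (Y n w)) r))%:E)))%E.
Proof.
move=> mH H0.
pose X1 w : (\bar R * E) * R := ((T n w, Y n w), fine (T n.+1 w) - fine (T n w)).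
pose h1 w : R := \1_[set w | (T n.+1 w < +oo)%E] w.
pose X2 (p : Omega * R) : (\bar R * E) * R := ((T n p.1, Y n p.1), cum (speed (Y n p.1)) p.2).
pose k2 (p : Omega * R) : R := rate 0 (Y n p.1) p.2 * expR (- cum (rate 0 (Y n p.1)) p.2).
pose h2 (p : Omega * R) : R := \1_([set w | (T n w < +oo)%E] `*` `[0, +oo[%classic) p * k2 p.
have mTY : measurable_fun setT (fun w => (T n w, Y n w)).
  by apply: measurable_fun_pair; [exact: mT|exact: mY].
have mTfin k : measurable [set w | (T k w < +oo)%E].
  rewrite -[X in measurable X]setTI; exact: emeasurable_fun_infty_o.
have mYp : measurable_fun setT (fun p : Omega * R => (Y n p.1, p.2)).
  apply: measurable_fun_pair; last exact: measurable_snd.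
  exact: (measurableT_comp (mY n) measurable_fst).
have mX1 : measurable_fun setT X1.
  apply: measurable_fun_pair => //; apply: measurable_funB.
    by apply: measurableT_comp; [exact: fine_measurable|exact: mT].
  by apply: measurableT_comp; [exact: fine_measurable|exact: mT].
have mX2 : measurable_fun setT X2.
  apply: measurable_fun_pair; first exact: (measurableT_comp mTY measurable_fst).
  exact: (measurableT_comp (measurable_cum_speed reg) mYp).
have mh1 : measurable_fun setT h1 by exact: measurable_indic.
have mk2 : measurable_fun setT k2.
  apply: measurable_funM; first exact: (measurableT_comp (measurable_ray_rate reg 0) mYp).
  apply: measurableT_comp => //; apply: measurable_funN.
  exact: (measurableT_comp (measurable_cum_ray_rate reg (lexx 0)) mYp).
have mh2 : measurable_fun setT h2.
  by apply: measurable_funM => //; apply: measurable_indic; exact: measurableX.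
have k20 p : 0 <= k2 p by rewrite mulr_ge0 ?expR_ge0// (ray_rate_ge0 reg).
have h10 w : 0 <= h1 w by [].
have h20 p : 0 <= h2 p by rewrite mulr_ge0.
pose m2 : {measure set (Omega * measurableTypeR R)%type -> \bar R} := (P z \x leb)%E.
have integral2 (g : (\bar R * E) * R -> \bar R) : measurable_fun setT g -> (forall x, 0 <= g x)%E ->
    (\int[m2]_p (g (X2 p) * (h2 p)%:E) = \int[P z]_w ((\1_[set w | (T n w < +oo)%E] w)%:E *
      \int[leb]_(r in `[0%R, +oo[) (g (X2 (w, r)) * (k2 (w, r))%:E)))%E.
  move=> mg g0.
  have mgh : measurable_fun setT (fun p => g (X2 p) * (h2 p)%:E)%E.
    by apply: emeasurable_funM; [exact: measurableT_comp|exact/measurable_EFinP].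
  have gh0 p : (0 <= g (X2 p) * (h2 p)%:E)%E by rewrite mule_ge0// lee_fin.
  transitivity (\int[P z]_w \int[leb]_r (g (X2 (w, r)) * (h2 (w, r))%:E))%E.
    exact: (@fubini_tonelli1 _ _ _ _ R (P z) leb _ mgh gh0).
  apply: eq_integral => w _; rewrite /h2 (indicE _ [set w | (T n w < +oo)%E]); case: (boolP (w \in _)) => [/set_mem Tw|Tw]; last first.
    rewrite mul0e integral0_eq// => r _.
    rewrite indicE memNset ?mul0r ?mule0// => -[/= Tw' _].
    by move/negP: Tw; apply; apply/mem_set.
  rewrite mul1e [RHS]integral_mkcond; apply: eq_integral => r _.
  rewrite patchE indicE; case: ifPn => [/set_mem r0|r0].
    by rewrite mem_set ?mul1r//; split.
  rewrite memNset ?mul0r ?mule0// => -[_ /= r0'].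
  by move/negP: r0; apply; apply/mem_set.
pose n1 := image_law (P z) mX1 mh1 h10; pose n2 := image_law m2 mX2 mh2 h20.
have indic_law d0 (T0 : measurableType d0) (m : {measure set T0 -> \bar R})
    (X : T0 -> (\bar R * E) * R) (h : T0 -> R) (mX : measurable_fun setT X)
    (mh : measurable_fun setT h) (h0 : forall w, 0 <= h w) C : measurable C ->
    image_law m mX mh h0 C = (\int[m]_w ((\1_C (X w))%:E * (h w)%:E))%E.
  move=> mC; rewrite image_lawE integral_mkcond; apply: eq_integral => w _.
  by rewrite patchE indicE -[X w \in C]/(w \in X @^-1` C); case: ifPn => _; rewrite ?mul1e ?mul0e.
have switch_alive w := @switch_age n w.
have fin1 : (\int[P z]_w (h1 w)%:E <= 1)%E.
  by rewrite integral_indic// setIT probability_le1.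
pose a (v : R) : set (\bar R * E) := [set x | alive (speed x.2) v].
have n12 : forall C, measurable C -> n1 C = n2 C.
  apply: (region_unique (a := a)).
  - move=> v; have m1 : measurable_fun setT (fun x : \bar R * E => (x.2, v)).
      by apply: measurable_fun_pair.
    by have := m1 measurableT _ (measurable_alive reg); rewrite setTI.
  - by move=> v v' vv' x; exact: alive_le.
  - by move=> v x; exact: alive_lt.
  - by apply: le_lt_trans fin1 _; rewrite ltry.
  - rewrite image_lawE integral0_eq// => w /= na; rewrite /h1 indicE memNset// => T1.
    by apply: na; exact: (switch_alive w T1).2.
  - rewrite image_lawE integral0_eq// => -[w r] /= na; rewrite /h2 indicE memNset ?mul0r// => -[_ /=].
    rewrite in_itv/= andbT => r0; apply: na; exact: (alive_cum (@sc _) (@sg _) r0).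
  (* Ages are nonnegative under both laws, so that for v <= 0 both vanish on the rectangle. *)
  - move=> A v mA Aa; have [v0|v0] := leP v 0.
      rewrite !image_lawE !integral0_eq//.
        move=> [w r] /= [_ /=]; rewrite in_itv/= => cv; rewrite /h2 indicE memNset ?mul0r// => -[_ /=].
        rewrite in_itv/= andbT => r0; have := le_lt_trans (cum_ge0 r (fun u => ltW (sg _ u))) (lt_le_trans cv v0).
        by rewrite ltxx.
      move=> w /= [_ /=]; rewrite in_itv/= => cv; rewrite /h1 indicE memNset// => T1.
      by have := lt_trans (switch_alive w T1).1 (lt_le_trans cv v0); rewrite ltxx.
    pose C := A `*` `]-oo, v[%classic : set ((\bar R * E) * R).
    have mC : measurable C by exact: measurableX.
    have mA1 : measurable_fun setT (fun w => (\1_A (T n w, Y n w))%:E : \bar R).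
      apply/measurable_EFinP.
      exact: (measurableT_comp (f := \1_A : _ -> R) (measurable_indic mA) mTY).
    pose tot := (\int[P z]_w ((\1_A (T n w, Y n w))%:E * (\1_[set w | (T n w < +oo)%E] w)%:E))%E.
    (* The mass of the paths not yet switched at age v. Added to either measure of the rectangle it
       gives [tot], the mass of the paths in A with T n finite; being finite it cancels. *)
    pose S := (\int[P z]_w ((\1_A (T n w, Y n w))%:E * (\1_(unswitched n v) w)%:E))%E.
    have mU : measurable (unswitched n v).
      have m1 : measurable_fun setT (fun w : Omega => (w, v)) by exact: measurable_pair2.
      by have := m1 measurableT _ (measurable_unswitched n); rewrite setTI.
    have mRn : measurable (running n v).
      have m1 : measurable_fun setT (fun w : Omega => (w, v)) by exact: measurable_pair2.
      by have := m1 measurableT _ (measurable_running n); rewrite setTI.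
    have mU1 : measurable_fun setT (fun w => (\1_(unswitched n v) w)%:E : \bar R).
      by apply/measurable_EFinP; exact: measurable_indic.
    have Sfin : S \is a fin_num.
      rewrite ge0_fin_numE; last by apply: integral_ge0 => w _; rewrite mule_ge0// lee_fin.
      apply: (@le_lt_trans _ _ (\int[P z]_w (\1_(unswitched n v) w)%:E)%E).
        apply: ge0_le_integral => //.
        - exact: emeasurable_funM.
        - by move=> w _; rewrite -EFinM lee_fin ler_piMl// indicE lern1 leq_b1.
      by rewrite integral_indic// setIT (le_lt_trans (probability_le1 _ _))// ltry.
    have rectE x r : \1_C (x, r) = \1_A x * (r < v)%R%:R :> R.
      rewrite !indicE -natrM mulnb; congr (nat_of_bool _)%:R.
      apply/idP/andP => [/set_mem[/= xA]|[/set_mem xA rv]].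
        by rewrite in_itv/= => rv; split => //; exact/mem_set.
      by apply/mem_set; split => //=; rewrite in_itv.
    have K1 : (n1 C + S = tot)%E.
      rewrite /n1 (indic_law _ _ _ _ _ mX1 mh1 h10 C mC) /S /tot -ge0_integralD//.
      - apply: eq_integral => w _; rewrite rectE /h1 !indicE -!EFinM -EFinD -mulrA -mulrDr.
        have [xA|_] := boolP ((T n w, Y n w) \in A); last by rewrite !mul0r.
        rewrite !mul1r -natrM mulnb -natrD; congr (_%:R)%:E.
        have aw : alive (speed (Y n w)) v := Aa _ (set_mem xA).
        have [Tn|Tn] := boolP (w \in [set w | (T n w < +oo)%E]); last first.
          rewrite memNset ?andbF//; last first.
            by move=> /switch_time_prev Tn'; move/negP: Tn; apply; exact/mem_set.
          by rewrite memNset// => -[[Tn' _] _]; move/negP: Tn; apply; exact/mem_set.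
        have TE := switch_time_fin (set_mem Tn).
        have [vT|Tv] := leP (T n w + v%:E)%E (T n.+1 w).
          rewrite [X in (_ + nat_of_bool X)%N]mem_set//; last by split => //; split => //; exact: set_mem Tn.
          rewrite (_ : _ && _ = false)//; apply/negP => /andP[Sv /set_mem/switch_time_fin T1E].
          move: vT; rewrite TE T1E -EFinD lee_fin -lerBrDl leNgt.
          by rewrite Sv.
        have T1 : (T n.+1 w < +oo)%E by apply: lt_trans Tv _; rewrite TE -EFinD ltry.
        rewrite [X in (_ + nat_of_bool X)%N]memNset; last by move=> [_ /=]; rewrite leNgt Tv.
        rewrite mem_set// andbT ltrBlDl -lte_fin EFinD -TE -(switch_time_fin T1) Tv//.
      - by move=> w _; rewrite mule_ge0// lee_fin.
      - apply: emeasurable_funM; last exact/measurable_EFinP.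
        by apply/measurable_EFinP; exact: (measurableT_comp (f := \1_C : _ -> R) (measurable_indic mC) mX1).
      - exact: emeasurable_funM.
    have K2 : (n2 C + S = tot)%E.
      have mC1 : measurable_fun setT (fun x => (\1_C x)%:E : \bar R).
        by apply/measurable_EFinP; exact: measurable_indic.
      have -> : n2 C = (\int[m2]_w ((\1_C (X2 w))%:E * (h2 w)%:E))%E.
        exact: (@indic_law _ (Omega * measurableTypeR R)%type m2 X2 h2 mX2 mh2 h20 C mC).
      rewrite (integral2 (fun x => (\1_C x)%:E) mC1); last by move=> x; rewrite lee_fin.
      have -> : S = (\int[P z]_w ((\1_A (T n w, Y n w))%:E *
          (\1_(running n v) w * survival (Y n w) v)%:E))%E.
        apply: (time_law z n (g := fun x => (\1_A x)%:E) (ltW v0)).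
          by apply/measurable_EFinP; exact: measurable_indic.
        by move=> x; rewrite lee_fin.
      have surv0 y : 0 <= survival y v by exact: expR_ge0.
      have msurv : measurable_fun setT (fun w => survival (Y n w) v).
        have m1 : measurable_fun setT (fun w => (Y n w, v)) by apply: measurable_fun_pair.
        exact: (measurableT_comp measurable_survival m1).
      have mCk : measurable_fun setT (fun p => (\1_C (X2 p))%:E * (k2 p)%:E : \bar R)%E.
        by apply: emeasurable_funM; [exact: (measurableT_comp mC1 mX2)|exact/measurable_EFinP].
      have Ck0 p : (0 <= (\1_C (X2 p))%:E * (k2 p)%:E :> \bar R)%E by rewrite mule_ge0// lee_fin.
      rewrite /tot -ge0_integralD//.
      - apply: eq_integral => w _.
        have [xA|xA] := boolP ((T n w, Y n w) \in A); last first.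
          rewrite (indicE _ A) (negbTE xA) !mul0e adde0 integral0_eq ?mule0// => r _.
          by rewrite rectE indicE (negbTE xA) mul0r mul0e.
        have aw : alive (speed (Y n w)) v := Aa _ (set_mem xA).
        rewrite (indicE _ A) xA !mul1e.
        have -> : \1_(running n v) w = \1_[set w | (T n w < +oo)%E] w :> R.
          by rewrite !indicE; congr (nat_of_bool _)%:R; apply/idP/idP => /set_mem H'; apply/mem_set => //; case: H'.
        rewrite (_ : (\int[leb]_(r in _) _ = (1 - survival (Y n w) v)%:E)%E).
          by rewrite -EFinM -EFinD -mulrDr subrK mulr1.
        rewrite -(integral_switch_density (ltW v0) aw); apply: eq_integral => r _.
        rewrite rectE !indicE xA mul1r; congr ((nat_of_bool _)%:R%:E * _)%E.
        by apply/idP/idP => [cv|/set_mem//]; exact/mem_set.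
      - by move=> w _; rewrite mule_ge0// ?lee_fin//; apply: integral_ge0.
      - apply: emeasurable_funM; first by apply/measurable_EFinP; exact: measurable_indic.
        exact: (measurable_integral_half_line mCk Ck0).
      - by move=> w _; rewrite mule_ge0// lee_fin mulr_ge0.
      - apply: emeasurable_funM; first exact: mA1.
        by apply/measurable_EFinP; apply: measurable_funM; [exact: measurable_indic|exact: msurv].
    by rewrite -[LHS](addeK _ Sfin) -[RHS](addeK _ Sfin) K1 K2.
transitivity (\int[n1]_x H x)%E.
  by rewrite ge0_integral_image_law.
transitivity (\int[n2]_x H x)%E.
  by apply: eq_measure_integral => C mC _; exact: n12.
by rewrite ge0_integral_image_law// integral2.
Qed.

Notation lam := (suzz_rate U s gamma).

Definition flip_prob (j : 'I_d) (z : E) : R := lam j z / total_rate U s gamma z.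

Lemma flip_prob_ge0 j z : 0 <= flip_prob j z.
Proof. by rewrite divr_ge0 ?(suzz_rate_ge0 reg)// (total_rate_ge0 reg). Qed.

Lemma measurable_flip_prob j : measurable_fun setT (flip_prob j).
Proof.
apply: measurable_funM; first exact: (measurable_suzz_rate reg).
under eq_fun do rewrite -(powR_inv1 (total_rate_ge0 reg _)).
by apply: (measurableT_comp (measurable_powR _)); exact: (measurable_total_rate reg).
Qed.

(** True also where the total rate is 0: the quotient is then 0 by convention, and each rate, being
    nonnegative, is 0 too. *)
Lemma flip_prob_rate j z : flip_prob j z * total_rate U s gamma z = lam j z.
Proof.
rewrite /flip_prob; have [L0|L0] := eqVneq (total_rate U s gamma z) 0; last by rewrite divfK.
rewrite L0 mulr0; apply/esym/eqP; move/eqP: L0.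
rewrite psumr_eq0 => [/allP/(_ j)|i _]; last exact: (suzz_rate_ge0 reg).
by apply; rewrite mem_index_enum.
Qed.

Definition flipped n (j : 'I_d) :=
  [set w | (T n.+1 w < +oo)%E /\ (Y n.+1 w).2 = flip j (Y n w).2].

Let stamped n w : (\bar R * E) * \bar R := ((T n w, Y n w), T n.+1 w).

Let measurable_stamped n : measurable_fun setT (stamped n).
Proof. by apply: measurable_fun_pair; [apply: measurable_fun_pair; [exact: mT|exact: mY]|exact: mT]. Qed.

Lemma history_switch_stamped n C : measurable C -> history_switch T Y n (stamped n @^-1` C).
Proof.
move=> mC.
pose S := g_sigma_algebraType (history T Y n `|` preimage_set_system setT (T n.+1) measurable).
have mS : measurable_fun [set: S] (fun w : S => ((T n w, Y n w), T n.+1 w)).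
  apply: measurable_fun_pair => _ B mB; rewrite setTI; apply: sub_sigma_algebra.
    by left; exact: (@history_timed n _ mB).
  by right; exists B => //; rewrite setTI.
by have := mS measurableT C mC; rewrite setTI.
Qed.

Let mTfin k : measurable [set w | (T k w < +oo)%E].
Proof. by rewrite -[X in measurable X]setTI; exact: emeasurable_fun_infty_o. Qed.

Lemma measurable_flipped n j : measurable (flipped n j).
Proof.
rewrite (_ : flipped n j = [set w | (T n.+1 w < +oo)%E] `&`
    \bigcup_(th in [set: velocity d]) ((fun w => (Y n w).2) @^-1` [set th] `&`
      (fun w => (Y n.+1 w).2) @^-1` [set flip j th])).
  apply: measurableI => //; apply: fin_bigcup_measurable => // th _.
  have m2 k : measurable_fun setT (fun w => (Y k w).2) := measurableT_comp measurable_snd (mY k).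
  apply: measurableI.
    by have := m2 n measurableT [set th] I; rewrite setTI.
  by have := m2 n.+1 measurableT [set flip j th] I; rewrite setTI.
apply/seteqP; split => w /= [T1].
  by move=> Y1; split => //; exists (Y n w).2.
by move=> [th _ [/= Y1 Y2]]; split => //; rewrite Y1 Y2.
Qed.

(** The position at the switch with the velocity before it: the state at which the flip
    probabilities are evaluated. *)
Let switch_state n w : E := ((Y n.+1 w).1, (Y n w).2).

Lemma velocity_law z n j (g : (\bar R * E) * \bar R -> \bar R) :
  measurable_fun setT g -> (forall x, 0 <= g x)%E ->
  (\int[P z]_w (g ((T n w, Y n w), T n.+1 w) * (\1_(flipped n j) w)%:E) =
   \int[P z]_w (g ((T n w, Y n w), T n.+1 w) *
     (\1_[set w | (T n.+1 w < +oo)%E] w * flip_prob j (switch_state n w))%:E))%E.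
Proof.
move=> mg g0.
have ms : measurable_fun setT (switch_state n).
  apply: measurable_fun_pair; first exact: (measurableT_comp measurable_fst (mY n.+1)).
  exact: (measurableT_comp measurable_snd (mY n)).
have mp : measurable_fun setT (fun w => flip_prob j (switch_state n w)).
  exact: (measurableT_comp (measurable_flip_prob j) ms).
have mF := measurable_flipped n j.
apply: (@ge0_integral_image_eq _ _ _ _ _ _ _ (P z) (P z) (stamped n) (stamped n)) => //.
- by apply: measurable_funM => //; exact: measurable_indic.
- by move=> w; rewrite mulr_ge0// flip_prob_ge0.
move=> C mC; have mB : measurable (stamped n @^-1` C).
  by have := measurable_stamped n measurableT mC; rewrite setTI.
have := @suzz_velocity_law _ _ _ _ _ _ _ _ _ _ _ _ Z_suzz z n j _ (history_switch_stamped mC).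
set B := stamped n @^-1` C in mB *.
cbv zeta; rewrite -setIA => law.
transitivity (P z (B `&` flipped n j)).
  by rewrite setIC -integral_indic.
rewrite law integral_mkcondr.
apply: eq_integral => w _; rewrite patchE indicE; case: ifPn => wr.
  by rewrite mul1r.
by rewrite mul0r.
Qed.

Lemma flip_inj (th : velocity d) : injective (fun j => flip j th).
Proof.
move=> i j /= /ffunP/(_ i); rewrite !ffunE eqxx; case: eqP => // _.
by case: (th i).
Qed.

(** [velocity_law] averages over the flip and [switch_law] over the switching time. The density of
    the latter carries the total rate, whose product with the flip probabilities gives back the
    rates of [jump]. *)
Lemma expectation_switch z n a (f : E -> \bar R) : 0 <= a -> nn_measurable f ->
  (\int[P z]_w ((disc a (T n.+1 w))%:E * f (Y n.+1 w)) =
   \int[P z]_w ((disc a (T n w))%:E * flyjump U s gamma a f (Y n w)))%E.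
Proof.
move=> a0 nf; have [mf f0] := nf.
pose fj j (y : E) := f (y.1, flip j y.2).
have fj0 j y : (0 <= fj j y)%E by exact: f0.
have mfj j : measurable_fun setT (fj j) by exact: (measurableT_comp mf (@measurable_flipz R d j)).
pose jumpn (y : E) : \bar R := (\sum_(j < d) (flip_prob j y)%:E * fj j y)%E.
have mjumpn : measurable_fun setT jumpn.
  apply: emeasurable_sum => j; apply: emeasurable_funM => //.
  by apply/measurable_EFinP; exact: measurable_flip_prob.
have jumpn0 y : (0 <= jumpn y)%E.
  by apply: sume_ge0 => j _; rewrite mule_ge0// lee_fin flip_prob_ge0.
have jumpnE y : (jumpn y * (total_rate U s gamma y)%:E = jump U s gamma f y)%E.
  rewrite ge0_sume_distrl; last by move=> j _; rewrite mule_ge0// lee_fin flip_prob_ge0.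
  by apply: eq_bigr => j _; rewrite muleAC -EFinM flip_prob_rate.
pose g j (x : (\bar R * E) * \bar R) : \bar R :=
  ((disc a x.2)%:E * fj j (flow x.1.2 (fine x.2 - fine x.1.1)%R))%E.
have mg j : measurable_fun setT (g j).
  apply: emeasurable_funM.
    by apply/measurable_EFinP; exact: (measurableT_comp (measurable_disc a) measurable_snd).
  have m1 : measurable_fun setT (fun x : (\bar R * E) * \bar R => (x.1.2, fine x.2 - fine x.1.1)).
    apply: measurable_fun_pair; first exact: (measurableT_comp measurable_snd measurable_fst).
    apply: measurable_funB; first by apply: measurableT_comp; [exact: fine_measurable|exact: measurable_snd].
    apply: measurableT_comp; first exact: fine_measurable.
    exact: (measurableT_comp measurable_fst measurable_fst).
  exact: (measurableT_comp (mfj j) (measurableT_comp (measurable_flow_state reg) m1)).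
have g0 j x : (0 <= g j x)%E by rewrite mule_ge0// lee_fin disc_ge0.
have switchE w : (T n.+1 w < +oo)%E ->
    switch_state n w = flow (Y n w) (fine (T n.+1 w) - fine (T n w)).
  move=> T1; have [S0 Sa] := switch_age T1.
  rewrite -(flow_state_Phi (ltW S0) Sa).
  by rewrite -(suzz_switch_position Z_suzz T1).
have ms : measurable_fun setT (switch_state n).
  apply: measurable_fun_pair; first exact: (measurableT_comp measurable_fst (mY n.+1)).
  exact: (measurableT_comp measurable_snd (mY n)).
(* At a switch exactly one of these terms survives, since distinct j give distinct flips. *)
transitivity (\int[P z]_w \sum_(j < d) (g j ((T n w, Y n w), T n.+1 w) * (\1_(flipped n j) w)%:E))%E.
  apply: eq_integral => w _.
  have [T1|Toy] := ltP (T n.+1 w) +oo%E; last first.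
    rewrite /g /disc ltNge Toy/= mul0e big1// => j _.
    by rewrite mul0e mul0e.
  have [j0 vj] := suzz_switch_velocity Z_suzz T1.
  rewrite (bigD1 j0)//= big1 ?adde0; last first.
    move=> j jj0; rewrite indicE memNset ?mule0// => -[_]; rewrite vj => /flip_inj j0j.
    by rewrite j0j eqxx in jj0.
  rewrite indicE mem_set; last by split.
  rewrite mule1 /g/= /fj -(switchE _ T1) /=; congr (_ * f _)%E.
  by rewrite -vj; case: (Y n.+1 w).
rewrite ge0_integral_sum//; last 2 first.
- move=> j; apply: emeasurable_funM; first exact: (measurableT_comp (mg j) (measurable_stamped n)).
  by apply/measurable_EFinP; apply: measurable_indic; exact: measurable_flipped.
- by move=> j w _; rewrite mule_ge0// lee_fin.
under eq_bigr => j _ do rewrite (velocity_law z n j (mg j) (g0 j)).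
rewrite -ge0_integral_sum//; last 2 first.
- move=> j; apply: emeasurable_funM; first exact: (measurableT_comp (mg j) (measurable_stamped n)).
  apply/measurable_EFinP; apply: measurable_funM; first exact: measurable_indic.
  exact: (measurableT_comp (measurable_flip_prob j) ms).
- by move=> j w _; rewrite mule_ge0// lee_fin mulr_ge0// flip_prob_ge0.
(* The discount at the next switch is that at the n-th times the exponential of - a times the age,
   so that only the n-th switch and the age remain. *)
pose H (x : (\bar R * E) * R) : \bar R :=
  ((disc a x.1.1)%:E * ((expR (- (a * x.2)))%:E * jumpn (flow x.1.2 x.2)))%E.
have mH : measurable_fun setT H.
  apply: emeasurable_funM.
    apply/measurable_EFinP; apply: (measurableT_comp (measurable_disc a)).
    exact: (measurableT_comp measurable_fst measurable_fst).
  apply: emeasurable_funM.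
    apply/measurable_EFinP; apply: measurableT_comp => //; apply: measurable_funN.
    by apply: measurable_funM => //; exact: measurable_snd.
  have m1 : measurable_fun setT (fun x : (\bar R * E) * R => (x.1.2, x.2)).
    apply: measurable_fun_pair; last exact: measurable_snd.
    exact: (measurableT_comp measurable_snd measurable_fst).
  exact: (measurableT_comp mjumpn (measurableT_comp (measurable_flow_state reg) m1)).
have H0 x : (0 <= H x)%E by rewrite !mule_ge0// lee_fin ?disc_ge0// expR_ge0.
transitivity (\int[P z]_w (H ((T n w, Y n w), (fine (T n.+1 w) - fine (T n w))%R) *
      (\1_[set w | (T n.+1 w < +oo)%E] w)%:E))%E.
  apply: eq_integral => w _.
  have [T1|Toy] := ltP (T n.+1 w) +oo%E; last first.
    have nT : w \notin [set w | (T n.+1 w < +oo)%E] by rewrite notin_setE/= ltNge Toy.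
    rewrite indicE (negbTE nT) mule0 big1// => j _.
    by rewrite mul0r mule0.
  rewrite indicE mem_set// mule1 /H/= muleA -EFinM.
  have -> : disc a (T n w) * expR (- (a * (fine (T n.+1 w) - fine (T n w)))) = disc a (T n.+1 w).
    rewrite /disc T1 (switch_time_prev T1) -expRD; congr expR; ring.
  rewrite ge0_sume_distrr; last by move=> j _; rewrite mule_ge0// lee_fin flip_prob_ge0.
  by apply: eq_bigr => j _; rewrite mul1r (switchE _ T1) /g/= -muleA (muleC _ (fj _ _)).
rewrite (switch_law z n mH H0).
have nj := nn_jump reg nf.
apply: eq_integral => w _.
have [Tn|Toy] := ltP (T n w) +oo%E; last first.
  have nT : w \notin [set w | (T n w < +oo)%E] by rewrite notin_setE/= ltNge Toy.
  by rewrite indicE (negbTE nT) /disc ltNge Toy/= !mul0e.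
rewrite indicE mem_set// mul1e /flyjump /fly -ge0_integralZl//; last 3 first.
- apply: measurable_funTS.
  exact: (measurableT_comp (nn_ray_weight reg a0 nj) (measurable_pair1 (Y n w))).
- by move=> r _; rewrite mule_ge0//; [exact: nj.2|rewrite lee_fin (weight_ge0 reg)].
- by rewrite lee_fin disc_ge0.
apply: eq_integral => r; rewrite inE/= in_itv/= andbT => r0.
rewrite /H/= (flow_state_cum reg _ r0) -jumpnE /ray_weight (cum_rate_split reg _ a0 r0).
rewrite -!muleA; congr (_ * _)%E; rewrite muleCA; congr (_ * _)%E.
rewrite -!EFinM /ray_rate add0r opprD expRD; congr (_%:E).
rewrite /ray_speed; ring.
Qed.

Definition position n t w : E := flow (Y n w) (t - fine (T n w)).

Lemma switch_time_le w m n : (m <= n)%N -> (T m w <= T n w)%E.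
Proof.
move=> mn; rewrite -(subnKC mn); elim: (n - m)%N => [|k IH]; first by rewrite addn0.
rewrite addnS (le_trans IH)//; have [Tk|] := ltP (T (m + k) w) +oo%E.
  exact: ltW (suzz_time_incr Z_suzz Tk).
by rewrite leye_eq => /eqP Tk; rewrite Tk (suzz_time_stop Z_suzz Tk).
Qed.

Lemma staying_uniq t w m n : staying m t w -> staying n t w -> m = n.
Proof.
wlog mn : m n / (m <= n)%N => [H mt nt|].
  have [|/ltnW] := leqP m n => mn; first exact: H.
  by apply/esym; exact: H.
move=> [_ [tm _]] [nt _]; apply/eqP; rewrite eqn_leq mn/= leqNgt; apply/negP => nm.
by have := lt_le_trans tm (le_trans (switch_time_le w nm) nt); rewrite ltxx.
Qed.

Lemma switch_interval t w : 0 <= t ->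
  (exists n, (T n w <= t%:E)%E /\ (t%:E < T n.+1 w)%E) \/ forall n, (T n w <= t%:E)%E.
Proof.
move=> t0; have [H|H] := pselect (exists n, (t%:E < T n w)%E); last first.
  by right=> n; rewrite leNgt; apply/negP => tn; apply: H; exists n.
left; have [n tn nP] := ex_minnP H; case: n => [|n] in tn nP.
  by move: tn; rewrite (suzz_time0 Z_suzz) lte_fin ltNge t0.
exists n; split => //; rewrite leNgt; apply/negP => tn'.
by have := nP _ tn'; rewrite ltnn.
Qed.

Lemma switch_interval_alive t w n : (T n w <= t%:E)%E -> (T n.+1 w < +oo)%E ->
  (t%:E < T n.+1 w)%E -> staying n t w.
Proof.
move=> nt T1 tn; split => //; split => //.
have [_ aS] := switch_age T1.
apply: alive_le aS; rewrite lerD2r -lee_fin.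
by rewrite -(switch_time_fin T1) ltW.
Qed.

(** Read backwards: a path that has entered the graveyard never leaves it. This gives right
    continuity of the observables there. *)
Lemma staying_le t u w m : 0 <= t -> t <= u -> staying m u w -> exists n, staying n t w.
Proof.
move=> t0 tu [mu [um au]].
have [mt|tm] := leP (T m w) t%:E.
  exists m; split => //; split; first by apply: le_lt_trans um; rewrite lee_fin.
  by apply: alive_le au; rewrite lerD2r.
have [[n [nt tn]]|/(_ m)] := switch_interval w t0; last by rewrite leNgt tm.
exists n; apply: switch_interval_alive => //.
have nm : (n < m)%N.
  by rewrite ltnNge; apply/negP => /(switch_time_le w) mn; have := lt_le_trans tm (le_trans mn nt); rewrite ltxx.
by apply: le_lt_trans (switch_time_le w nm) (le_lt_trans mu _); rewrite ltry.
Qed.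

Lemma staying_age t w n : staying n t w ->
  T n w = (fine (T n w))%:E /\ 0 <= t - fine (T n w).
Proof.
move=> [nt [_ _]]; have TE : T n w = (fine (T n w))%:E.
  by apply: switch_time_fin; apply: le_lt_trans nt _; rewrite ltry.
by split => //; rewrite subr_ge0 -lee_fin -TE.
Qed.

Lemma staying_path t w n : staying n t w -> Z t w = Some (position n t w).
Proof.
move=> st; have [TE age0] := staying_age st; case: st => nt [tn at_].
rewrite (suzz_path Z_suzz nt tn).
  by rewrite (flow_state_Phi age0 at_).
rewrite TE -lteBlDl// -EFinB.
exact/(lt_tstarE d_gt0 (C1_continuous (regular_s reg)) (regular_s_gt0 reg) (suzz_flow Z_suzz) _ age0).
Qed.

Lemma not_staying_path t w : 0 <= t -> (forall n, ~ staying n t w) -> Z t w = None.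
Proof.
move=> t0 ns; have [[n [nt tn]]|Tt] := switch_interval w t0; last first.
  apply: (suzz_switch_explosion Z_suzz); apply: lime_le; last exact: nearW.
  apply: ereal_nondecreasing_is_cvgn => m n; exact: switch_time_le.
apply: (suzz_flow_explosion Z_suzz nt tn); rewrite leNgt; apply/negP => tx.
have TE : T n w = (fine (T n w))%:E.
  by apply: switch_time_fin; apply: le_lt_trans nt _; rewrite ltry.
have age0 : 0 <= t - fine (T n w) by rewrite subr_ge0 -lee_fin -TE.
apply: (ns n); split => //; split => //.
apply/(lt_tstarE d_gt0 (C1_continuous (regular_s reg)) (regular_s_gt0 reg) (suzz_flow Z_suzz) _ age0).
by rewrite EFinB -TE lteBlDl// TE.
Qed.

(** [expectation_switch] removes the last switch, which is the innermost [flyjump], hence [iterSr].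
    For n = 0 the path starts at time 0, almost surely at z. *)
Lemma switch_expectation z n a h : 0 <= a -> nn_measurable h ->
  (\int[P z]_w ((disc a (T n w))%:E * h (Y n w)) = iter n (flyjump U s gamma a) h z)%E.
Proof.
move=> a0; elim: n h => [|n IH] h nh; last first.
  by rewrite (expectation_switch z n a0 nh) IH ?iterSr//; exact: (nn_flyjump reg).
have [mh h0] := nh; rewrite /=.
have mz : measurable [set w | Y 0 w = z].
  have m1 : measurable [set z].
    rewrite (_ : [set z] = [set z.1] `*` [set z.2]); last first.
      apply/seteqP; split=> [y /= ->//|y /= [y1 y2]].
      by rewrite (surjective_pairing y) y1 y2 -surjective_pairing.
    apply: measurableX => //.
    rewrite (_ : [set z.1] = \bigcap_(i in [set: 'I_d]) ((fun x : 'rV[R]_d => x 0 i) @^-1` [set z.1 0 i])).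
      apply: fin_bigcap_measurable => // i _.
      by have := @measurable_coor R d i measurableT _ (measurable_set1 (z.1 0 i)); rewrite setTI.
    apply/seteqP; split=> [x /= -> //|x /= xz].
    by apply/rowP => i; exact: xz.
  by have := mY 0 measurableT m1; rewrite setTI.
transitivity (\int[P z]_w (cst (h z) w))%E; last by rewrite integral_cst//= probability_setT mule1.
apply: ge0_ae_eq_integral => //.
- apply: emeasurable_funM; last exact: (measurableT_comp mh (mY 0)).
  by apply/measurable_EFinP; exact: (measurableT_comp (measurable_disc a) (mT 0)).
- by move=> w _; rewrite mule_ge0// lee_fin disc_ge0.
- by move=> w _; exact: h0.
exists (~` [set w | Y 0 w = z]); split; first exact: measurableC.
  by apply: (etrans (probability_setC (P z) mz)); rewrite (suzz_start Z_suzz) subee.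
move=> w; apply: contra_not => Yz _; rewrite /=.
by rewrite (suzz_time0 Z_suzz) /disc ltry/= mulr0 oppr0 expR0 mul1e Yz.
Qed.

Section fixed.
Variable f : E -> R.
Hypothesis mf : measurable_fun setT f.
Hypothesis f01 : forall y, 0 <= f y <= 1.

Let nf : nn_measurable (EFin \o f).
Proof. by split; [exact/measurable_EFinP|move=> y; rewrite lee_fin; case/andP: (f01 y)]. Qed.

(** This is f (Z t), with 0 at the graveyard: at most one term is nonzero. As a series over episodes
    it is jointly measurable in time and path, from the measurability of T and Y. *)
Definition obs (t : R) (w : Omega) : \bar R :=
  (\sum_(n <oo) (\1_(staying n t) w)%:E * (f (position n t w))%:E)%E.

Let term_ge0 n t w : (0 <= (\1_(staying n t) w)%:E * (f (position n t w))%:E)%E.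
Proof. by rewrite mule_ge0// lee_fin; case/andP: (f01 (position n t w)). Qed.

Lemma obs_staying n t w : staying n t w -> obs t w = (f (position n t w))%:E.
Proof.
move=> st; rewrite /obs (nneseriesD1 (n := n))//.
rewrite indicE mem_set// mul1e eseries0 ?adde0// => k _ /= kn.
rewrite indicE memNset ?mul0e// => sk.
by rewrite (staying_uniq sk st) eqxx in kn.
Qed.

Lemma obs_not_staying t w : (forall n, ~ staying n t w) -> obs t w = 0%E.
Proof.
by move=> ns; rewrite /obs eseries0// => k _ _; rewrite indicE memNset ?mul0e//; exact: ns.
Qed.

Lemma obs01 t w : (0 <= obs t w <= 1)%E.
Proof.
have [[n st]|ns] := pselect (exists n, staying n t w).
  by rewrite (obs_staying st) !lee_fin f01.
by rewrite obs_not_staying ?lexx ?lee01// => n st; apply: ns; exists n.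
Qed.

Lemma measurable_obs2 : measurable_fun setT (fun p : Omega * R => obs p.2 p.1).
Proof.
apply: (ge0_emeasurable_sum (P := xpredT)
  (h := fun n (p : Omega * R) => (\1_(staying n p.2) p.1)%:E * (f (position n p.2 p.1))%:E)%E) => //.
move=> n _; have := measurable_occupation n 0 nf.
apply: eq_measurable_fun => p _.
by rewrite /occupation mul0r oppr0 expR0 mul1e.
Qed.

Lemma measurable_obs t : measurable_fun setT (obs t).
Proof. exact: (measurableT_comp measurable_obs2 (measurable_pair2 t)). Qed.

(** The time axis splits into episodes, and the n-th one contributes [resolvent_term a n]:
    [expectation_occupation] inside the episode, then [switch_expectation] back to the start. *)
Lemma laplace_obs z (a : R) : 0 <= a ->
  (\int[leb]_(t in `[0%R, +oo[) ((expR (- (a * t)))%:E * \int[P z]_w obs t w) =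
   resolvent U s gamma a (EFin \o f) z)%E.
Proof.
move=> a0.
pose F (p : Omega * R) : \bar R := ((expR (- (a * p.2)))%:E * obs p.2 p.1)%E.
have mF : measurable_fun setT F.
  apply: emeasurable_funM; last exact: measurable_obs2.
  apply/measurable_EFinP; apply: measurableT_comp => //; apply: measurable_funN.
  by apply: measurable_funM => //; exact: measurable_snd.
have F0 p : (0 <= F p)%E.
  by rewrite mule_ge0 ?lee_fin ?expR_ge0//; case/andP: (obs01 p.2 p.1).
transitivity (\int[leb]_(t in `[0%R, +oo[) \int[P z]_w F (w, t))%E.
  apply: eq_integral => t _; rewrite -ge0_integralZl_EFin ?expR_ge0//.
    by move=> w _; case/andP: (obs01 t w).
  exact: measurable_obs.
rewrite -(tonelli_half_line (P z) mF F0).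
have occ0 n p := @occupation_ge0 n a _ p nf.
have mocc n := measurable_occupation n a nf.
transitivity (\int[P z]_w \int[leb]_(t in `[0%R, +oo[)
    \sum_(n <oo) occupation n a (EFin \o f) (w, t))%E.
  apply: eq_integral => w _; apply: eq_integral => t _.
  rewrite /F /obs -nneseriesZl//; apply: eq_eseriesr => n _.
  by rewrite /occupation/= muleCA.
transitivity (\int[P z]_w \sum_(n <oo) \int[leb]_(t in `[0%R, +oo[)
    occupation n a (EFin \o f) (w, t))%E.
  apply: eq_integral => w _; rewrite integral_nneseries// => n.
  apply: measurable_funTS; exact: (measurableT_comp (mocc n) (measurable_pair1 w)).
rewrite integral_nneseries//; last 2 first.
- by move=> n; exact: measurable_integral_half_line.
- by move=> n w _; apply: integral_ge0.
apply: eq_eseriesr => n _.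
rewrite (expectation_occupation z n a0 nf).
by rewrite (switch_expectation z n a0 (nn_fly reg a0 nf)).
Qed.

Hypothesis cf : forall th, continuous (fun x => f (x, th)).

(** A path in an episode remains in it for a while, following the flow, along which f is continuous;
    a path in no episode is dead and stays so by [staying_le]. *)
Lemma obs_right_continuous t w : 0 <= t -> fine (obs u w) @[u --> t^'+] --> fine (obs t w).
Proof.
move=> t0; have [[n st]|ns] := pselect (exists n, staying n t w); last first.
  rewrite obs_not_staying; last by move=> n st; apply: ns; exists n.
  apply: cvg_near_cst; near=> u.
  rewrite obs_not_staying// => n su; apply: ns.
  by apply: (staying_le t0 _ su); apply: ltW; near: u; exact: nbhs_right_gt.
have [TE age0] := staying_age st; rewrite (obs_staying st)/=.
have [nt [tn at_]] := st.
have st_near : \forall u \near t^'+, staying n u w.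
  have [q qt aq] := alive_lt at_.
  have u_lt : \forall u \near t^'+, (u%:E < T n.+1 w)%E.
    have [Toy|T1] := leP +oo%E (T n.+1 w).
      by apply: nearW => u; apply: lt_le_trans Toy; rewrite ltry.
    move: tn; rewrite (switch_time_fin T1) lte_fin => tn.
    by near=> u; rewrite lte_fin; near: u; exact: nbhs_right_lt.
  near=> u.
  have tu : t <= u by apply: ltW; near: u; exact: nbhs_right_gt.
  split; first by apply: le_trans nt _; rewrite lee_fin.
  split; first by near: u.
  apply: alive_le aq; rewrite lerBlDr ltW//.
  by near: u; apply: nbhs_right_lt; rewrite -ltrBlDr.
have cray : f (position n u w) @[u --> t^'+] --> f (position n t w).
  pose h (r : R) := f ((ray (Y n w) r).1, (Y n w).2).
  have ch : continuous h.
    move=> r; apply: (@continuous_comp _ _ _ (fun r => (ray (Y n w) r).1) (fun x => f (x, (Y n w).2)) r).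
      exact: continuous_ray.
    exact: cf.
  apply: (@cvg_comp _ _ _ (fun u => rho (speed (Y n w)) (u - fine (T n w))) h _
    (nbhs (rho (speed (Y n w)) (t - fine (T n w)))) _ _ (ch _)).
  apply: (@cvg_comp _ _ _ (fun u => u - fine (T n w)) (rho (speed (Y n w))) _
    ((t - fine (T n w))^'+) _ _ (rho_right_continuous reg age0 at_)).
  move=> A; rewrite /at_right/within/= => /nbhs_ballP[e e0 eA].
  apply/nbhs_ballP; exists e => // u; rewrite /ball/= => tu ltu; apply: eA.
    by rewrite /ball/= (_ : _ - _ = t - u)//; ring.
  by rewrite ltrD2r.
apply: cvg_trans cray; apply: near_eq_cvg; near=> u.
have su : staying n u w by near: u.
by rewrite (obs_staying su).
Unshelve. all: by end_near. Qed.

(* [transition t z] is the expectation of [f (Z t)], with [f = 0] at the graveyard. *)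
Definition transition (t : R) (z : E) : R := fine (\int[P z]_w obs t w).

Let integral_obs01 t z : (0 <= \int[P z]_w obs t w <= 1)%E.
Proof.
apply/andP; split; first by apply: integral_ge0 => w _; case/andP: (obs01 t w).
apply: (@le_trans _ _ (\int[P z]_w cst 1 w)%E); last first.
  by rewrite integral_cst//= probability_setT mule1.
apply: ge0_le_integral => //.
- by move=> w _; case/andP: (obs01 t w).
- exact: measurable_obs.
- by move=> w _; case/andP: (obs01 t w).
Qed.

Lemma transitionE t z : (transition t z)%:E = (\int[P z]_w obs t w)%E.
Proof.
rewrite /transition fineK//; have /andP[h0 h1] := integral_obs01 t z.
by rewrite ge0_fin_numE// (le_lt_trans h1)// ltry.
Qed.

Lemma transition01 t z : 0 <= transition t z <= 1.
Proof. by rewrite -!lee_fin transitionE integral_obs01. Qed.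

Lemma measurable_transition_time z : measurable_fun setT (transition ^~ z).
Proof.
apply: measurableT_comp => //.
apply: (@measurable_fun_fubini_tonelli_G _ _ _ _ _ (P z) (fun p : Omega * R => obs p.2 p.1)).
  exact: measurable_obs2.
by move=> p; case/andP: (obs01 p.2 p.1).
Qed.

Lemma transition_right_continuous t z : 0 <= t ->
  transition u z @[u --> t^'+] --> transition t z.
Proof.
move=> t0; apply/cvg_at_rightP => u u_t.
have mobs v : measurable_fun setT (obs v) := measurable_obs v.
have obsK v w : (fine (obs v w))%:E = obs v w.
  by rewrite fineK//; have /andP[h0 h1] := obs01 v w; rewrite ge0_fin_numE// (le_lt_trans h1)// ltry.
have [] := @dominated_convergence _ _ _ (P z) setT measurableT (fun n => obs (u n)) (obs t) (cst 1%E).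
- by move=> n; exact: mobs.
- exact: mobs.
- apply: aeW => w _.
  have /cvg_at_rightP/(_ u u_t) h := @obs_right_continuous t w t0.
  rewrite -(obsK t w); apply: cvg_EFin; last exact: h.
  by apply: nearW => n; rewrite -obsK.
- apply/integrableP; split => //; rewrite (_ : (fun _ => _) = cst 1%E).
    by rewrite integral_cst//= probability_setT mule1 ltry.
  by apply/funext => w /=; rewrite normr1.
- by apply: aeW => w n _; have /andP[h0 h1] := obs01 (u n) w; rewrite gee0_abs.
move=> _ _ h; apply: fine_cvg; rewrite transitionE; exact: h.
Qed.

End fixed.

Hypothesis U_int : (\int[lebesgue_rV R d]_x (expR (- U x))%:E < +oo)%E.
Hypothesis flux : (eucl_norm x ^+ d.-1 * s x * expR (- U x)) @[x --> eucl_infty]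
  --> (0 : R).
Notation mu := (target_measure (regular_U reg)).

Let mu_fin : (mu setT < +oo)%E := target_measure_fin reg U_int.

Lemma target_integrable (h : E -> R) C : measurable_fun setT h ->
  (forall z, `|h z| <= C) -> mu.-integrable setT (EFin \o h).
Proof.
move=> mh hC; apply: measurable_bounded_integrable => //.
by exists C; split; [exact: num_real|move=> M CM z _; exact: le_trans (hC z) (ltW CM)].
Qed.

Let cvg_norm_le (u : nat -> R) l C : (forall n, `|u n| <= C) -> u n @[n --> \oo] --> l -> `|l| <= C.
Proof.
move=> uC ul; have nl : `|u n| @[n --> \oo] --> `|l| by exact: cvg_norm.
rewrite -(cvg_lim (@Rhausdorff R) nl).
by apply: limr_le; [exact: cvgP nl|exact: nearW].
Qed.

Lemma target_cvg (f : nat -> E -> R) (g : E -> R) C :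
  (forall n, measurable_fun setT (f n)) -> measurable_fun setT g ->
  (forall n z, `|f n z| <= C) -> (forall z, f n z @[n --> \oo] --> g z) ->
  \int[mu]_z f n z @[n --> \oo] --> \int[mu]_z g z.
Proof.
move=> mf mg fC fg.
have gC z : `|g z| <= C by exact: cvg_norm_le (fun n => fC n z) (fg z).
have [] := @dominated_convergence _ _ _ mu setT measurableT (fun n => EFin \o f n) (EFin \o g) (cst C%:E).
- by move=> n; exact/measurable_EFinP.
- exact/measurable_EFinP.
- by apply: aeW => z _; apply: cvg_EFin; [exact: nearW|exact: fg].
- have C0 : 0 <= C by apply: le_trans (gC point).
  by apply: (target_integrable (h := cst C) (C := C)) => // z; rewrite /= ger0_norm.
- by apply: aeW => z n _; rewrite /= lee_fin.
move=> _ _ h; apply: fine_cvg; rewrite fineK; first exact: h.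
exact: (integrable_fin_num _ (target_integrable mg gC)).
Qed.

(* Both the measurability in the starting point and the invariance are carried by
   Laplace inversion: a point [None] is added to the state space, at which functions
   are required to take the value of their integral. *)
Lemma transition_invariant (f : E -> R) t : measurable_fun setT f ->
  (forall y, 0 <= f y <= 1) -> (forall th, continuous (fun x => f (x, th))) -> 0 <= t ->
  measurable_fun setT (transition f t) /\
  \int[mu]_z transition f t z = \int[mu]_z f z.
Proof.
move=> mf f01 cf t0; pose m := \int[mu]_z f z.
(* At the added point phi is constant in time, equal to the target integral of f; [V] at phi t then
   states both conclusions at once. Its boundedness clause makes the integrals additive. *)
pose phi (o : option E) (u : R) := if o is Some z then transition f u z else m.
pose V (h : option E -> R) := [/\ measurable_fun setT (fun z => h (Some z)),
  exists C, forall z, `|h (Some z)| <= C & \int[mu]_z h (Some z) = h None].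
have tr01 u z : 0 <= transition f u z <= 1 by exact: (transition01 mf f01).
have trE := transitionE mf f01.
suff [mtr _ trm] : V (phi ^~ t) by split.
apply: (@laplace_inversion R (option E) V phi (1 + `|m|) _ _ _ _ _ _ _ t t0).
- move=> h1 h2 [mh1 [C1 hC1] I1] [mh2 [C2 hC2] I2]; split.
  + exact: measurable_funD.
  + by exists (C1 + C2) => z; rewrite (le_trans (ler_normD _ _))// lerD.
  + by rewrite RintegralD ?I1 ?I2//; [exact: target_integrable hC1|exact: target_integrable hC2].
- move=> k h [mh [C hC] I]; split.
  + exact: measurable_funM.
  + by exists (`|k| * C) => z; rewrite normrM ler_wpM2l.
  + by rewrite RintegralZl ?I//; exact: target_integrable hC.
- move=> h g C Vh hC hg.
  have mg : measurable_fun setT (fun z => g (Some z)).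
    apply: (@measurable_fun_cvg _ _ _ setT (fun n z => h n (Some z))) => [n|z _].
      by case: (Vh n).
    exact: hg.
  split => //.
  + by exists C => z; exact: cvg_norm_le (fun n => hC n (Some z)) (hg (Some z)).
  + have mh n : measurable_fun setT (fun z => h n (Some z)) by case: (Vh n).
    have := target_cvg mh mg (fun n z => hC n (Some z)) (fun z => hg (Some z)).
    rewrite (_ : (fun n => _) = (fun n => h n None)); last first.
      by apply/funext => n; case: (Vh n).
    move=> hI; apply: (cvg_unique _ hI) => //; exact: hg.
- by case=> [z|]; [exact: (measurable_transition_time mf f01)|exact: measurable_cst].
- case=> [z|] u /=; last by rewrite lerDr.
  by have /andP[h0 h1] := tr01 u z; rewrite ger0_norm// (le_trans h1)// lerDl.
- by rewrite addr_ge0.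
- move=> a a0; have a0' := ltW a0.
  pose S z := resolvent U s gamma a (EFin \o f) z.
  have nS : nn_measurable S.
    apply: (nn_resolvent reg a0'); split; first exact/measurable_EFinP.
    by move=> z; rewrite lee_fin; case/andP: (f01 z).
  have mexp : measurable_fun setT (fun u : R => expR (- (a * u))).
    by apply: measurableT_comp => //; apply: measurable_funN; apply: measurable_funM.
  have SE z : S z = (\int[leb]_(u in `[0%R, +oo[) (expR (- (a * u)) * transition f u z)%:E)%E.
    rewrite /S -(laplace_obs mf f01 z a0').
    by apply: eq_integral => u _; rewrite -trE EFinM.
  have S_le z : (S z <= (a^-1)%:E)%E.
    rewrite SE -(integral_exp_half_line a0); apply: ge0_le_integral => //.
    - by move=> u _; rewrite lee_fin mulr_ge0 ?expR_ge0//; case/andP: (tr01 u z).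
    - apply: measurable_funTS; apply/measurable_EFinP; apply: measurable_funM => //.
      exact: (measurable_transition_time mf f01).
    - by apply: measurable_funTS; apply/measurable_EFinP.
    - by move=> u _; rewrite lee_fin ler_piMr ?expR_ge0//; case/andP: (tr01 u z).
  have SK z : (fine (S z))%:E = S z.
    by rewrite fineK// ge0_fin_numE ?(le_lt_trans (S_le z)) ?ltry//; exact: nS.2.
  have intf : (\int[mu]_z (f z)%:E = m%:E)%E.
    rewrite /m /Rintegral fineK//; apply: (integrable_fin_num _ (target_integrable (C := 1) mf _)) => // z.
    by have /andP[h0 h1] := f01 z; rewrite ger0_norm.
  have hS z : \int[leb]_(u in `[0, +oo[) (expR (- (a * u)) * phi (Some z) u) = fine (S z).
    by rewrite SE.
  split.
  + under eq_fun do rewrite hS.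
    by apply: measurableT_comp => //; case: nS.
  + exists a^-1 => z; rewrite hS ger0_norm; last by apply: fine_ge0; exact: nS.2.
    by rewrite -lee_fin SK.
  + transitivity (\int[mu]_z fine (S z)); first by apply: eq_Rintegral => z _; exact: hS.
    rewrite /Rintegral; under eq_integral do rewrite SK.
    (* The resolvent has integral m / a, which is also the transform at a of the constant m: this is
       membership in [V]. *)
    have := resolvent_invariant d_gt0 reg U_int flux a0 mf f01; rewrite intf -/S => aS.
    have -> : (\int[mu]_z S z = (a^-1 * m)%:E)%E.
      by rewrite EFinM -aS muleA -EFinM mulVf ?gt_eqF// mul1e.
    transitivity (m * \int[leb]_(u in `[0, +oo[) expR (- (a * u))).
      by rewrite /Rintegral integral_exp_half_line// mulrC.
    rewrite -RintegralZl//; last exact: integrable_exp.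
    by apply: eq_Rintegral => u _; rewrite mulrC.
- case=> [z|]; last exact: cvg_cst.
  exact: (transition_right_continuous mf f01 cf).
Qed.

(** * From continuous functions to Borel sets *)

Definition orthant (b : 'I_d -> R) (Th : set (velocity d)) : set E :=
  [set y : E | (forall i, y.1 0 i <= b i) /\ Th y.2].

(** A generating pi-system whose indicators are limits of functions continuous in the position. *)
Let orthants := [set C | exists b Th, C = orthant b Th].

Lemma measurable_orthants : @measurable _ E = <<s orthants >>.
Proof.
have exhaust (y : E) : exists n : nat, forall i, y.1 0 i <= n%:R.
  exists (Num.bound `|y.1|) => i; apply: (le_trans (ler_norm _)).
  by rewrite (le_trans (normr_coor_le _ _))// ltW// archi_boundP.
apply/seteqP; split; last first.
  apply: smallest_sub; first exact: sigma_algebra_measurable.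
  move=> _ [b [Th ->]].
  rewrite (_ : orthant b Th = (\bigcap_(i in [set: 'I_d]) ((fun x : 'rV[R]_d => x 0 i) @^-1` `]-oo, b i]))
      `*` Th).
    apply: measurableX => //; apply: fin_bigcap_measurable => // i _.
    by have := @measurable_coor R d i measurableT _ (measurable_itv `]-oo, b i]); rewrite setTI.
  apply/seteqP; split=> y /= [yb yT]; split => // i; first by move=> _ /=; rewrite in_itv/=.
  by have := yb i I; rewrite /= in_itv/=.
pose S := g_sigma_algebraType orthants.
suff : measurable_fun [set: S] (fun y : S => (y.1, y.2) : E).
  move=> mid C mC; have := mid measurableT C mC.
  by rewrite setTI (_ : _ @^-1` C = C)//; apply/seteqP; split=> -[].
apply: measurable_fun_pair.
  apply: measurable_fun_rVP => i.
  apply: (measurability _ (RGenOInfty.measurableE R)) => _ [_ [v ->] <-].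
  rewrite setTI.
  rewrite (_ : _ @^-1` _ = ~` \bigcup_n orthant (fun j => if j == i then v else n%:R) setT).
    apply: (@measurableC _ S); apply: (@bigcupT_measurable _ S) => n.
    by apply: sub_sigma_algebra; exists (fun j => if j == i then v else n%:R), setT.
  apply/seteqP; split=> y /=; rewrite in_itv/= andbT.
    by move=> vy [n _ [/(_ i)]]; rewrite eqxx leNgt vy.
  move=> ny; rewrite ltNge; apply/negP => yv; apply: ny.
  have [n yn] := exhaust y; exists n => //; split => // j.
  by case: eqP => [->|_].
move=> _ Th _; rewrite setTI.
rewrite (_ : _ @^-1` Th = \bigcup_n orthant (fun=> n%:R) Th).
  apply: (@bigcupT_measurable _ S) => n.
  by apply: sub_sigma_algebra; exists (fun=> n%:R), Th.
apply/seteqP; split=> y /=; last by move=> [n _ []].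
by move=> yT; have [n yn] := exhaust y; exists n.
Qed.

Lemma setI_closed_orthants : setI_closed orthants.
Proof.
move=> _ _ [b [Th ->]] [b' [Th' ->]].
exists (fun i => Num.min (b i) (b' i)), (Th `&` Th'); apply/seteqP; split=> y /=.
  by move=> [[yb yT] [yb' yT']]; split => // i; rewrite le_min yb yb'.
move=> [yb [yT yT']]; split; split => // i; have := yb i; rewrite le_min => /andP[]//.
Qed.

Section fixed_time.
Variable t : R.
Hypothesis t0 : 0 <= t.

Definition visits (B : set E) := [set w | exists2 y, B y & Z t w = Some y].

Lemma visitsE B : visits B = \bigcup_n [set w | staying n t w /\ B (position n t w)].
Proof.
apply/seteqP; split=> w.
  move=> [y By Zy]; have [[n st]|ns] := pselect (exists n, staying n t w).
    exists n => //; split => //; move: Zy.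
    by rewrite (staying_path st) => -[->].
  move: Zy; rewrite (not_staying_path t0)// => n st.
  by apply: ns; exists n.
move=> [n _ /= [st Bp]]; exists (position n t w) => //.
exact: (staying_path st).
Qed.

Lemma measurable_visits B : measurable B -> measurable (visits B).
Proof.
move=> mB; rewrite visitsE; apply: bigcupT_measurable => n.
have m1 : measurable_fun setT (fun w => (Y n w, t - fine (T n w))).
  apply: measurable_fun_pair => //; apply: measurable_funB => //.
  by apply: measurableT_comp => //; exact: fine_measurable.
have m2 := measurableT_comp (measurable_flow_state reg) m1.
rewrite (_ : [set w | _] = [set w | staying n t w] `&` position n t @^-1` B)//.
apply: measurableI.
  have m3 : measurable_fun setT (fun w : Omega => (w, t)) by exact: measurable_pair2.
  by have := m3 measurableT _ (measurable_staying n); rewrite setTI.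
by have := m2 measurableT _ mB; rewrite setTI.
Qed.

Definition visit_prob (B : set E) (z : E) : R := fine (P z (visits B)).

Lemma visit_prob01 B z : measurable B -> 0 <= visit_prob B z <= 1.
Proof.
move=> mB; have mv := measurable_visits mB.
rewrite /visit_prob fine_ge0//= -lee_fin fineK ?probability_le1//.
by rewrite ge0_fin_numE// (le_lt_trans (probability_le1 _ mv))// ltry.
Qed.

Lemma visit_probE B z : measurable B -> (visit_prob B z)%:E = P z (visits B).
Proof.
move=> mB; rewrite fineK// ge0_fin_numE//.
by rewrite (le_lt_trans (probability_le1 _ (measurable_visits mB)))// ltry.
Qed.

Lemma integral_visit_prob B z : measurable B ->
  (\int[P z]_w (\1_(visits B) w)%:E = (visit_prob B z)%:E)%E.
Proof.
by move=> mB; rewrite integral_indic ?setIT ?visit_probE//; exact: measurable_visits.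
Qed.

Lemma transition_cvg (f : nat -> E -> R) B z : measurable B ->
  (forall n, measurable_fun setT (f n)) -> (forall n y, 0 <= f n y <= 1) ->
  (forall y, f n y @[n --> \oo] --> (\1_B y : R)) ->
  transition (f n) t z @[n --> \oo] --> visit_prob B z.
Proof.
move=> mB mf f01 fB.
have mv := measurable_visits mB.
have obsK n w : (fine (obs (f n) t w))%:E = obs (f n) t w.
  rewrite fineK//; have /andP[h0 h1] := obs01 (f01 n) t w.
  by rewrite ge0_fin_numE// (le_lt_trans h1)// ltry.
have [] := @dominated_convergence _ _ _ (P z) setT measurableT
  (fun n => obs (f n) t) (fun w => (\1_(visits B) w)%:E) (cst 1%E).
- by move=> n; exact: (measurable_obs (mf n) (f01 n)).
- by apply/measurable_EFinP; exact: measurable_indic.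
- apply: aeW => w _.
  have [[n st]|ns] := pselect (exists n, staying n t w).
    have -> : \1_(visits B) w = \1_B (position n t w) :> R.
      rewrite !indicE; congr (nat_of_bool _)%:R; apply/idP/idP => /set_mem; last first.
        move=> Bp; apply/mem_set; exists (position n t w) => //.
        exact: (staying_path st).
      by move=> [y By]; rewrite (staying_path st) => -[yE]; apply/mem_set; rewrite yE.
    under eq_cvg do rewrite (obs_staying (f01 _) st).
    by apply: cvg_EFin; [exact: nearW|exact: fB].
  have ns' n : ~ staying n t w by move=> st; apply: ns; exists n.
  have -> : \1_(visits B) w = 0 :> R.
    by rewrite indicE memNset// => -[y _]; rewrite (not_staying_path t0 ns').
  by apply: cvg_near_cst; apply: nearW => n; exact: obs_not_staying.
- apply/integrableP; split => //; rewrite (_ : (fun _ => _) = cst 1%E).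
    by rewrite integral_cst//= probability_setT mule1 ltry.
  by apply/funext => w /=; rewrite normr1.
- by apply: aeW => w n _; have /andP[h0 h1] := obs01 (f01 n) t w; rewrite gee0_abs.
move=> _ _; rewrite integral_visit_prob// => h.
exact: fine_cvg h.
Qed.

Let conserved (B : set E) :=
  measurable_fun setT (visit_prob B) /\ \int[mu]_z visit_prob B z = fine (mu B).

(** By dominated convergence, bounded pointwise limits pass through the expectation and through the
    target integral, which carries [transition_invariant] over to the indicator of B. *)
Let conserved_limit (f : nat -> E -> R) B : measurable B ->
  (forall n th, continuous (fun x => f n (x, th))) -> (forall n y, 0 <= f n y <= 1) ->
  (forall y, f n y @[n --> \oo] --> (\1_B y : R)) -> conserved B.
Proof.
move=> mB cf f01 fB.
have mf n : measurable_fun setT (f n).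
  by apply: measurable_fun_velocity => th; apply: continuous_measurable_rV; exact: cf.
have f1 n y : `|f n y| <= 1 by have /andP[h0 h1] := f01 n y; rewrite ger0_norm.
have inv n := transition_invariant (mf n) (f01 n) (cf n) t0.
have tr1 n z : `|transition (f n) t z| <= 1.
  by have /andP[h0 h1] := transition01 (mf n) (f01 n) t z; rewrite ger0_norm.
have trB z := @transition_cvg f B z mB mf f01 fB.
have mp : measurable_fun setT (visit_prob B).
  apply: (@measurable_fun_cvg _ _ _ setT (fun n => transition (f n) t)) => [n|z _].
    by case: (inv n).
  exact: trB.
split => //.
have h1 := @target_cvg _ _ _ (fun n => (inv n).1) mp tr1 trB.
have h2 := @target_cvg _ _ _ mf (measurable_indic mB) f1 fB.
have -> : fine (mu B) = \int[mu]_z \1_B z.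
  by rewrite /Rintegral integral_indic// setIT.
have invE : (fun n => \int[mu]_z transition (f n) t z) = (fun n => \int[mu]_z f n z).
  by apply/funext => n; exact: (inv n).2.
by rewrite invE in h1; exact: (cvg_unique (@Rhausdorff R) h1 h2).
Qed.

(** A continuous function that vanishes exactly where the coordinates satisfy the bounds, so that
    max (0, 1 - n excess) tends to the indicator. *)
Let excess (b : 'I_d -> R) (x : 'rV[R]_d) := \sum_i Num.max 0 (x 0 i - b i).

Let continuous_excess b : continuous (excess b).
Proof.
apply: continuous_sumr => i x.
apply: (@continuous_max R _ (cst 0) (fun x : 'rV[R]_d => x 0 i - b i)); first exact: cst_continuous.
by apply: continuousB; [exact: coord_continuous|exact: cst_continuous].
Qed.

Let excess_ge0 b x : 0 <= excess b x.
Proof. by apply: sumr_ge0 => i _; rewrite le_max lexx. Qed.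

Let excess_eq0 b x : (excess b x == 0) = [forall i, x 0 i <= b i].
Proof.
rewrite psumr_eq0; last by move=> i _; rewrite le_max lexx.
apply/allP/forallP => [h i|h i _].
  by have := h i (mem_index_enum _); rewrite eq_maxl subr_le0.
by rewrite /= eq_maxl subr_le0.
Qed.

Let conserved_orthant b Th : conserved (orthant b Th).
Proof.
apply: (@conserved_limit (fun n y => \1_Th y.2 * Num.max 0 (1 - n%:R * excess b y.1))).
- by rewrite measurable_orthants; apply: sub_sigma_algebra; exists b, Th.
- move=> n th x.
  apply: (@continuousM R _ (cst (\1_Th th)) (fun x => Num.max 0 (1 - n%:R * excess b x)) x).
    exact: cst_continuous.
  apply: (@continuous_max R _ (cst 0) (fun x => 1 - n%:R * excess b x)); first exact: cst_continuous.
  apply: continuousB; first exact: cst_continuous.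
  by apply: continuousM; [exact: cst_continuous|exact: continuous_excess].
- move=> n y; rewrite mulr_ge0 ?le_max ?lexx//=.
  rewrite -[leRHS]mul1r ler_pM ?le_max ?lexx// ?indicE ?lern1 ?leq_b1//.
  by rewrite ge_max ler01 gerBl mulr_ge0.
- move=> y; have [y0|y0] := eqVneq (excess b y.1) 0.
    have -> : \1_(orthant b Th) y = \1_Th y.2 :> R.
      rewrite !indicE; congr (nat_of_bool _)%:R; apply/idP/idP => /set_mem h; apply/mem_set.
        by case: h.
      by split => // i; move/eqP: y0; rewrite excess_eq0 => /forallP.
    under eq_cvg do rewrite y0 mulr0 subr0 (max_r ler01) mulr1.
    exact: cvg_cst.
  have -> : \1_(orthant b Th) y = 0 :> R.
    rewrite indicE memNset// => -[yb _].
    by move/negP: y0; apply; rewrite excess_eq0; apply/forallP.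
  have e0 : 0 < excess b y.1 by rewrite lt_neqAle eq_sym y0 excess_ge0.
  apply: cvg_near_cst; near=> n.
  rewrite max_l ?mulr0// subr_le0 -ler_pdivrMr// mul1r.
  by near: n; exact: nbhs_infty_ger.
Unshelve. all: by end_near. Qed.

Lemma visit_prob_integrable B : measurable B -> measurable_fun setT (visit_prob B) ->
  mu.-integrable setT (EFin \o visit_prob B).
Proof.
move=> mB mp; apply: (@target_integrable _ 1) => // z.
by have /andP[h0 h1] := visit_prob01 z mB; rewrite ger0_norm.
Qed.

Lemma target_measure_fin_num B : measurable B -> mu B \is a fin_num.
Proof.
move=> mB; rewrite ge0_fin_numE//; apply: le_lt_trans mu_fin.
by apply: le_measure; rewrite ?inE.
Qed.

(** Obtained from the constant function 1. It says that almost no mass is in the graveyard at time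
    t, and is what complements require. *)
Let conservedT : conserved setT.
Proof.
apply: (@conserved_limit (fun _ => cst 1)) => //.
- by move=> n th x; exact: cst_continuous.
- by move=> n y; rewrite /= ler01 lexx.
- by move=> y; rewrite indicE mem_set//; exact: cvg_cst.
Qed.

Lemma visit_prob_invariant B : measurable B -> conserved B.
Proof.
move=> mB; move: (mB); rewrite measurable_orthants.
apply: (dynkin_induction measurable_orthants setI_closed_orthants).
- exact: conservedT.
- by move=> _ [b [Th ->]]; exact: conserved_orthant.
(* The visits of the complement of S are a complement within the paths alive at t, not within the
   whole sample space; hence the recourse to [conservedT]. *)
- move=> S mS [mpS pS]; have [mpT pT] := conservedT.
  have mSC := measurableC mS.
  have pC z : visit_prob (~` S) z = visit_prob setT z - visit_prob S z.
    have : ((visit_prob setT z)%:E = (visit_prob S z)%:E + (visit_prob (~` S) z)%:E)%E.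
      rewrite !visit_probE//.
      have -> : visits setT = visits S `|` visits (~` S).
        apply/seteqP; split=> w /=; last by case=> -[y _ Zy]; exists y.
        by move=> [y _ Zy]; have [Sy|Sy] := pselect (S y); [left|right]; exists y.
      rewrite measureU//; [exact: measurable_visits|exact: measurable_visits|].
      apply/seteqP; split=> // w /= [[y Sy Zy] [y' Sy']]; rewrite Zy => -[yy'].
      by apply: Sy'; rewrite -yy'.
    by rewrite -EFinD => -[->]; rewrite addrAC subrr add0r.
  have muE : fine (mu setT) = fine (mu S) + fine (mu (~` S)).
    rewrite -fineD ?target_measure_fin_num// -measureU ?setUv//; exact: setICr.
  split.
    rewrite (_ : visit_prob (~` S) = (fun z => visit_prob setT z - visit_prob S z)); last exact/funext.
    exact: measurable_funB.
  under eq_Rintegral do rewrite pC.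
  rewrite RintegralB ?pT ?pS//; last 2 first.
  + exact: visit_prob_integrable.
  + exact: visit_prob_integrable.
  by rewrite muE addrAC subrr add0r.
- move=> F mF tF cF.
  have mUF : measurable (\bigcup_k F k) by exact: bigcupT_measurable.
  pose f n (z : E) := \sum_(0 <= k < n) visit_prob (F k) z.
  have mf n : measurable_fun setT (f n).
    by apply: measurable_sum => k; case: (cF k).
  have fp z : f n z @[n --> \oo] --> visit_prob (\bigcup_k F k) z.
    rewrite /visit_prob (_ : visits (\bigcup_k F k) = \bigcup_k visits (F k)).
      apply: fine_sigma_additive => [||k].
      - by apply: le_lt_trans (probability_le1 (P z) measurableT) _; rewrite ltry.
      - by move=> i j _ _ [w [[y Fy Zy] [y' Fy']]]; rewrite Zy => -[yy']; apply: tF => //; exists y; split => //; rewrite yy'.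
      - exact: measurable_visits.
    apply/seteqP; split=> w /=.
      by move=> [y [k _ Fy] Zy]; exists k => //; exists y.
    by move=> [k _ [y Fy Zy]]; exists y => //; exists k.
  have mp : measurable_fun setT (visit_prob (\bigcup_k F k)).
    by apply: (@measurable_fun_cvg _ _ _ setT f) => // z _; exact: fp.
  have f0 n z : 0 <= f n z by apply: sumr_ge0 => k _; case/andP: (visit_prob01 z (mF k)).
  have f1 n z : `|f n z| <= 1.
    rewrite ger0_norm//; have /andP[_ p1] := visit_prob01 z mUF; apply: le_trans p1.
    rewrite -(cvg_lim (@Rhausdorff R) (fp z)).
    apply: (@nondecreasing_cvgn_le _ (f ^~ z) _ _ n); last exact: cvgP (fp z).
    apply/nondecreasing_seqP => k; rewrite /f big_nat_recr//= lerDl.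
    by case/andP: (visit_prob01 z (mF k)).
  split => //.
  have h1 := @target_cvg _ _ _ mf mp f1 fp.
  have h2 : \sum_(0 <= k < n) fine (mu (F k)) @[n --> \oo] --> fine (mu (\bigcup_k F k)).
    by apply: fine_sigma_additive.
  have fE : (fun n => \int[mu]_z f n z) = (fun n => \sum_(0 <= k < n) fine (mu (F k))).
    apply/funext => n; elim: n => [|n IH].
      rewrite big_geq//; under eq_Rintegral do rewrite /f big_geq//.
      by rewrite Rintegral_cst// mul0r.
    rewrite big_nat_recr//= -IH -(cF n).2 -RintegralD//.
    - by apply: eq_Rintegral => z _; rewrite /f big_nat_recr.
    - exact: (@target_integrable _ 1).
    - exact: (visit_prob_integrable (mF n) (cF n).1).
  by rewrite fE in h1; exact: (cvg_unique (@Rhausdorff R) h1 h2).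
Qed.

End fixed_time.

End process.

Theorem theorem3p2 (R : realType) (d : nat) (U s : 'rV[R]_d -> R)
    (gamma : 'I_d -> 'rV[R]_d -> velocity d -> R)
    (disp : measure_display) (Omega : measurableType disp)
    (P : 'rV[R]_d * velocity d -> probability Omega R)
    (T : nat -> Omega -> \bar R)
    (Y : nat -> Omega -> 'rV[R]_d * velocity d)
    (Z : R -> Omega -> option ('rV[R]_d * velocity d))
    (Phi : R -> 'rV[R]_d * velocity d -> 'rV[R]_d)
    (tstar : 'rV[R]_d * velocity d -> \bar R)
    (d_gt0 : (0 < d)%N)
    (U_C1 : C1 U)
    (H_fin : (\int[lebesgue_rV R d]_x (expR (- U x))%:E < +oo)%E)
    (s_C2 : C2 s)
    (s_gt0 : forall x, 0 < s x)
    (gamma_rates : refresh_rates gamma)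
    (Z_suzz : suzz_process T Y s (suzz_rate U s gamma) P Z Phi tstar)
    (hyp1 : exists gbar : R,
      [/\ forall i x th th', gamma i x th = gamma i x th',
          forall i x th, gamma i x th <= gbar &
          exists Rad A : R, [/\ 0 < Rad, 0 < A,
            forall x, ~ (eucl_norm x < Rad) -> A < \sum_i `|drift U s i x| &
            Num.max (3 * d%:R * gbar) (4 * d%:R * (d%:R - 1) * gbar) < A]])
    (hyp2 : exists n : nat, (0 < n)%N /\
      (iter_log n (s x * \sum_i `|partial i (fun y => U y - ln (s y)) x|)
         / (U x - ln (s x))) @[x --> eucl_infty] --> (0 : R))
    (hyp3_C1 : forall j, C1 (drift U s j))
    (hyp3 : forall delta : R, 0 < delta ->
      (\sum_i \sum_j s x / (\sum_k `|drift U s k x|) *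
         (`|partial i (drift U s j) x| /
           ((1 + `|drift U s j x|) * (1 + ln (1 + delta * `|drift U s j x|)))))
        @[x --> eucl_infty] --> (0 : R))
    (hyp4 : (eucl_norm x ^+ d.-1 * s x * expR (- U x)) @[x --> eucl_infty]
       --> (0 : R)) :
  invariant_measure P Z (target_measure U_C1).
Proof.
have [gbar [gamma_indep gamma_le _]] := hyp1.
have [gamma_ge0 _ _ gamma_measurable _] := gamma_rates.
pose reg : regular_suzz U s gamma gbar := Build_regular_suzz U_C1 s_C2.1 s_gt0
  gamma_ge0 gamma_measurable gamma_indep gamma_le.
move=> t B t0 mB.
have [mp pB] := visit_prob_invariant d_gt0 reg Z_suzz H_fin hyp4 t0 mB.
have p_int := visit_prob_integrable d_gt0 reg Z_suzz H_fin t0 mB mp.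
transitivity (\int[target_measure U_C1]_z (visit_prob P Z t B z)%:E)%E.
  by apply: eq_integral => z _; rewrite (visit_probE d_gt0 reg Z_suzz t0 z mB).
have -> : target_measure U_C1 B = (fine (target_measure U_C1 B))%:E.
  by rewrite fineK// (target_measure_fin_num reg H_fin).
by rewrite -pB /Rintegral fineK//; exact: (integrable_fin_num _ p_int).
Qed.
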